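(* Let $0<\varepsilon<\frac1{16}$, $s\ge-\frac12-\varepsilon$ and $0<\gamma\le\varepsilon$. There is a constant $C>0$, independent of $T$, $u$ and $v$, such that for all $T>0$, $$\|(uv)_x\|_{X^{s,-\frac12+\gamma}_T}\le C\,\|u\|_{X^{s,\frac12-\varepsilon}_T}\,\|v\|_{X^{s,\frac12-\varepsilon}_T}$$ for all $u,v\in X^{s,\frac12-\varepsilon}_T$ with spatial mean zero (at each time).
   Context: $x\in\mathbb T=\mathbb R/2\pi\mathbb Z$, $\tilde u(n,\tau)$ is the space-time Fourier transform, $\langle a\rangle=(1+|a|^2)^{1/2}$. For $s,b\in\mathbb R$, $$\|u\|_{X^{s,b}}=\Big(\int_{\mathbb R}\sum_{n\in\mathbb Z}\langle n\rangle^{2s}\langle i(\tau-n^3)+n^2\rangle^{2b}|\tilde u(n,\tau)|^2\,d\tau\Big)^{1/2},$$ and for $T>0$, $$\|u\|_{X^{s,b}_T}=\inf\{\|v\|_{X^{s,b}}:\ v\in X^{s,b},\ v(t)=u(t)\text{ for }t\in[0,T]\}.$$ *)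

(* Defs.v *)
From HB Require Import structures.
From mathcomp Require Import all_boot all_order all_algebra.
From mathcomp Require Export complex.
From mathcomp Require Export all_classical all_reals all_analysis.

Set Implicit Arguments.
Unset Strict Implicit.
Unset Printing Implicit Defensive.

Import Order.TTheory GRing.Theory Num.Theory.
Import numFieldNormedType.Exports.

Local Open Scope classical_set_scope.
Local Open Scope ring_scope.
Local Open Scope complex_scope.

(** * Complex-valued integration *)

Section ComplexIntegral.
Context {d : measure_display} {T : measurableType d} {R : realType}.

Definition cmeasurable (D : set T) (f : T -> R[i]) : Prop :=
  measurable_fun D (fun x => complex.Re (f x)) /\
  measurable_fun D (fun x => complex.Im (f x)).

Definition cintegral (mu : {measure set T -> \bar R}) (D : set T)
    (f : T -> R[i]) : R[i] :=
  Rintegral mu D (fun x => complex.Re (f x)) +i*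
  Rintegral mu D (fun x => complex.Im (f x)).

Definition square_integrable (mu : {measure set T -> \bar R}) (D : set T)
    (f : T -> R[i]) : Prop :=
  cmeasurable D f /\
  (\int[mu]_(x in D) ((ComplexField.Normc.normc (f x)) ^+ 2)%:E < +oo)%E.

End ComplexIntegral.

Definition cis {R : realType} (y : R) : R[i] := cos y +i* sin y.

(** * Distributions on (open time interval) x (R / 2 pi Z) *)

(* Real-valued smooth functions with compact support in the open set [I]. *)
Definition test_function {R : realType} (I : set R) (psi : R -> R) : Prop :=
  (forall (k : nat) (t : R), derivable (derive1n k psi) t 1) /\
  exists K : set R, [/\ compact K, K `<=` I & forall t, ~ K t -> psi t = 0].

(* The value [U n psi] stands for the pairing of the distribution [U] with the
   test function (t, x) |-> psi t * e^{- i n x}; linear combinations of these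
   are dense in the test functions on I x (R / 2 pi Z), so they determine [U].
   Equivalently, [U n] is the [n]-th spatial Fourier coefficient of [U], as a
   distribution in time.  Only the values at test functions of the relevant
   time interval are meaningful: distributions are compared by
   [eq_distr_on].  Linearity and continuity in [psi] are not bundled: they
   follow on [I] from the existence of an extension whose Fourier transform has
   finite norm, which is part of the membership in the spaces below. *)
Definition distr (R : realType) : Type := int -> (R -> R) -> R[i].

Definition eq_distr_on {R : realType} (I : set R) (U V : distr R) : Prop :=
  forall n psi, test_function I psi -> U n psi = V n psi.

Definition distr_of_fun {R : realType} (I : set R) (a : R * R -> R[i]) :
    distr R := fun n psi =>
  cintegral (@lebesgue_measure R \x @lebesgue_measure R)%E
    (I `*` `]0, pi *+ 2[)
    (fun tx => a tx * (psi tx.1)%:C * cis (- (n%:~R * tx.2))).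

(* < d/dx U, psi e^{- i n x} > = - < U, psi d/dx (e^{- i n x}) > *)
Definition distr_dx {R : realType} (U : distr R) : distr R := fun n psi =>
  (0 +i* n%:~R) * U n psi.

Definition spatial_mean_zero {R : realType} (I : set R) (U : distr R) : Prop :=
  forall psi, test_function I psi -> U 0 psi = 0.

(* [W] is the product [U V] on [I]: both factors are square integrable
   functions there, and the product is the pointwise one (which is integrable).
   The representatives, hence [W] on [I], are unique up to null sets. *)
Definition is_product_on {R : realType} (I : set R) (U V W : distr R) : Prop :=
  exists a b : R * R -> R[i],
    [/\ square_integrable (@lebesgue_measure R \x @lebesgue_measure R)%E
          (I `*` `]0, pi *+ 2[) a,
        square_integrable (@lebesgue_measure R \x @lebesgue_measure R)%E
          (I `*` `]0, pi *+ 2[) b,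
        eq_distr_on I U (distr_of_fun I a),
        eq_distr_on I V (distr_of_fun I b) &
        eq_distr_on I W (distr_of_fun I (fun tx => a tx * b tx))].

(** * Bourgain spaces of the KdV-Burgers equation *)

Definition japanese {R : realType} (a : R[i]) : R :=
  Num.sqrt (1 + ComplexField.Normc.normc a ^+ 2).

(* Normalization: f (n, tau) = \int \int u (t, x) e^{- i (n x + tau t)} dx dt,
   so that by duality < u, psi e^{- i n x} > is the integral over tau of
   f (n, tau) times (2 pi)^-1 \int psi t e^{i tau t} dt. *)
Definition inverse_fourier {R : realType} (psi : R -> R) (tau : R) : R[i] :=
  ((pi *+ 2)^-1)%:C *
  cintegral (@lebesgue_measure R) setT (fun t => (psi t)%:C * cis (tau * t)).

(* When f (n, .) * inverse_fourier psi is not integrable, the integral below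
   is a junk value; this cannot occur when [XFnorm s b f] is finite. *)
Definition is_spacetime_fourier {R : realType} (U : distr R)
    (f : int -> R -> R[i]) : Prop :=
  (forall n, cmeasurable [set: R] (f n)) /\
  forall n psi, test_function setT psi ->
    U n psi = cintegral (@lebesgue_measure R) setT
                (fun tau => f n tau * inverse_fourier psi tau).

Definition XFnorm {R : realType} (s b : R) (f : int -> R -> R[i]) : \bar R :=
  ((\int[@lebesgue_measure R]_(tau in [set: R])
     \esum_(n in [set: int])
       (japanese (n%:~R : R[i]) `^ (2 * s) *
        japanese (n%:~R ^+ 2 +i* (tau - n%:~R ^+ 3)) `^ (2 * b) *
        ComplexField.Normc.normc (f n tau) ^+ 2)%:E) `^ (2^-1))%E.

(* The space-time Fourier transform is unique almost everywhere, so this is an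
   infimum over one value, or +oo when the Fourier transform of [U] is not a
   function; [U] belongs to X^{s,b} when it is finite. *)
Definition Xnorm {R : realType} (s b : R) (U : distr R) : \bar R :=
  ereal_inf [set XFnorm s b f | f in is_spacetime_fourier U].

Definition inX {R : realType} (s b : R) (U : distr R) : Prop :=
  (Xnorm s b U < +oo)%E.

Definition XTnorm {R : realType} (s b T : R) (u : distr R) : \bar R :=
  ereal_inf [set Xnorm s b v | v in
    [set v | inX s b v /\ eq_distr_on `]0, T[ v u]].

Definition inXT {R : realType} (s b T : R) (u : distr R) : Prop :=
  (XTnorm s b T u < +oo)%E.

(* Main.v *)
From HB Require Import structures.
Require Import Defs.
From mathcomp Require Import all_boot all_order all_algebra.
From mathcomp Require Import all_classical all_reals all_analysis.
From mathcomp Require Import measurable_realfun complex ring lra zify.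

Set Implicit Arguments.
Unset Strict Implicit.
Unset Printing Implicit Defensive.

Import Order.TTheory GRing.Theory Num.Theory.
Import numFieldNormedType.Exports.
Local Open Scope classical_set_scope.
Local Open Scope ring_scope.

(** Write [y = (n, tau)] for a space-time frequency, [tau - n^3] for its detuning
    and [w = <i (tau - n^3) + n^2>] for its modulation. A distribution of finite
    norm has a spectrum [f], and the norm is a weighted [L^2] norm of [f]; the
    weight is bounded below, because [n^2] is controlled by [w], so [f] is square
    integrable. As the spatial means vanish on the time interval, the mode [n = 0]
    of [f] can be removed without changing the distribution there and without
    increasing the norm. If [u] and [v] have the spectra [f] and [g], then
    [(uv)_x] has the spectrum [i n (2 pi)^-2 (f * g)], and the theorem follows
    from an estimate on convolutions in frequency space, in which the time
    interval no longer appears; hence a constant independent of [T].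

    The convolution estimate ([bilinear_estimate]) rests on the resonance identity:
    if [x = y + z], the detunings of [y] and [z] minus that of [x] add up to three
    times the product of the three spatial frequencies. For nonzero frequencies
    the largest of the three modulations therefore dominates that product
    ([spatial_product_le]), and its power [1 - 2 eps] pays for the derivative and
    for the negative Sobolev exponents up to a loss of size [eps]. What remains
    are the powers of the two other modulations. Part of them is converted into
    decay in a spatial frequency by [n^2 <= w], leaving a kernel that is summable
    in [n] and integrable in [tau] with the exponent [(4 - 16 eps) / 3], larger
    than 1 since [eps < 1 / 16] ([multiplier_bound]). The Cauchy-Schwarz
    inequality concludes, in a form that depends on which modulation is the
    largest ([trilinear_bound_output], [trilinear_bound_left],
    [trilinear_bound_right]).

    The other half of the proof identifies products of functions on the cylinder
    [(0, T) x (0, 2 pi)] with convolutions of spectra. For integrable spectra the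
    inverse transform [synth] is an honest integral and the product formula is
    Fubini's theorem ([synth_product_pairing]). A Bessel inequality on the cylinder
    ([synth_bessel]) extends synthesis to square integrable spectra as a limit in
    the mean ([synthesizes_ex]), and the product formula passes to the limit
    ([synthesizes_product]); in particular the product exists. Since the product
    is defined through arbitrary representatives, it remains to see that a
    function on the cylinder is determined by its pairings with [psi t e^{-inx}]
    ([density_ae_eq0]): smooth bumps in time and explicit trigonometric
    polynomials in space converge to indicators of half lines, so the integral
    vanishes over all quadrants, hence over all measurable sets. *)

Notation normc := ComplexField.Normc.normc.
Notation Re := complex.Re.
Notation Im := complex.Im.

(** * Complex-valued integration *)

Section complex_modulus.
Context {R : realType}.
Local Open Scope complex_scope.
Implicit Types z w : R[i].

Lemma normc_ge0 z : 0 <= normc z.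
Proof. by case: z => a b; exact: sqrtr_ge0. Qed.

Lemma sqr_normcE z : normc z ^+ 2 = Re z ^+ 2 + Im z ^+ 2.
Proof. by case: z => a b; rewrite sqr_sqrtr// addr_ge0 ?sqr_ge0. Qed.

Lemma ler_Re_normc z : `|Re z| <= normc z.
Proof.
rewrite -(@ler_pXn2r _ 2) ?nnegrE ?normc_ge0// sqr_normcE real_normK ?num_real//.
by rewrite lerDl sqr_ge0.
Qed.

Lemma ler_Im_normc z : `|Im z| <= normc z.
Proof.
rewrite -(@ler_pXn2r _ 2) ?nnegrE ?normc_ge0// sqr_normcE real_normK ?num_real//.
by rewrite lerDr sqr_ge0.
Qed.

Lemma ler_normc_ReIm z : normc z <= `|Re z| + `|Im z|.
Proof.
rewrite -(@ler_pXn2r _ 2) ?nnegrE ?normc_ge0 ?addr_ge0// sqr_normcE.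
rewrite sqrrD !real_normK ?num_real// addrAC lerDl.
by rewrite mulrn_wge0// mulr_ge0.
Qed.

Lemma normcM z w : normc (z * w) = normc z * normc w.
Proof. exact: ComplexField.Normc.normcM. Qed.

Lemma ler_normcD z w : normc (z + w) <= normc z + normc w.
Proof. exact: complex.le_normcD. Qed.

Lemma normcN z : normc (- z) = normc z.
Proof. by case: z => a b /=; rewrite !sqrrN. Qed.

Lemma ler_normcB z w : normc (z - w) <= normc z + normc w.
Proof. by rewrite (le_trans (ler_normcD _ _))// normcN. Qed.

Lemma normc_real (x : R) : normc (x%:C) = `|x|.
Proof. by rewrite /= expr0n/= addr0 sqrtr_sqr. Qed.

Lemma normc_conj z : normc z^* = normc z.
Proof. by case: z => a b /=; rewrite sqrrN. Qed.

Lemma normc0_eq0 z : normc z = 0 -> z = 0.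
Proof. exact: ComplexField.Normc.eq0_normc. Qed.

Lemma mulc_conj z : z * z^* = (normc z ^+ 2)%:C.
Proof.
rewrite sqr_normcE; case: z => a b /=.
by rewrite /GRing.mul/=; congr (_ +i* _); ring.
Qed.

Lemma normc_cis (y : R) : normc (cis y) = 1.
Proof. by rewrite /cis /= cos2Dsin2 sqrtr1. Qed.

Lemma cisD (x y : R) : cis (x + y) = cis x * cis y.
Proof. by rewrite /cis cosD sinD /GRing.mul/=; congr (_ +i* _); rewrite addrC. Qed.

Lemma cis0 : cis 0 = 1 :> R[i].
Proof. by rewrite /cis cos0 sin0. Qed.

Lemma conj_cis (x : R) : (cis x)^* = cis (- x).
Proof. by rewrite /cis cosN sinN. Qed.

End complex_modulus.

Section complex_integral.
Context {R : realType} {d : measure_display} {T : measurableType d}.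
Local Open Scope complex_scope.
Implicit Types f g : T -> R[i].

Lemma ReMc (z w : R[i]) : Re (z * w) = Re z * Re w - Im z * Im w.
Proof. by case: z w => [a b] [c e]. Qed.

Lemma ImMc (z w : R[i]) : Im (z * w) = Re z * Im w + Im z * Re w.
Proof. by case: z w => [a b] [c e]. Qed.

Lemma ReDc (z w : R[i]) : Re (z + w) = Re z + Re w.
Proof. by case: z w => [a b] [c e]. Qed.

Lemma ImDc (z w : R[i]) : Im (z + w) = Im z + Im w.
Proof. by case: z w => [a b] [c e]. Qed.

Lemma ReNc (z : R[i]) : Re (- z) = - Re z.
Proof. by case: z. Qed.

Lemma ImNc (z : R[i]) : Im (- z) = - Im z.
Proof. by case: z. Qed.

Lemma complex_eta (z : R[i]) : Re z +i* Im z = z.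
Proof. by case: z. Qed.

Notation cmeas f := (cmeasurable setT f).

Lemma cmeasurable_cst (z : R[i]) : cmeas (fun _ : T => z).
Proof. by split; exact: measurable_cst. Qed.

Lemma cmeasurable_real (f : T -> R) : measurable_fun setT f ->
  cmeas (fun x => (f x)%:C).
Proof. by move=> mf; split=> //=; exact: measurable_cst. Qed.

Lemma cmeasurableD f g : cmeas f -> cmeas g -> cmeas (fun x => f x + g x).
Proof.
move=> [f1 f2] [g1 g2]; split.
  under eq_fun do rewrite ReDc; exact: measurable_funD.
under eq_fun do rewrite ImDc; exact: measurable_funD.
Qed.

Lemma cmeasurableN f : cmeas f -> cmeas (fun x => - f x).
Proof.
move=> [f1 f2]; split.
  under eq_fun do rewrite ReNc; exact: measurable_funN.
under eq_fun do rewrite ImNc; exact: measurable_funN.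
Qed.

Lemma cmeasurableB f g : cmeas f -> cmeas g -> cmeas (fun x => f x - g x).
Proof. by move=> mf mg; apply: cmeasurableD => //; exact: cmeasurableN. Qed.

Lemma cmeasurableM f g : cmeas f -> cmeas g -> cmeas (fun x => f x * g x).
Proof.
move=> [f1 f2] [g1 g2]; split.
  by under eq_fun do rewrite ReMc; apply: measurable_funB; exact: measurable_funM.
by under eq_fun do rewrite ImMc; apply: measurable_funD; exact: measurable_funM.
Qed.

Lemma cmeasurable_conj f : cmeas f -> cmeas (fun x => (f x)^*).
Proof.
move=> [f1 f2]; split.
  by have -> : (fun x => Re (f x)^*) = (fun x => Re (f x)) by apply/funext => x/=; case: (f x).
have -> : (fun x => Im (f x)^*) = \- (fun x => Im (f x)).
  by apply/funext => x/=; case: (f x).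
exact: measurable_funN.
Qed.

Lemma cmeasurable_cis (h : T -> R) : measurable_fun setT h -> cmeas (fun x => cis (h x)).
Proof.
move=> mh; split => /=.
  by apply: (measurableT_comp _ mh); apply: continuous_measurable_fun; exact: continuous_cos.
by apply: (measurableT_comp _ mh); apply: continuous_measurable_fun; exact: continuous_sin.
Qed.

Lemma cmeasurable_comp d' (U : measurableType d') (f : U -> R[i]) (h : T -> U) :
  cmeasurable setT f -> measurable_fun setT h -> cmeas (fun x => f (h x)).
Proof.
move=> [f1 f2] mh; split.
  exact: (measurableT_comp f1 mh).
exact: (measurableT_comp f2 mh).
Qed.

Lemma measurable_normc f : cmeas f -> measurable_fun setT (fun x => normc (f x)).
Proof.
move=> [f1 f2].
have -> : (fun x => normc (f x)) =
    (fun x => Num.sqrt (Re (f x) ^+ 2 + Im (f x) ^+ 2)).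
  by apply/funext => x; case: (f x).
have -> : (fun x => Num.sqrt (Re (f x) ^+ 2 + Im (f x) ^+ 2)) =
    (fun x => (Re (f x) ^+ 2 + Im (f x) ^+ 2) `^ (2^-1)).
  by apply/funext => x; rewrite powR12_sqrt// addr_ge0 ?sqr_ge0.
apply: (measurableT_comp (measurable_powR _)).
by apply: measurable_funD; exact: measurable_funX.
Qed.

Variable mu : {measure set T -> \bar R}.
Notation cint f := (cintegral mu setT f).

Definition cintegrable (f : T -> R[i]) : Prop :=
  cmeas f /\ (\int[mu]_x (normc (f x))%:E < +oo)%E.

Lemma le_cintegrable f (h : T -> R) : cmeas f ->
  measurable_fun setT h -> (forall x, normc (f x) <= h x) ->
  (\int[mu]_x (h x)%:E < +oo)%E -> cintegrable f.
Proof.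
move=> mf mh fh hoo; split=> //; apply: le_lt_trans hoo.
apply: ge0_le_integral => //.
- by move=> x _; rewrite lee_fin normc_ge0.
- by apply/measurable_EFinP; exact: measurable_normc.
- by apply/measurable_EFinP.
- by move=> x _; rewrite lee_fin.
Qed.

Lemma cintegrable_Re f : cintegrable f -> mu.-integrable setT (EFin \o (fun x => Re (f x))).
Proof.
move=> [[f1 f2] foo]; apply/integrableP; split; first exact/measurable_EFinP.
apply: le_lt_trans foo; apply: ge0_le_integral => //.
- by apply: measurableT_comp => //; exact/measurable_EFinP.
- by apply/measurable_EFinP; exact: measurable_normc.
- by move=> x _; rewrite lee_fin ler_Re_normc.
Qed.

Lemma cintegrable_Im f : cintegrable f -> mu.-integrable setT (EFin \o (fun x => Im (f x))).
Proof.
move=> [[f1 f2] foo]; apply/integrableP; split; first exact/measurable_EFinP.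
apply: le_lt_trans foo; apply: ge0_le_integral => //.
- by apply: measurableT_comp => //; exact/measurable_EFinP.
- by apply/measurable_EFinP; exact: measurable_normc.
- by move=> x _; rewrite lee_fin ler_Im_normc.
Qed.

Lemma cintegrableD f g : cintegrable f -> cintegrable g ->
  cintegrable (fun x => f x + g x).
Proof.
move=> [mf foo] [mg goo].
apply: (@le_cintegrable _ (fun x => normc (f x) + normc (g x))).
- exact: cmeasurableD.
- by apply: measurable_funD; exact: measurable_normc.
- by move=> x; exact: ler_normcD.
- under eq_integral do rewrite EFinD.
  rewrite ge0_integralD//; first exact: lte_add_pinfty.
  - by move=> x _; rewrite lee_fin normc_ge0.
  - by apply/measurable_EFinP; exact: measurable_normc.
  - by move=> x _; rewrite lee_fin normc_ge0.
  - by apply/measurable_EFinP; exact: measurable_normc.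
Qed.

Lemma cintegrableMl (K : R) f g : cmeas g -> (forall x, normc (g x) <= K) ->
  cintegrable f -> cintegrable (fun x => g x * f x).
Proof.
move=> mg gK [mf foo].
have K0 (x : T) : 0 <= K by rewrite (le_trans _ (gK x))// normc_ge0.
apply: (@le_cintegrable _ (fun x => `|K| * normc (f x))).
- exact: cmeasurableM.
- by apply: measurable_funM => //; exact: measurable_normc.
- by move=> x; rewrite normcM ler_wpM2r ?normc_ge0// ger0_norm ?K0 ?gK.
- under eq_integral do rewrite EFinM.
  rewrite ge0_integralZl_EFin//.
  + by rewrite lte_mul_pinfty.
  + by move=> x _; rewrite lee_fin normc_ge0.
  + by apply/measurable_EFinP; exact: measurable_normc.
Qed.

Lemma cintegrableZ (z : R[i]) f : cintegrable f -> cintegrable (fun x => z * f x).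
Proof. by apply: (@cintegrableMl (normc z)) => //; exact: cmeasurable_cst. Qed.

Lemma eq_cintegral f g : f =1 g -> cint f = cint g.
Proof. by move=> /funext ->. Qed.

Lemma cintegralD f g : cintegrable f -> cintegrable g ->
  cint (fun x => f x + g x) = cint f + cint g.
Proof.
move=> fi gi; rewrite /cintegral.
under eq_Rintegral do rewrite ReDc.
under [X in _ +i* X]eq_Rintegral do rewrite ImDc.
rewrite !RintegralD//; [exact: cintegrable_Im|exact: cintegrable_Im|
 exact: cintegrable_Re|exact: cintegrable_Re].
Qed.

Lemma cintegralZ (z : R[i]) f : cintegrable f -> cint (fun x => z * f x) = z * cint f.
Proof.
move=> fi; have fr := cintegrable_Re fi; have fm := cintegrable_Im fi.
case: z => a b; rewrite /cintegral.
have Zi (k : R) (h : T -> R) : mu.-integrable setT (EFin \o h) ->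
    mu.-integrable setT (EFin \o (fun x => k * h x)).
  by move=> /(integrableZl measurableT k).
under eq_Rintegral do rewrite ReMc.
under [X in _ +i* X]eq_Rintegral do rewrite ImMc.
rewrite RintegralB// ?RintegralD ?RintegralZl//; exact: Zi.
Qed.

Lemma cintegralN f : cintegrable f -> cint (fun x => - f x) = - cint f.
Proof.
move=> fi; under eq_cintegral do rewrite -mulN1r.
by rewrite cintegralZ// mulN1r.
Qed.

Lemma cintegrableN f : cintegrable f -> cintegrable (fun x => - f x).
Proof.
move=> [mf foo]; split; first exact: cmeasurableN.
by under eq_integral do rewrite normcN.
Qed.

Lemma cintegralB f g : cintegrable f -> cintegrable g ->
  cint (fun x => f x - g x) = cint f - cint g.
Proof.
by move=> fi gi; rewrite cintegralD ?cintegralN//; exact: cintegrableN.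
Qed.

Lemma cintegral_conj f : cintegrable f -> cint (fun x => (f x)^*) = (cint f)^*.
Proof.
move=> fi; rewrite /cintegral/=; congr (_ +i* _).
  by apply: eq_Rintegral => x _; case: (f x).
rewrite -[RHS]mulN1r -RintegralZl//; last exact: cintegrable_Im.
by apply: eq_Rintegral => x _; case: (f x) => a b /=; rewrite mulN1r.
Qed.

(** The sharp constant is 1; bounding the real and the imaginary part
    separately is simpler and loses a harmless factor 2. *)
Lemma normc_cintegral_le f : cmeas f ->
  ((normc (cint f))%:E <= 2%:E * \int[mu]_x (normc (f x))%:E)%E.
Proof.
move=> mf; have [foo|] := ltP (\int[mu]_x (normc (f x))%:E)%E +oo%E; last first.
  by rewrite leye_eq => /eqP ->; rewrite gt0_muley ?leey ?lte_fin.
have fi : cintegrable f by split.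
have R1 (h : T -> R) : measurable_fun setT h -> mu.-integrable setT (EFin \o h) ->
    (forall x, `|h x| <= normc (f x)) ->
    (`|\int[mu]_x h x|%R%:E <= \int[mu]_x (normc (f x))%:E)%E.
  move=> mh hi hf; rewrite -(@fineK _ (\int[mu]_x (normc (f x))%:E)%E); last first.
    by rewrite ge0_fin_numE// integral_ge0// => x _; rewrite lee_fin normc_ge0.
  rewrite lee_fin; apply: le_trans (le_normr_Rintegral measurableT hi) _.
  apply: le_Rintegral => //.
  - exact: (integrable_norm).
  - apply/integrableP; split; first exact/measurable_EFinP/measurable_normc.
    by under eq_integral do rewrite /= ger0_norm ?normc_ge0//.
have {}R1 := (R1 (fun x => Re (f x)) (proj1 mf) (cintegrable_Re fi)
  (fun x => ler_Re_normc _), R1 (fun x => Im (f x)) (proj2 mf) (cintegrable_Im fi)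
  (fun x => ler_Im_normc _)).
apply: le_trans (_ : (`|\int[mu]_x Re (f x)|%R + `|\int[mu]_x Im (f x)|%R)%:E <= _)%E.
  by rewrite lee_fin (le_trans (ler_normc_ReIm _)).
rewrite EFinD (_ : 2%:E = 1%:E + 1%:E)%E; last by rewrite -EFinD.
rewrite ge0_muleDl ?mul1e ?lee_fin//.
by apply: leeD; [exact: R1.1|exact: R1.2].
Qed.

End complex_integral.
Arguments cintegrable {R d T}.

(** A named copy of the product measure, on which the sigma-finite structure can
    be registered, so that products can be iterated. *)
Section prod_measure.
Context {R : realType} {d1 d2 : measure_display}
  {T1 : measurableType d1} {T2 : measurableType d2}.
Variables (m1 : {sigma_finite_measure set T1 -> \bar R})
  (m2 : {sigma_finite_measure set T2 -> \bar R}).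

Definition prod_measure : set (T1 * T2) -> \bar R := (m1 \x m2)%E.
HB.instance Definition _ := Measure.on prod_measure.

Let prod_measure_sigma_finite : sigma_finite setT prod_measure.
Proof.
have /sigma_finiteP[F [TF ndF Foo]] := sigma_finiteT m1.
have /sigma_finiteP[G [TG ndG Goo]] := sigma_finiteT m2.
exists (fun n => F n `*` G n).
  rewrite -setXTT TF TG predeqE => -[x y]; split.
    move=> [/= [n _ Fnx] [k _ Gky]]; exists (maxn n k) => //; split.
    - by move: x Fnx; exact/subsetPset/ndF/leq_maxl.
    - by move: y Gky; exact/subsetPset/ndG/leq_maxr.
  by move=> [n _ []/= ? ?]; split; exists n.
move=> k; have [? ?] := Foo k; have [? ?] := Goo k.
split; first exact: measurableX.
by rewrite /prod_measure product_measure1E// lte_mul_pinfty// ge0_fin_numE.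
Qed.
HB.instance Definition _ :=
  Measure_isSigmaFinite.Build _ _ _ prod_measure prod_measure_sigma_finite.

End prod_measure.
Arguments prod_measure {R d1 d2 T1 T2} m1 m2.

Section complex_fubini.
Context {R : realType} {d1 d2 : measure_display}
  {T1 : measurableType d1} {T2 : measurableType d2}.
Variables (m1 : {sigma_finite_measure set T1 -> \bar R})
  (m2 : {sigma_finite_measure set T2 -> \bar R}).
Local Open Scope complex_scope.

Lemma measurable_Rintegral_prod (h : T1 * T2 -> R) : measurable_fun setT h ->
  measurable_fun setT (fun x => Rintegral m2 setT (fun y => h (x, y))).
Proof.
move=> mh.
have mfine : measurable_fun [set: \bar R] (@fine R) by exact: fine_measurable.
apply: (measurableT_comp mfine).
have mE : measurable_fun setT (fun z => (h z)%:E) by exact/measurable_EFinP.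
have -> : (fun x => \int[m2]_y (h (x, y))%:E)%E =
  (fun x => fubini_F m2 ((fun z => (h z)%:E)^\+)%E x -
            fubini_F m2 ((fun z => (h z)%:E)^\-)%E x)%E.
  apply/funext => x; rewrite integralE; congr (_ - _)%E.
    by apply: eq_integral => y _; rewrite !funeposE.
  by apply: eq_integral => y _; rewrite !funenegE.
apply: emeasurable_funB.
  by apply: measurable_fun_fubini_tonelli_F => //; exact: measurable_funepos.
by apply: measurable_fun_fubini_tonelli_F => //; exact: measurable_funeneg.
Qed.

Lemma cmeasurable_cintegral_prod (F : T1 * T2 -> R[i]) : cmeasurable setT F ->
  cmeasurable setT (fun x => cintegral m2 setT (fun y => F (x, y))).
Proof.
by move=> [F1 F2]; split;
  [exact: (measurable_Rintegral_prod F1)|exact: (measurable_Rintegral_prod F2)].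
Qed.

Lemma cintegrable_prod (F : T1 * T2 -> R[i]) : cmeasurable setT F ->
  (\int[m1]_x \int[m2]_y (normc (F (x, y)))%:E < +oo)%E ->
  cintegrable (prod_measure m1 m2) F.
Proof.
move=> mF Foo; split=> //; rewrite /prod_measure.
rewrite fubini_tonelli1//; last by move=> x; rewrite lee_fin normc_ge0.
by apply/measurable_EFinP; exact: measurable_normc.
Qed.

Lemma Rfubini (h : T1 * T2 -> R) : (m1 \x m2)%E.-integrable setT (EFin \o h) ->
  Rintegral m1 setT (fun x => Rintegral m2 setT (fun y => h (x, y))) =
  Rintegral m2 setT (fun y => Rintegral m1 setT (fun x => h (x, y))).
Proof.
move=> hi; rewrite /Rintegral; congr fine.
transitivity (\int[m1]_x fubini_F m2 (EFin \o h) x)%E.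
  have iF := integrable_fubini_F hi.
  apply: ae_eq_integral => //.
  - have /integrableP[mh _] := hi.
    move: mh => /measurable_EFinP mh.
    by apply/measurable_EFinP; exact: measurable_Rintegral_prod.
  - by have /integrableP[] := iF.
  - have := integrable_ae measurableT iF.
    by apply: filterS => x /(_ I) fx _; rewrite fineK.
transitivity (\int[m2]_x fubini_G m1 (EFin \o h) x)%E.
  exact: (Fubini hi).
have iG : m2.-integrable setT (fubini_G m1 (EFin \o h)).
  have mE : measurable_fun setT (EFin \o h) := measurable_int _ hi.
  apply/integrableP; split; first exact: (@measurable_fubini_G _ _ _ _ _ m1 m2 _ hi).
  apply: le_lt_trans ((integrable21ltyP m1 m2 mE).1 hi).
  apply: ge0_le_integral => //.
  - by apply: measurableT_comp => //; exact: (@measurable_fubini_G _ _ _ _ _ m1 m2 _ hi).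
  - apply: (@measurable_fun_fubini_tonelli_G _ _ _ _ _ m1 (abse \o (EFin \o h))) => //.
      exact: measurableT_comp.
    by move=> z; exact: abse_ge0.
  - move=> y _; apply: le_abse_integral => //.
    exact: (measurableT_comp mE).
apply: ae_eq_integral => //.
- by have /integrableP[] := iG.
- have -> : (fun x => (fine (\int[m1]_x0 (h (x0, x))%:E))%:E)%E =
     EFin \o (fine \o fubini_G m1 (EFin \o h)) by [].
  apply/measurable_EFinP; apply: measurableT_comp; first exact: fine_measurable.
  by have /integrableP[] := iG.
- have := integrable_ae measurableT iG.
  by apply: filterS => x /(_ I) fx _; rewrite fineK.
Qed.

Lemma cfubini (F : T1 * T2 -> R[i]) : cmeasurable setT F ->
  (\int[m1]_x \int[m2]_y (normc (F (x, y)))%:E < +oo)%E ->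
  cintegral m1 setT (fun x => cintegral m2 setT (fun y => F (x, y))) =
  cintegral m2 setT (fun y => cintegral m1 setT (fun x => F (x, y))).
Proof.
move=> mF Foo; have Fi := cintegrable_prod mF Foo.
rewrite /cintegral/=; congr (_ +i* _).
  exact: (Rfubini (cintegrable_Re Fi)).
exact: (Rfubini (cintegrable_Im Fi)).
Qed.

End complex_fubini.

Section cauchy_schwarz.
Context {R : realType} {d : measure_display} {T : measurableType d}.
Variable mu : {measure set T -> \bar R}.
Local Open Scope ereal_scope.

Lemma poweR2 (x : \bar R) : 0 <= x -> x `^ 2 = x * x.
Proof.
case: x => [r| |]//= r0; last by rewrite mulyy pnatr_eq0.
by rewrite powR_mulrn// expr2 EFinM.
Qed.

Lemma integral_sqr_mul_le (f g : T -> R) :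
  measurable_fun setT f -> measurable_fun setT g ->
  (forall x, (0 <= f x)%R) -> (forall x, (0 <= g x)%R) ->
  (\int[mu]_x (f x * g x)%:E) `^ 2 <=
   (\int[mu]_x (f x ^+ 2)%:E) * (\int[mu]_x (g x ^+ 2)%:E).
Proof.
move=> mf mg f0 g0.
have sq (h : T -> R) : measurable_fun setT h -> (forall x, (0 <= h x)%R) ->
   'N[mu]_(2%:E)[EFin \o h] `^ 2 = \int[mu]_x (h x ^+ 2)%:E.
  move=> mh h0; rewrite powR_Lnorm//; apply: eq_integral => x _ /=.
  by rewrite ger0_norm// powR_mulrn.
have := @hoelder _ _ _ mu f g 2 2 mf mg; rewrite -!sq// -poweRM ?Lnorm_ge0//.
rewrite Lnorm1 => H.
have -> : \int[mu]_x (f x * g x)%:E = \int[mu]_x `|(EFin \o (f \* g)%R) x|.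
  by apply: eq_integral => x _ /=; rewrite ger0_norm// mulr_ge0.
apply: gt0_ler_poweR => //; rewrite ?in_itv/= ?leey ?andbT.
- exact: integral_ge0.
- by rewrite mule_ge0// Lnorm_ge0.
- by apply: H => //; lra.
Qed.

End cauchy_schwarz.

(** * The frequency space Z x R *)

HB.instance Definition _ := isPointed.Build int 0.
HB.instance Definition _ := @isMeasurable.Build default_measure_display
  int discrete_measurable discrete_measurable0
  discrete_measurableC discrete_measurableU.

Lemma measurable_fun_int d (T : measurableType d) (f : int -> T) :
  measurable_fun setT f.
Proof. by []. Qed.

(** A named copy of the counting measure on the integers: canonical instances
    are indexed by the head constant, and the one of [counting] is taken by the
    natural numbers. *)
Definition countZ {R : realType} : set int -> \bar R := counting.
HB.instance Definition _ (R : realType) := Measure.on (@countZ R).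

Section counting_int.
Context {R : realType}.
Local Open Scope ereal_scope.

Definition int_of_nat (k : nat) : int := if odd k then Negz k./2 else Posz k./2.

Lemma set_bij_int_of_nat : set_bij setT setT int_of_nat.
Proof.
split=> //.
- move=> i j _ _; rewrite /int_of_nat => ij.
  rewrite -(odd_double_half i) -(odd_double_half j).
  by case: (odd i) (odd j) ij => -[] // [->].
- move=> [n|n] _.
    by exists n.*2 => //; rewrite /int_of_nat odd_double doubleK.
  by exists n.*2.+1 => //; rewrite /int_of_nat/= odd_double/= uphalf_double.
Qed.

Lemma sigma_finite_counting_int : sigma_finite [set: int] (@countZ R).
Proof.
exists (fun n => int_of_nat @` `I_n).
  have [_ _ surj] := set_bij_int_of_nat.
  apply/seteqP; split=> // x _; have [k _ kx] := surj x I.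
  by exists k.+1 => //; exists k => /=.
move=> k; split=> //; rewrite /countZ /counting asboolT ?ltry//.
exact/finite_image/finite_II.
Qed.
HB.instance Definition _ :=
  @Measure_isSigmaFinite.Build _ _ _ (@countZ R) sigma_finite_counting_int.

Lemma counting_int_dirac (A : set int) :
  countZ A = \sum_(k <oo) \d_(int_of_nat k) A :> \bar R.
Proof.
transitivity (\esum_(i in A) \d_ i A : \bar R).
  rewrite /countZ /counting; case: ifPn => /asboolP finA.
    by rewrite -finite_card_dirac.
  by rewrite infinite_card_dirac.
rewrite nneseries_esumT//.
rewrite -(@reindex_esum _ _ _ _ _ int_of_nat (fun i => \d_i A) set_bij_int_of_nat).
rewrite [RHS](esumID A)// !setTI [X in _ + X](_ : _ = 0) ?adde0//.
by apply: esum1 => i Ai; rewrite /= /dirac indicE memNset.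
Qed.

Lemma ge0_integral_counting_int (a : int -> \bar R) : (forall n, 0 <= a n) ->
  \int[@countZ R]_n a n = \esum_(n in [set: int]) a n.
Proof.
move=> a0; rewrite (@reindex_esum _ _ _ _ _ int_of_nat a set_bij_int_of_nat).
rewrite -nneseries_esumT//.
transitivity (\int[mseries (fun k => \d_(int_of_nat k)) O]_n a n).
  by congr (integral _ _ _); apply/funext => A; rewrite /= counting_int_dirac.
rewrite (@ge0_integral_measure_series _ _ R (fun k => \d_(int_of_nat k)) setT)//=.
by apply: eq_eseriesr => i _; rewrite integral_dirac//= diracT mul1e.
Qed.

Lemma ge0_integral_counting_int_refl (n : int) (a : int -> \bar R) :
  (forall m, 0 <= a m) ->
  \int[@countZ R]_m a (n - m)%R = \int[@countZ R]_m a m.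
Proof.
move=> a0; rewrite !ge0_integral_counting_int//.
rewrite [RHS](@reindex_esum _ _ _ [set: int] [set: int] (fun m => n - m)%R)//.
split=> //.
- by move=> i j _ _ /addrI /oppr_inj.
- by move=> i _; exists (n - i)%R => //; rewrite opprB addrC subrK.
Qed.

Lemma ge0_integral_counting_int_shift (n : int) (a : int -> \bar R) :
  (forall m, 0 <= a m) ->
  \int[@countZ R]_m a (n + m)%R = \int[@countZ R]_m a m.
Proof.
move=> a0; rewrite !ge0_integral_counting_int//.
rewrite [RHS](@reindex_esum _ _ _ [set: int] [set: int] (fun m => n + m)%R)//.
Qed.

Lemma ge0_integral_counting_int_supp (n : int) (a : int -> \bar R) :
  (forall m, 0 <= a m) -> (forall m, m != n -> a m = 0) ->
  \int[@countZ R]_m a m = a n.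
Proof.
move=> a0 an; rewrite ge0_integral_counting_int// -[RHS](esum_set1 (a0 n)).
rewrite [RHS]esum_mkcond; apply: eq_esum => m _.
case: ifPn => //; rewrite notin_setE/= => /eqP mn; exact: an.
Qed.

Lemma integral_counting_int_supp (n : int) (a : int -> \bar R) :
  (forall m, m != n -> a m = 0) -> \int[@countZ R]_m a m = a n.
Proof.
move=> an; rewrite integralE !(@ge0_integral_counting_int_supp n)//.
- by rewrite [in RHS](funeposneg a).
- by move=> m mn; rewrite funenegE an// oppe0 maxxx.
- by move=> m mn; rewrite funeposE an// maxxx.
Qed.

End counting_int.

Section lebesgue_affine.
Context {R : realType}.
Local Open Scope ereal_scope.
Notation leb := (@lebesgue_measure R).

Lemma measurable_refl (c : R) : measurable_fun [set: R] (fun t => c - t)%R.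
Proof. by apply: measurable_funB => //; exact: measurable_cst. Qed.

Lemma measurable_shift (c : R) : measurable_fun [set: R] (fun t => c + t)%R.
Proof. by apply: measurable_funD => //; exact: measurable_cst. Qed.

Lemma measurable_oppT : measurable_fun [set: R] (-%R : R -> R).
Proof. exact: oppr_measurable. Qed.

Lemma pushforward_lebesgue_shift (c : R) (A : set R) : measurable A ->
  pushforward leb ((fun t => c + t)%R : measurableTypeR R -> measurableTypeR R) A = leb A.
Proof.
move=> mA; apply/esym.
have mc : measurable_fun [set: measurableTypeR R]
  ((fun t => c + t)%R : measurableTypeR R -> measurableTypeR R).
  exact: measurable_shift.
pose m : {measure set (measurableTypeR R) -> \bar R} :=
  measure_function_pushforward__canonical__measure_function_Measure leb mc.
apply: (@lebesgue_measure_unique R m) mA => _ [[a b] _ <-].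
rewrite /m /= /pushforward.
have -> : (fun t => c + t)%R @^-1` `]a, b]%classic = `](a - c)%R, (b - c)%R]%classic.
  by apply/seteqP; split=> t /=; rewrite !in_itv/= ltrBlDl lerBrDl.
rewrite !lebesgue_measure_itv/= !lte_fin ltrD2r; case: ifPn => // _.
by rewrite -!EFinB; congr EFin; ring.
Qed.

Lemma ge0_integral_oppr (f : R -> \bar R) :
  measurable_fun setT f -> (forall t, 0 <= f t) ->
  \int[leb]_t f (- t)%R = \int[leb]_t f t.
Proof.
move=> mf f0.
have := @ge0_integral_pushforward _ _ (measurableTypeR R) (measurableTypeR R) R _ measurable_oppT leb setT f measurableT mf.
rewrite preimage_setT => <-; last by move=> t _; exact: f0.
apply: eq_measure_integral => A mA _; exact: lebesgue_measureN.
Qed.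

Lemma ge0_integral_shift (c : R) (f : R -> \bar R) :
  measurable_fun setT f -> (forall t, 0 <= f t) ->
  \int[leb]_t f (c + t)%R = \int[leb]_t f t.
Proof.
move=> mf f0.
have := @ge0_integral_pushforward _ _ (measurableTypeR R) (measurableTypeR R) R _ (measurable_shift c) leb setT f measurableT mf.
rewrite preimage_setT => <-; last by move=> t _; exact: f0.
apply: eq_measure_integral => [|mc A mA _]; first exact: measurable_shift.
exact: pushforward_lebesgue_shift.
Qed.

Lemma ge0_integral_refl (c : R) (f : R -> \bar R) :
  measurable_fun setT f -> (forall t, 0 <= f t) ->
  \int[leb]_t f (c - t)%R = \int[leb]_t f t.
Proof.
move=> mf f0.
rewrite (@ge0_integral_oppr (fun t => f (c + t)%R)); last by move=> t; exact: f0.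
  exact: ge0_integral_shift.
exact: (measurableT_comp mf (measurable_shift c)).
Qed.

End lebesgue_affine.

Section frequency_space.
Context {R : realType}.
Local Open Scope ereal_scope.

Notation leb := (@lebesgue_measure R).
Notation freq := (int * measurableTypeR R)%type.
Notation nu := (prod_measure (@countZ R) leb).

Lemma measurable_fun_freq d (T : measurableType d) (f : freq -> T) :
  (forall n, measurable_fun setT (fun t => f (n, t))) -> measurable_fun setT f.
Proof.
move=> mf _ Y mY; rewrite setTI.
have -> : f @^-1` Y =
    \bigcup_k ([set int_of_nat k] `*` ((fun t => f (int_of_nat k, t)) @^-1` Y)).
  apply/seteqP; split=> [[n t] /= Yf|[n t] [k _ [/= -> //]]].
  have [_ _ surj] := set_bij_int_of_nat.
  by have [k _ kn] := surj n I; exists k => //; split=> /=; rewrite kn.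
apply: bigcup_measurable => k _; apply: measurableX => //.
by rewrite -[X in measurable X]setTI; exact: mf.
Qed.

Lemma ge0_integral_freqE (f : freq -> \bar R) : measurable_fun setT f ->
  (forall y, 0 <= f y) ->
  \int[nu]_y f y = \int[leb]_t \esum_(n in [set: int]) f (n, t).
Proof.
move=> mf f0; rewrite /prod_measure fubini_tonelli2//; apply: eq_integral => t _.
by rewrite /fubini_G ge0_integral_counting_int.
Qed.

Lemma ge0_integral_freq (f : freq -> \bar R) : measurable_fun setT f ->
  (forall y, 0 <= f y) ->
  \int[nu]_y f y = \int[@countZ R]_n \int[leb]_t f (n, t).
Proof. by move=> mf f0; rewrite /prod_measure fubini_tonelli1. Qed.


Lemma measurable_fun_of_int d (T : measurableType d) d' (U : measurableType d')
  (h : T -> int) (f : int -> U) : measurable_fun setT h ->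
  measurable_fun setT (fun x => f (h x)).
Proof. by move=> mh; exact: (measurableT_comp (measurable_fun_int f) mh). Qed.

Lemma measurable_fun_of_int2 d (T : measurableType d) d' (U : measurableType d')
  (h k : T -> int) (f : int -> int -> U) :
  measurable_fun setT h -> measurable_fun setT k ->
  measurable_fun setT (fun x => f (h x) (k x)).
Proof.
move=> mh mk _ Y mY; rewrite setTI.
have -> : (fun x => f (h x) (k x)) @^-1` Y = \bigcup_i \bigcup_j
    ((h @^-1` [set int_of_nat i] `&` k @^-1` [set int_of_nat j]) `&`
     (fun _ => f (int_of_nat i) (int_of_nat j)) @^-1` Y).
  have [_ _ surj] := set_bij_int_of_nat.
  apply/seteqP; split=> [x /= Yx|x [i _ [j _ [[/= <- <-]]]]//].
  have [i _ ih] := surj (h x) I; have [j _ jk] := surj (k x) I.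
  by exists i => //; exists j => //; rewrite /= ih jk.
apply: bigcup_measurable => i _; apply: bigcup_measurable => j _.
have mp (g : T -> int) (A : set int) : measurable_fun setT g -> measurable (g @^-1` A).
  by move=> mg; rewrite -[X in measurable X]setTI; exact: mg.
apply: measurableI; first by apply: measurableI; exact: mp.
rewrite -[X in measurable X]setTI.
exact: (@measurable_cst _ _ T U setT (f (int_of_nat i) (int_of_nat j))).
Qed.

Lemma measurable_freq_add d (T : measurableType d) (h k : T -> freq) :
  measurable_fun setT h -> measurable_fun setT k ->
  measurable_fun setT (fun x => h x + k x)%R.
Proof.
move=> /measurable_fun_pairP[h1 h2] /measurable_fun_pairP[k1 k2].
apply/measurable_fun_pairP; split.
  exact: (measurable_fun_of_int2 (fun m n => m + n)%R h1 k1).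
exact: (measurable_funD h2 k2).
Qed.

Lemma measurable_freq_sub d (T : measurableType d) (h k : T -> freq) :
  measurable_fun setT h -> measurable_fun setT k ->
  measurable_fun setT (fun x => h x - k x)%R.
Proof.
move=> /measurable_fun_pairP[h1 h2] /measurable_fun_pairP[k1 k2].
apply/measurable_fun_pairP; split.
  exact: (measurable_fun_of_int2 (fun m n => m - n)%R h1 k1).
exact: (measurable_funB h2 k2).
Qed.

Lemma ge0_integral_freq_refl (x : freq) (f : freq -> \bar R) :
  measurable_fun setT f -> (forall y, 0 <= f y) ->
  \int[nu]_y f (x - y)%R = \int[nu]_y f y.
Proof.
move=> mf f0; case: x => n t; rewrite [RHS]ge0_integral_freq// ge0_integral_freq//; last first.
  by apply: (measurableT_comp mf); apply: measurable_freq_sub => //; exact: measurable_cst.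
rewrite -[RHS](@ge0_integral_counting_int_refl _ n); last by move=> m; exact: integral_ge0.
apply: eq_integral => m _.
rewrite -(@ge0_integral_refl _ t (fun t' => f ((n - m)%R, t')))//.
exact: (measurableT_comp mf (pair1_measurable _)).
Qed.

Lemma ge0_integral_freq_shift (x : freq) (f : freq -> \bar R) :
  measurable_fun setT f -> (forall y, 0 <= f y) ->
  \int[nu]_y f (x + y)%R = \int[nu]_y f y.
Proof.
move=> mf f0; case: x => n t; rewrite [RHS]ge0_integral_freq// ge0_integral_freq//; last first.
  by apply: (measurableT_comp mf); apply: measurable_freq_add => //; exact: measurable_cst.
rewrite -[RHS](@ge0_integral_counting_int_shift _ n); last by move=> m; exact: integral_ge0.
apply: eq_integral => m _.
rewrite -(@ge0_integral_shift _ t (fun t' => f ((n + m)%R, t')))//.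
exact: (measurableT_comp mf (pair1_measurable _)).
Qed.

Lemma ge0_integral_freq_shiftl (y : freq) (f : freq -> \bar R) :
  measurable_fun setT f -> (forall y, 0 <= f y) ->
  \int[nu]_x f (x - y)%R = \int[nu]_x f x.
Proof.
move=> mf f0; rewrite -[RHS](ge0_integral_freq_shift (- y)%R mf f0).
by apply: eq_integral => x _; rewrite addrC.
Qed.

(** Fubini reduces an integral over frequencies whose integrand lives on the
    single mode [n] to a time-frequency integral. *)
Lemma cintegral_freq_supp (n : int) (F : freq -> R[i]) :
  cintegrable nu F -> (forall y, y.1 != n -> F y = 0%R) ->
  cintegral nu setT F = cintegral leb setT (fun t => F (n, t)).
Proof.
move=> Fi Fn.
have H (h : freq -> R) : nu.-integrable setT (EFin \o h) ->
    (forall y, y.1 != n -> h y = 0%R) ->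
    Rintegral nu setT h = Rintegral leb setT (fun t => h (n, t)).
  move=> hi hn; rewrite /Rintegral /prod_measure -(integral12_prod_meas1 hi) /fubini_F.
  congr fine; rewrite (@integral_counting_int_supp _ n)// => m mn.
  by apply: integral0_eq => t _ /=; rewrite hn.
rewrite /cintegral; congr (_ +i* _)%C.
  by apply: (H _ (cintegrable_Re Fi)) => y yn; rewrite Fn.
by apply: (H _ (cintegrable_Im Fi)) => y yn; rewrite Fn.
Qed.

End frequency_space.

(** * Smooth functions with compact support *)

Section flat_functions.
Context {R : realType}.
Implicit Types (f g : R -> R) (k : nat).

(** The functions [x^-k exp(-1/x)] on the positive half line, extended by zero:
    up to linear combinations this family is stable under derivation, which is
    how the smoothness of [exp(-1/x)] at the origin is proved. *)
Definition flat k (x : R) : R := if 0 < x then x^-1 ^+ k * expR (- x^-1) else 0.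

Lemma flat_ge0 k x : 0 <= flat k x.
Proof.
rewrite /flat; case: ifPn => // x0.
by rewrite mulr_ge0 ?expR_ge0// exprn_ge0// invr_ge0 ltW.
Qed.

Lemma flat_le0 k x : x <= 0 -> flat k x = 0.
Proof. by rewrite /flat leNgt => /negbTE ->. Qed.

Lemma flatS k x : flat k x = flat k.+1 x * x.
Proof.
rewrite /flat; case: ifPn => x0; last by rewrite mul0r.
by rewrite exprSr -!mulrA (mulrC (expR _)) (mulrA x^-1) mulVf ?gt_eqF// mul1r.
Qed.

(** One term of the exponential series; it makes [exp(-1/x)] beat every power
    of [1/x] at the origin. *)
Lemma exprn_le_expR n (y : R) : 0 <= y -> y ^+ n <= n`!%:R * expR y.
Proof.
move=> y0; case: n => [|n].
  by rewrite fact0 mul1r expr0 -expR0 ler_expR.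
rewrite mulrC -ler_pdivrMr ?ltr0n ?fact_gt0//.
by rewrite (le_trans _ (expR_ge1Dxn n y0))// lerDr.
Qed.

Lemma flat_bound k x : flat k x <= k.+1`!%:R * `|x|.
Proof.
rewrite /flat; case: ifPn => x0; last by rewrite mulr_ge0.
rewrite gtr0_norm// -ler_pdivrMr// mulrAC -exprSr expRN ler_pdivrMr ?expR_gt0//.
by apply: exprn_le_expR; rewrite invr_ge0 ltW.
Qed.

Lemma flat_continuous0 k : {for 0, continuous (flat k)}.
Proof.
apply/cvgrPdist_le => e e0; near=> x.
rewrite [flat k 0]flat_le0// sub0r normrN ger0_norm ?flat_ge0//.
apply: le_trans (flat_bound _ _) _.
rewrite -ler_pdivlMl ?ltr0n ?fact_gt0//; near: x.
exists ((k.+1)`!%:R^-1 * e); first by rewrite /= mulr_gt0// invr_gt0 ltr0n fact_gt0.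
by move=> y /=; rewrite sub0r normrN => /ltW.
Unshelve. all: by end_near. Qed.

Lemma is_derive_flat k (x : R) :
  is_derive x 1 (flat k) (flat k.+2 x - k%:R * flat k.+1 x).
Proof.
have [x0|x0|->] := ltgtP x 0.
- rewrite !flat_le0 ?ltW// mulr0 subr0.
  apply: (@near_eq_is_derive _ _ _ (cst 0)).
  by near=> y; rewrite flat_le0//; apply: ltW; near: y; exact: lt_nbhsl.
- apply: (@near_eq_is_derive _ _ _ (fun x : R => x^-1 ^+ k * expR (- x^-1))).
    by near=> y; rewrite /flat ifT//; near: y; exact: lt_nbhsr.
  have x00 : x != 0 by rewrite gt_eqF.
  have dV : is_derive x 1 (@GRing.inv R) (- x ^- 2).
    have := is_deriveV x00 (is_derive_id x 1).
    by rewrite scaler1.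
  have dE : is_derive x 1 (fun y : R => expR (- y^-1)) (expR (- x^-1) * - - x ^- 2).
    exact: (@is_derive1_comp _ expR (- @GRing.inv R) x _ _ (is_derive_expR (- x^-1))
      (is_deriveN dV)).
  have := is_deriveM (is_deriveX k dV) dE.
  rewrite exprfctE => /is_derive_eq; apply.
  rewrite /flat x0 /GRing.scale/= opprK.
  case: k dE => [|k] dE /=; first by rewrite !expr0; field.
  by rewrite !exprS; field.
- rewrite !flat_le0// mulr0 subr0.
  apply/is_derive1_caratheodory; exists (flat k.+1); split.
  + by move=> z; rewrite [flat k 0]flat_le0// !subr0 flatS.
  + exact: flat_continuous0.
  + by rewrite flat_le0.
Unshelve. all: by end_near. Qed.

(** Smooth functions generated by the flat ones: a class that contains the
    bump functions below and, by induction, the derivatives of its members. *)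
Inductive flat_alg : (R -> R) -> Prop :=
| flat_alg_flat k (a b : R) : flat_alg (fun x => flat k (a * x + b))
| flat_alg_cst (c : R) : flat_alg (cst c)
| flat_algD f g : flat_alg f -> flat_alg g -> flat_alg (f + g)
| flat_algM f g : flat_alg f -> flat_alg g -> flat_alg (f * g).

Lemma flat_alg_derive f : flat_alg f ->
  exists2 g, flat_alg g & forall x : R, is_derive x 1 f (g x).
Proof.
elim=> [k a b|c|{}f g fa [f' f'a ff'] ga [g' g'a gg']|
  {}f g fa [f' f'a ff'] ga [g' g'a gg']].
- exists (cst a * ((fun x => flat k.+2 (a * x + b)) +
     cst (- k%:R) * (fun x => flat k.+1 (a * x + b)))).
    by apply: flat_algM; [exact: flat_alg_cst|apply: flat_algD;
      [exact: flat_alg_flat|apply: flat_algM; [exact: flat_alg_cst|exact: flat_alg_flat]]].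
  move=> x.
  have dl : is_derive x 1 (fun x : R => a * x + b) a.
    have := is_deriveD (is_deriveZ a (is_derive_id x 1)) (is_derive_cst b x 1).
    by rewrite addr0 scaler1.
  have := @is_derive1_comp _ (flat k) (fun x : R => a * x + b) x _ _
    (is_derive_flat k (a * x + b)) dl.
  by move=> /is_derive_eq; apply; rewrite !fctE mulNr mulrC.
- exists (cst 0); first exact: flat_alg_cst.
  by move=> x; exact: is_derive_cst.
- exists (f' + g'); first exact: flat_algD.
  by move=> x; exact: is_deriveD.
- exists (f * g' + g * f'); first by apply: flat_algD; exact: flat_algM.
  by move=> x; exact: is_deriveM.
Qed.

Lemma flat_alg_smooth f : flat_alg f ->
  forall (k : nat) (t : R), derivable (derive1n k f) t 1.
Proof.
move=> fa k t; suff /flat_alg_derive[g _ /(_ t) []//] : flat_alg (derive1n k f).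
elim: k => [|k IHk]; first by rewrite derive1n0.
rewrite derive1nS; have [g ga fg] := flat_alg_derive IHk.
suff -> : derive1 (derive1n k f) = g by [].
by apply/funext => x; rewrite derive1E; have /@derive_val -> := fg x.
Qed.

End flat_functions.

Section bump.
Context {R : realType}.

(** A smooth function supported in [[a + 1/k, b - 1/k]]; as [k] grows, these
    functions increase to the indicator of [(a, b)]. *)
Definition bump (a b : R) (k : nat) (t : R) : R :=
  flat 0 (k%:R * (t - a) - 1) * flat 0 (k%:R * (b - t) - 1).

Lemma bump_ge0 a b k t : 0 <= bump a b k t.
Proof. by rewrite mulr_ge0// flat_ge0. Qed.

Lemma flat0_le1 (x : R) : flat 0 x <= 1.
Proof.
rewrite /flat; case: ifPn => // x0.
by rewrite expr0 mul1r expR_le1 oppr_le0 invr_ge0 ltW.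
Qed.

Lemma bump_le1 a b k t : bump a b k t <= 1.
Proof. by rewrite mulr_ile1// ?flat_ge0// flat0_le1. Qed.

Lemma bump_test a b k (I : set R) : `]a, b[ `<=` I -> test_function I (bump a b k).
Proof.
move=> abI; split.
  apply: flat_alg_smooth.
  have -> : bump a b k = (fun t => flat 0 (k%:R * t + (- (k%:R * a) - 1))) *
                         (fun t => flat 0 ((- k%:R) * t + (k%:R * b - 1))).
    by apply/funext => t; rewrite /bump fctE; congr (flat _ _ * flat _ _); ring.
  by apply: flat_algM; exact: flat_alg_flat.
have [k0|k0] := posnP k.
  exists set0; split=> //; first exact: compact0.
  by move=> t _; rewrite /bump k0 !mul0r sub0r flat_le0 ?mul0r// lerN10.
have k0' : 0 < k%:R :> R by rewrite ltr0n.
exists `[a + k%:R^-1, b - k%:R^-1]%classic; split.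
- exact: segment_compact.
- apply: subset_trans abI => t /=; rewrite !in_itv/= => /andP[at1 tb].
  have : 0 < k%:R^-1 :> R by rewrite invr_gt0.
  by lra.
- move=> t /negP; rewrite in_itv/= negb_and -!ltNge => /orP[H|H].
    rewrite /bump (@flat_le0 _ 0 (k%:R * (t - a) - 1)) ?mul0r// subr_le0.
    by rewrite -ler_pdivlMl// mulr1; lra.
  rewrite /bump (@flat_le0 _ 0 (k%:R * (b - t) - 1)) ?mulr0// subr_le0.
  by rewrite -ler_pdivlMl// mulr1; lra.
Qed.

Lemma flat0_cvg1 (u : R^nat) : (u n @[n --> \oo] --> +oo) ->
  flat 0 (u n) @[n --> \oo] --> (1 : R).
Proof.
move=> uoo.
have : expR (- (u n)^-1) @[n --> \oo] --> (1 : R).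
  rewrite -expR0; apply: continuous_cvg; first exact: continuous_expR.
  rewrite -oppr0; apply: cvgN.
  by apply/gtr0_cvgV0 => //; move/cvgryPgt : uoo; exact.
apply: cvg_trans; apply: near_eq_cvg; near=> n.
rewrite /flat ifT ?expr0 ?mul1r//; near: n.
by move/cvgryPgt : uoo; exact.
Unshelve. all: by end_near. Qed.

Lemma bump_cvg (a b t : R) : a < t < b -> bump a b k t @[k --> \oo] --> (1 : R).
Proof.
move=> /andP[at1 tb]; rewrite -[X in _ --> X]mulr1.
have cv (c : R) : 0 < c -> k%:R * c - 1 @[k --> \oo] --> +oo.
  move=> c0; apply/cvgryPge => A; near=> k.
  rewrite lerBrDr -ler_pdivrMr//; near: k; exact: nbhs_infty_ger.
by apply: cvgM; apply: flat0_cvg1; apply: cv; rewrite subr_gt0.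
Unshelve. all: by end_near. Qed.

Lemma bump_out (a b : R) k t : ~~ (a < t < b) -> bump a b k t = 0.
Proof.
rewrite negb_and -!leNgt /bump => /orP[ta|bt].
  rewrite (@flat_le0 _ 0 (k%:R * (t - a) - 1)) ?mul0r// subr_le0.
  by rewrite (@le_trans _ _ 0)// mulr_ge0_le0// subr_le0.
rewrite (@flat_le0 _ 0 (k%:R * (b - t) - 1)) ?mulr0// subr_le0.
by rewrite (@le_trans _ _ 0)// mulr_ge0_le0// subr_le0.
Qed.

End bump.

(** * Decay of the Fourier transform of a test function *)

Section test_functions.
Context {R : realType}.
Notation leb := (@lebesgue_measure R).
Implicit Types (psi f F : R -> R).

Definition supported_in (L : R) (f : R -> R) := forall t, L < `|t| -> f t = 0.

Lemma supported_inE (L : R) f : supported_in L f -> f = f \_ `[- L, L]%classic.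
Proof.
move=> fL; apply/funext => t; rewrite patchE; case: ifPn => //.
rewrite notin_setE/= in_itv/= => tL; apply: fL.
by rewrite ltNge ler_norml; exact/negP.
Qed.

Lemma continuous_supported_integrable (L : R) f : continuous f -> supported_in L f ->
  leb.-integrable setT (EFin \o f).
Proof.
move=> cf fL; rewrite (supported_inE fL) -restrict_EFin.
rewrite -integrable_mkcond//.
apply: continuous_compact_integrable; first exact: segment_compact.
exact: continuous_subspaceT.
Qed.

Lemma integral_derive_supported_eq0 (L : R) F f : 0 < L ->
  (forall x : R, is_derive x 1 F (f x)) -> continuous f -> supported_in L F ->
  supported_in L f -> Rintegral leb setT f = 0.
Proof.
move=> L0 dF cf FL fL.
have fL1 : supported_in (L + 1) f by move=> t Lt; apply: fL; lra.
have cF : continuous F.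
  by move=> x; apply/differentiable_continuous/derivable1_diffP; have [] := dF x.
rewrite (supported_inE fL1) -Rintegral_mkcond /Rintegral (@continuous_FTC2 _ f F).
- have [FLa FLb] : F (L + 1) = 0 /\ F (- (L + 1)) = 0.
    by split; apply: FL; rewrite ?normrN gtr0_norm; lra.
  by rewrite FLa FLb subee.
- lra.
- exact: continuous_subspaceT.
- split; first by move=> x _; have [] := dF x.
  + by apply: cvg_at_right_filter; exact: cF.
  + by apply: cvg_at_left_filter; exact: cF.
- by move=> x _; rewrite derive1E; have /@derive_val -> := dF x.
Qed.

Lemma test_function_setT (I : set R) psi : test_function I psi -> test_function setT psi.
Proof. by move=> [psiS [K [cK KI K0]]]; split=> //; exists K; split. Qed.

Lemma test_function_derive (I : set R) psi k (t : R) : test_function I psi ->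
  is_derive t 1 (derive1n k psi) (derive1n k.+1 psi t).
Proof.
move=> [/(_ k t) dpsi _]; rewrite derive1nS derive1E.
exact: derivableP.
Qed.

Lemma test_function_continuous (I : set R) psi k : test_function I psi ->
  continuous (derive1n k psi).
Proof.
move=> tpsi t; apply/differentiable_continuous/derivable1_diffP.
by have [] := test_function_derive k t tpsi.
Qed.

Lemma test_function_supported (I : set R) psi : test_function I psi ->
  exists2 L, 0 < L & forall k, supported_in L (derive1n k psi).
Proof.
move=> tpsi; have [_ [K [cK _ K0]]] := tpsi.
have [M [_ KM]] : bounded_set K := compact_bounded cK.
pose L := `|M| + 1.
have L0 : 0 < L by rewrite /L ltr_pwDr.
exists L => //; elim => [|k IHk] t Lt.
  have ML : M < L by rewrite /L (le_lt_trans (ler_norm _))// ltrDl.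
  by rewrite derive1n0; apply: K0 => /(KM L ML)/=; rewrite leNgt Lt.
have [_ <-] := test_function_derive k t tpsi.
rewrite (@near_eq_derive _ _ _ _ (cst 0)) ?derive_cst//.
near=> s; apply: IHk; near: s.
exact: (cvgr_gt _ (@norm_continuous _ R^o t) _ Lt).
Unshelve. all: by end_near. Qed.


Lemma continuous_cosM (tau : R) : continuous (fun t : R => cos (tau * t)).
Proof.
move=> t; apply: (@continuous_comp _ _ _ (fun t : R => tau * t) cos).
  exact: mulrl_continuous.
exact: continuous_cos.
Qed.

Lemma continuous_sinM (tau : R) : continuous (fun t : R => sin (tau * t)).
Proof.
move=> t; apply: (@continuous_comp _ _ _ (fun t : R => tau * t) sin).
  exact: mulrl_continuous.
exact: continuous_sin.
Qed.

Lemma is_derive_cosM (tau t : R) :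
  is_derive t 1 (fun t : R => cos (tau * t)) (- (tau * sin (tau * t))).
Proof.
have dl : is_derive t 1 (fun t : R => tau * t) tau.
  by have := is_deriveZ tau (is_derive_id t 1); rewrite scaler1.
have := @is_derive1_comp _ cos (fun t : R => tau * t) t _ _ (is_derive_cos _) dl.
by move=> /is_derive_eq; apply; rewrite mulNr mulrC.
Qed.

Lemma is_derive_sinM (tau t : R) :
  is_derive t 1 (fun t : R => sin (tau * t)) (tau * cos (tau * t)).
Proof.
have dl : is_derive t 1 (fun t : R => tau * t) tau.
  by have := is_deriveZ tau (is_derive_id t 1); rewrite scaler1.
have := @is_derive1_comp _ sin (fun t : R => tau * t) t _ _ (is_derive_sin _) dl.
by move=> /is_derive_eq; apply; rewrite mulrC.
Qed.

Section decay.
Variables (I : set R) (psi : R -> R).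
Hypothesis tpsi : test_function I psi.

Let d0 (t : R) : is_derive t 1 psi (derive1n 1 psi t).
Proof. by have := test_function_derive 0 t tpsi; rewrite derive1n0. Qed.

Let c0 : continuous psi.
Proof. by have := @test_function_continuous I psi 0 tpsi; rewrite derive1n0. Qed.

(** Two integrations by parts, packed in one exact derivative: for a solution
    [c] of [c'' = - tau^2 c], the derivative of [psi' c - psi c'] is
    [(psi'' + tau^2 psi) c]. *)
Let decay_aux (tau : R) (c c' : R -> R) :
  (forall t : R, is_derive t 1 c (c' t)) ->
  (forall t : R, is_derive t 1 c' (- (tau ^+ 2 * c t))) -> continuous c ->
  (forall t, `|c t| <= 1) ->
  (1 + tau ^+ 2) * `|Rintegral leb setT (fun t => psi t * c t)| <=
    Rintegral leb setT (fun t => `|psi t - derive1n 2 psi t|).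
Proof.
move=> dc dc' cc c1.
have [L L0 Lpsi] := test_function_supported tpsi.
pose psi2 := derive1n 2 psi.
have L2 : supported_in L psi2 by exact: (Lpsi 2%N).
have c2 : continuous psi2 by exact: (@test_function_continuous I psi 2 tpsi).
have d1 (t : R) : is_derive t 1 (derive1n 1 psi) (psi2 t) := test_function_derive 1 t tpsi.
rewrite -/psi2.
have L0psi : supported_in L psi by have := Lpsi 0%N; rewrite derive1n0.
have cD : continuous (fun t => psi t * c t) by move=> t; apply: cvgM; [exact: c0|exact: cc].
have cD2 : continuous (fun t => psi2 t * c t).
  by move=> t; apply: cvgM; [exact: (@test_function_continuous I psi 2 tpsi)|exact: cc].
have iD : leb.-integrable setT (EFin \o (fun t => psi t * c t)).
  by apply: (continuous_supported_integrable (L := L) cD) => t Lt; rewrite /comp/= L0psi// mul0r.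
have iD2 : leb.-integrable setT (EFin \o (fun t => psi2 t * c t)).
  by apply: (continuous_supported_integrable (L := L) cD2) => t Lt; rewrite /comp/= L2// mul0r.
have H : Rintegral leb setT (fun t => psi2 t * c t + tau ^+ 2 * (psi t * c t)) = 0.
  apply: (@integral_derive_supported_eq0 L (derive1n 1 psi * c - psi * c') _ L0).
  - move=> t.
    have := is_deriveB (is_deriveM (d1 t) (dc t))
      (is_deriveM (d0 t) (dc' t)).
    move=> /is_derive_eq; apply; rewrite /GRing.scale/=; ring.
  - by move=> t; apply: cvgD; [exact: cD2|apply: cvgM; [exact: cvg_cst|exact: cD]].
  - by move=> t Lt; rewrite !fctE (Lpsi 1%N)// L0psi// !mul0r subrr.
  - by move=> t Lt; rewrite L2// L0psi// !mul0r mulr0 addr0.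
have iDt : leb.-integrable setT (EFin \o (fun t => tau ^+ 2 * (psi t * c t))).
  by have := integrableZl measurableT (tau ^+ 2) iD.
move: H; rewrite RintegralD// RintegralZl// => H.
rewrite -[X in X * _]ger0_norm ?addr_ge0 ?sqr_ge0// -normrM mulrDl mul1r.
have -> : tau ^+ 2 * (\int[leb]_t (psi t * c t)) = - \int[leb]_t (psi2 t * c t).
  by apply/eqP; rewrite -addr_eq0 addrC H.
rewrite -RintegralB//.
have cB : continuous (fun t => psi t - psi2 t).
  by move=> t; apply: cvgB; [exact: c0|exact: c2].
have cBn : continuous (fun t => `|psi t - psi2 t|).
  by move=> t; apply: cvg_norm; exact: cB.
apply: le_trans (le_normr_Rintegral measurableT _) _.
  exact: (integrableB measurableT iD iD2).
apply: le_Rintegral => //.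
- exact: (integrable_norm (integrableB measurableT iD iD2)).
- apply: (continuous_supported_integrable (L := L) cBn) => t Lt.
  by rewrite L0psi// L2// subrr normr0.
- by move=> t _; rewrite -mulrBl normrM ler_piMr.
Qed.

Lemma inverse_fourier_decay :
  exists2 C, 0 <= C & forall tau, normc (inverse_fourier psi tau) <= C / (1 + tau ^+ 2).
Proof.
pose A := Rintegral leb setT (fun t => `|psi t - derive1n 2 psi t|).
have A0 : 0 <= A by apply: Rintegral_ge0.
exists ((pi *+ 2)^-1 * (A + A)) => [|tau].
  by rewrite mulr_ge0 ?addr_ge0// invr_ge0 mulrn_wge0// pi_ge0.
have t0 : 0 < 1 + tau ^+ 2 by rewrite ltr_pwDl// sqr_ge0.
rewrite ler_pdivlMr// /inverse_fourier normcM normc_real ger0_norm; last first.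
  by rewrite invr_ge0 mulrn_wge0// pi_ge0.
rewrite -mulrA; apply: ler_wpM2l; first by rewrite invr_ge0 mulrn_wge0// pi_ge0.
apply: (@le_trans _ _ ((`|Rintegral leb setT (fun t => psi t * cos (tau * t))| +
   `|Rintegral leb setT (fun t => psi t * sin (tau * t))|) * (1 + tau ^+ 2))).
  apply: ler_wpM2r; first exact: ltW.
  apply: le_trans (ler_normc_ReIm _) _; rewrite /cintegral/=.
  under eq_Rintegral do rewrite mul0r subr0.
  by under [X in _ + `|X| <= _]eq_Rintegral do rewrite mul0r addr0.
rewrite mulrC mulrDr; apply: lerD.
  apply: (decay_aux (c' := fun t => - (tau * sin (tau * t)))).
  - exact: is_derive_cosM.
  - move=> t; have := is_deriveN (is_deriveZ tau (is_derive_sinM tau t)).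
    by move=> /is_derive_eq; apply; rewrite /GRing.scale/= mulrA expr2.
  - exact: continuous_cosM.
  - by move=> t; rewrite ler_norml cos_geN1 cos_le1.
apply: (decay_aux (c' := fun t => tau * cos (tau * t))).
- exact: is_derive_sinM.
- move=> t; have := is_deriveZ tau (is_derive_cosM tau t).
  by move=> /is_derive_eq; apply; rewrite /GRing.scale/= mulrN mulrA expr2.
- exact: continuous_sinM.
- by move=> t; rewrite ler_norml sin_geN1 sin_le1.
Qed.

End decay.

End test_functions.

(** * Integrable power weights *)

Section power_weights.
Context {R : realType}.
Notation leb := (@lebesgue_measure R).

Definition decay (q x : R) : R := (1 + `|x|) `^ (- q).

Lemma decay_gt0 q x : 0 < decay q x.
Proof. by rewrite powR_gt0// ltr_pwDl. Qed.

Lemma decay_ge0 q x : 0 <= decay q x.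
Proof. exact: ltW (decay_gt0 _ _). Qed.

Lemma continuous_decay q : continuous (decay q).
Proof.
move=> x.
apply: (@continuous_comp _ _ _ (fun x : R => 1 + `|x|) (fun y => y `^ (- q))).
  by apply: cvgD; [exact: cvg_cst|exact: norm_continuous].
apply/differentiable_continuous/derivable1_diffP.
have y0 : 0 < 1 + `|x| by rewrite ltr_pwDl.
by have [] := is_derive1_powR (- q) y0.
Qed.

Lemma powRN_cvg0 (p : R) : 0 < p -> (1 + x) `^ (- p) @[x --> +oo] --> (0 : R).
Proof.
move=> p0; apply/cvgrPdist_le => e e0; near=> x.
have x0 : 0 < e `^ (- p^-1) by rewrite powR_gt0.
have xe : e `^ (- p^-1) <= x by near: x; apply: nbhs_pinfty_ge; rewrite num_real.
rewrite sub0r normrN ger0_norm ?powR_ge0//.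
have -> : e = ((e `^ (- p^-1)) `^ p)^-1.
  by rewrite -powRrM mulNr mulVf ?gt_eqF// powR_inv1 ?invrK// ltW.
rewrite powRN lef_pV2 ?posrE ?powR_gt0//; last by rewrite ltr_pwDl// (le_trans _ xe)// ltW.
apply: ge0_ler_powR; rewrite ?nnegrE ?powR_ge0 ?(ltW p0)//.
  by rewrite addr_ge0// (le_trans _ xe)// ltW.
by rewrite (le_trans xe)// lerDr.
Unshelve. all: by end_near. Qed.

Lemma integral_decay_lty (q : R) : 1 < q ->
  (\int[leb]_x (decay q x)%:E < +oo)%E.
Proof.
move=> q1; pose F (x : R) := - (q - 1)^-1 * (1 + x) `^ (- (q - 1)).
have q10 : q - 1 != 0 by rewrite gt_eqF// subr_gt0.
have dF (x : R) : 0 <= x -> is_derive x 1 F (decay q x).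
  move=> x0; have y0 : 0 < 1 + x by rewrite ltr_pwDl.
  have dl : is_derive x 1 (fun x : R => 1 + x) 1.
    have := is_deriveD (is_derive_cst (1 : R) x 1) (is_derive_id x 1).
    by rewrite add0r.
  have dp := @is_derive1_comp _ ((@powR R) ^~ (- (q - 1))) (fun x : R => 1 + x) x _ _
    (is_derive1_powR _ y0) dl.
  have := is_deriveZ (- (q - 1)^-1) dp.
  move=> /is_derive_eq; apply; rewrite /GRing.scale/= mulr1 mulrA mulrNN mulVf// mul1r.
  by rewrite /decay ger0_norm//; congr (_ `^ _); ring.
rewrite ge0_symfun_integralT//.
- rewrite lte_mul_pinfty// -set_itvcy (@ge0_continuous_FTC2y _ _ F 0 0).
  + by rewrite -EFinB ltry.
  + by move=> x _; exact: decay_ge0.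
  + by apply: continuous_subspaceT; exact: continuous_decay.
  + rewrite -[X in _ --> X](mulr0 (- (q - 1)^-1)); apply: cvgM; first exact: cvg_cst.
    by apply: powRN_cvg0; rewrite subr_gt0.
  + by move=> x x0; have [] := dF x (ltW x0).
  + apply: cvg_at_right_filter.
    by apply/differentiable_continuous/derivable1_diffP; have [] := dF 0 (lexx 0).
  + move=> x; rewrite in_itv/= andbT => x0; rewrite derive1E.
    by have /@derive_val -> := dF x (ltW x0).
- by move=> x; exact: decay_ge0.
- exact: continuous_decay.
- by move=> x; rewrite /decay/= normrN.
Qed.

Lemma measurable_decay q : measurable_fun setT (decay q).
Proof. by apply: continuous_measurable_fun; exact: continuous_decay. Qed.

(** Comparison of the sum over the integers with the integral: the unit
    intervals [[n, n + 1)] tile the line, and [1 + |t|] is comparable with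
    [1 + |n|] on the [n]-th of them. *)
Lemma sum_decay_lty (q : R) : 1 < q ->
  (\int[@countZ R]_n (decay q n%:~R)%:E < +oo)%E.
Proof.
move=> q1; have q0 : 0 <= q by lra.
pose H (z : int * R) : \bar R :=
  ((2 `^ q * decay q z.2) * \1_`[z.1%:~R, z.1%:~R + 1[ z.2)%:E.
have mH : measurable_fun setT H.
  apply: measurable_fun_freq => n; apply/measurable_EFinP; apply: measurable_funM.
    by apply: measurable_funM => //; exact: measurable_decay.
  have m1 : measurable (`[n%:~R, n%:~R + 1[%classic : set R) by exact: measurable_itv.
  by have := @measurable_indic _ _ R setT _ m1.
have H0 z : (0 <= H z)%E by rewrite lee_fin mulr_ge0// mulr_ge0 ?powR_ge0 ?decay_ge0.
apply: (@le_lt_trans _ _ (\int[@countZ R]_n \int[leb]_t H (n, t))%E).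
  apply: ge0_le_integral => //.
  - by move=> n _; rewrite lee_fin decay_ge0.
  - move=> n _.
    apply: (@le_trans _ _ (\int[leb]_(t in `[n%:~R, (n%:~R + 1)%R[) (decay q n%:~R)%:E)%E).
      rewrite integral_cst//= lebesgue_measure_itv/= lte_fin ltrDl ltr01 -EFinB.
      by rewrite addrAC subrr add0r mule1.
    rewrite integral_mkcond; apply: ge0_le_integral => //.
    + by move=> t _; rewrite patchE; case: ifPn => // _; rewrite lee_fin decay_ge0.
    + apply/(measurable_restrictT _ _).1 => //; exact: measurable_cst.
    + exact: (measurableT_comp mH (pair1_measurable n)).
    + move=> t _; rewrite patchE /H/= indicE; case: ifPn => [tn|_]; last by rewrite mulr0.
      rewrite mulr1 lee_fin; move: tn; rewrite inE/= in_itv/= => /andP[nt tn].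
      rewrite /decay !powRN ler_pdivlMr ?powR_gt0 ?ltr_pwDl//.
      rewrite mulrC ler_pdivrMr ?powR_gt0 ?ltr_pwDl// -powRM ?addr_ge0//.
      apply: ge0_ler_powR => //; rewrite ?nnegrE ?mulr_ge0 ?addr_ge0//.
      have : `|t| <= `|n%:~R| + 1.
        rewrite -[t](subrK n%:~R) addrC (le_trans (ler_normD _ _))// lerD2l.
        by rewrite ger0_norm; lra.
      by have := normr_ge0 (n%:~R : R); lra.
rewrite fubini_tonelli//.
apply: (@le_lt_trans _ _ (\int[leb]_t (2 `^ q * decay q t)%:E)%E).
  apply: ge0_le_integral => //.
  - by move=> t _; apply: integral_ge0.
  - apply: (@measurable_fun_fubini_tonelli_G _ _ _ _ _ (@countZ R) H) => //.
  - by apply/measurable_EFinP; apply: measurable_funM => //; exact: measurable_decay.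
  - move=> t _; rewrite (@integral_counting_int_supp _ (Num.floor t)); last first.
      move=> n nt; rewrite /H/= indicE memNset ?mulr0//= in_itv/= => tn.
      by move/eqP : nt; apply; apply/esym/floor_def; rewrite intrD.
    by rewrite lee_fin ler_piMr ?mulr_ge0 ?powR_ge0 ?decay_ge0.
under eq_integral do rewrite EFinM.
rewrite ge0_integralZl_EFin//.
- by rewrite lte_mul_pinfty// ?integral_decay_lty// lee_fin powR_ge0.
- by move=> t _; rewrite lee_fin decay_ge0.
- by apply/measurable_EFinP; exact: measurable_decay.
Qed.

End power_weights.

Section test_function_transform.
Context {R : realType}.
Notation leb := (@lebesgue_measure R).
Variables (I : set R) (psi : R -> R).
Hypothesis tpsi : test_function I psi.

Lemma measurable_test_function : measurable_fun setT psi.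
Proof.
apply: continuous_measurable_fun.
by have := @test_function_continuous _ I psi 0 tpsi; rewrite derive1n0.
Qed.

Lemma cmeasurable_inverse_fourier : cmeasurable setT (inverse_fourier psi).
Proof.
rewrite /inverse_fourier; apply: cmeasurableM; first exact: cmeasurable_cst.
apply: (@cmeasurable_cintegral_prod R _ _ R (measurableTypeR R) leb
  (fun z => (psi z.2)%:C%C * cis (z.1 * z.2))).
apply: cmeasurableM.
  apply: cmeasurable_real.
  exact: (measurableT_comp measurable_test_function measurable_snd).
by apply: cmeasurable_cis; exact: measurable_funM.
Qed.

Lemma integrable_test_function : leb.-integrable setT (EFin \o psi).
Proof.
have [L _ /(_ 0%N)] := test_function_supported tpsi.
have := @test_function_continuous _ I psi 0 tpsi; rewrite derive1n0 => c0.
exact: continuous_supported_integrable.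
Qed.

Lemma inverse_fourier_bounded :
  exists2 C, 0 <= C & forall tau, normc (inverse_fourier psi tau) <= C.
Proof.
have [C C0 HC] := inverse_fourier_decay tpsi; exists C => // tau.
apply: le_trans (HC tau) _; rewrite ler_pdivrMr ?ltr_pwDl ?sqr_ge0//.
by rewrite ler_peMr// lerDl sqr_ge0.
Qed.

Lemma cintegrable_inverse_fourier : cintegrable leb (inverse_fourier psi).
Proof.
have [C C0 HC] := inverse_fourier_decay tpsi.
apply: (@le_cintegrable _ _ _ leb _ (fun tau : R => 2 * C * decay 2 tau)).
- exact: cmeasurable_inverse_fourier.
- by apply: measurable_funM => //; exact: measurable_decay.
- move=> tau; apply: le_trans (HC tau) _.
  rewrite (mulrC 2) -mulrA; apply: ler_wpM2l => //.
  rewrite /decay powRN powR_mulrn ?addr_ge0//.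
  rewrite ler_pdivlMr ?exprn_gt0 ?ltr_pwDl// mulrC.
  rewrite ler_pdivrMr ?ltr_pwDl ?sqr_ge0//.
  have -> : tau ^+ 2 = `|tau| ^+ 2 by rewrite real_normK// num_real.
  have := normr_ge0 tau; have := sqr_ge0 (1 - `|tau|); nra.
- under eq_integral do rewrite EFinM.
  rewrite ge0_integralZl_EFin ?mulr_ge0//.
  + by rewrite lte_mul_pinfty// ?integral_decay_lty ?ltr1n// lee_fin mulr_ge0.
  + by move=> t _; rewrite lee_fin decay_ge0.
  + by apply/measurable_EFinP; exact: measurable_decay.
Qed.

End test_function_transform.

Section torus.
Context {R : realType}.
Notation leb := (@lebesgue_measure R).

Definition torus : set R := `]0, pi *+ 2[%classic.

Lemma measurable_torus : measurable torus.
Proof. exact: measurable_itv. Qed.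

Lemma cos_sin_2pi (m : int) :
  cos (m%:~R * (pi *+ 2)) = 1 :> R /\ sin (m%:~R * (pi *+ 2)) = 0 :> R.
Proof.
have H (n : nat) : cos (n%:R * (pi *+ 2)) = 1 :> R /\ sin (n%:R * (pi *+ 2)) = 0 :> R.
  have := @sin2pi R; have := @cos2pi R; move: (pi *+ 2) => p cp sp.
  elim: n => [|n [IHc IHs]]; first by rewrite mul0r cos0 sin0.
  rewrite -natr1 mulrDl mul1r cosD sinD IHc IHs.
  by rewrite cp sp !mul0r !mulr0 subr0 add0r mulr1.
case: m => n; first exact: H.
rewrite NegzE mulrNz mulNr cosN sinN; have [-> ->] := H n.+1.
by rewrite oppr0.
Qed.

Lemma integral_torus (f F : R -> R) : continuous f ->
  (forall x : R, is_derive x 1 F (f x)) ->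
  Rintegral leb torus f = F (pi *+ 2) - F 0.
Proof.
move=> cf dF.
have cF : continuous F.
  by move=> x; apply/differentiable_continuous/derivable1_diffP; have [] := dF x.
have pi20 : 0 < pi *+ 2 :> R by rewrite mulrn_wgt0// pi_gt0.
rewrite /torus /Rintegral.
rewrite -(@integral_itv_bndoo _ _ _ _ true false); last first.
  by apply/measurable_EFinP/measurable_funTS; exact: continuous_measurable_fun.
rewrite (@continuous_FTC2 _ f F)//.
- exact: continuous_subspaceT.
- split; first by move=> x _; have [] := dF x.
  + by apply: cvg_at_right_filter; exact: cF.
  + by apply: cvg_at_left_filter; exact: cF.
- by move=> x _; rewrite derive1E; have /@derive_val -> := dF x.
Qed.

Lemma cintegral_torus (m : int) :
  cintegral leb torus (fun x => cis (m%:~R * x)) =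
  if m == 0 then (pi *+ 2)%:C%C else 0 :> R[i].
Proof.
case: ifPn => [/eqP ->|m0].
  rewrite /cintegral/=; under eq_Rintegral do rewrite mul0r cos0.
  under [X in (_ +i* X)%C]eq_Rintegral do rewrite mul0r sin0.
  have -> : Rintegral leb torus (fun _ => 1) = pi *+ 2 - 0.
    apply: (@integral_torus _ id) => x; exact: cvg_cst.
  have -> : Rintegral leb torus (fun _ => 0) = 0 - 0.
    apply: (@integral_torus _ (cst 0)) => x; exact: cvg_cst.
  by rewrite !subr0.
have mR0 : m%:~R != 0 :> R by rewrite intr_eq0.
have [c1 s0] := cos_sin_2pi m.
have -> : cintegral leb torus (fun x => cis (m%:~R * x)) = (0 +i* 0)%C :> R[i].
  rewrite /cintegral/=; congr (_ +i* _)%C.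
    have dF (x : R) : is_derive x 1 (fun x => m%:~R^-1 * sin (m%:~R * x)) (cos (m%:~R * x)).
      have := is_deriveZ m%:~R^-1 (is_derive_sinM m%:~R x).
      by move=> /is_derive_eq; apply; rewrite /GRing.scale/= mulrA mulVf// mul1r.
    by rewrite (integral_torus (@continuous_cosM _ _) dF) s0 !mulr0 sin0 mulr0 subrr.
  have dF (x : R) : is_derive x 1 (fun x => - m%:~R^-1 * cos (m%:~R * x)) (sin (m%:~R * x)).
    have := is_deriveZ (- m%:~R^-1) (is_derive_cosM m%:~R x).
    by move=> /is_derive_eq; apply; rewrite /GRing.scale/= mulrNN mulrA mulVf// mul1r.
  by rewrite (integral_torus (@continuous_sinM _ _) dF) c1 mulr0 cos0 subrr.
by [].
Qed.

End torus.

(** * Synthesis of a function from an integrable spectrum *)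

Section product_integrals.
Context {R : realType} {d1 d2 : measure_display}
  {T1 : measurableType d1} {T2 : measurableType d2}.
Variables (m1 : {sigma_finite_measure set T1 -> \bar R})
  (m2 : {sigma_finite_measure set T2 -> \bar R}).

Lemma cintegral_prodE (F : T1 * T2 -> R[i]) : cintegrable (prod_measure m1 m2) F ->
  cintegral (prod_measure m1 m2) setT F =
  cintegral m1 setT (fun x => cintegral m2 setT (fun y => F (x, y))).
Proof.
move=> Fi.
have H (h : T1 * T2 -> R) : (prod_measure m1 m2).-integrable setT (EFin \o h) ->
    Rintegral (prod_measure m1 m2) setT h =
    Rintegral m1 setT (fun x => Rintegral m2 setT (fun y => h (x, y))).
  move=> hi; rewrite /Rintegral /prod_measure -(integral12_prod_meas1 hi); congr fine.
  have iF := integrable_fubini_F hi.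
  apply: ae_eq_integral => //.
  - by have /integrableP[] := iF.
  - have /integrableP[/measurable_EFinP mh _] := hi.
    by apply/measurable_EFinP; exact: measurable_Rintegral_prod.
  - have := integrable_ae measurableT iF.
    by apply: filterS => x /(_ I) fx _; rewrite fineK.
by rewrite /cintegral; congr (_ +i* _)%C;
  [exact: (H _ (cintegrable_Re Fi))|exact: (H _ (cintegrable_Im Fi))].
Qed.

Lemma cintegrable_cintegral (F : T1 * T2 -> R[i]) : cmeasurable setT F ->
  (\int[m1]_x \int[m2]_y (normc (F (x, y)))%:E < +oo)%E ->
  cintegrable m1 (fun x => cintegral m2 setT (fun y => F (x, y))).
Proof.
move=> mF Foo; split; first exact: cmeasurable_cintegral_prod.
have mN : measurable_fun setT (fun z => (normc (F z))%:E).
  by apply/measurable_EFinP; exact: measurable_normc.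
have N0 z : (0 <= (normc (F z))%:E)%E by rewrite lee_fin normc_ge0.
apply: (@le_lt_trans _ _ (\int[m1]_x (2%:E * \int[m2]_y (normc (F (x, y)))%:E))%E).
  apply: ge0_le_integral => //.
  - by move=> x _; rewrite lee_fin normc_ge0.
  - by apply/measurable_EFinP/measurable_normc; exact: cmeasurable_cintegral_prod.
  - apply: emeasurable_funM => //.
    exact: (@measurable_fun_fubini_tonelli_F _ _ T1 T2 R m2 (fun z => (normc (F z))%:E) mN N0).
  - move=> x _; apply: normc_cintegral_le.
    exact: (cmeasurable_comp mF (pair1_measurable x)).
rewrite ge0_integralZl_EFin//.
- by rewrite lte_mul_pinfty.
- by move=> x _; apply: integral_ge0.
- exact: (@measurable_fun_fubini_tonelli_F _ _ T1 T2 R m2 (fun z => (normc (F z))%:E) mN N0).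
Qed.

Lemma ge0_integral_tensor (a : T1 -> R) (b : T2 -> R) :
  measurable_fun setT a -> measurable_fun setT b ->
  (forall x, 0 <= a x) -> (forall y, 0 <= b y) ->
  (\int[m1]_x \int[m2]_y (a x * b y)%:E =
   (\int[m1]_x (a x)%:E) * (\int[m2]_y (b y)%:E))%E.
Proof.
move=> ma mb a0 b0.
rewrite -ge0_integralZr//; last 3 first.
- exact/measurable_EFinP.
- by move=> x _; rewrite lee_fin.
- by apply: integral_ge0 => y _; rewrite lee_fin.
apply: eq_integral => x _; rewrite -ge0_integralZl_EFin//.
- by move=> y _; rewrite lee_fin.
- exact/measurable_EFinP.
Qed.

Lemma cintegrable_tensor_lty (f : T1 -> R[i]) (g : T2 -> R[i]) :
  cintegrable m1 f -> cintegrable m2 g ->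
  (\int[m1]_x \int[m2]_y (normc (f x * g y))%:E < +oo)%E.
Proof.
move=> [mf fi] [mg gi]; under eq_integral do under eq_integral do rewrite normcM.
rewrite ge0_integral_tensor//; first last.
- by move=> x; exact: normc_ge0.
- by move=> x; exact: normc_ge0.
- exact: measurable_normc.
- exact: measurable_normc.
by apply: lte_mul_pinfty => //; [apply: integral_ge0 => x _; rewrite lee_fin normc_ge0|
  rewrite ge0_fin_numE// integral_ge0// => x _; rewrite lee_fin normc_ge0].
Qed.

Lemma cmeasurable_tensor (f : T1 -> R[i]) (g : T2 -> R[i]) :
  cmeasurable setT f -> cmeasurable setT g ->
  cmeasurable setT (fun z : T1 * T2 => f z.1 * g z.2).
Proof.
move=> mf mg; apply: cmeasurableM.
  exact: (cmeasurable_comp mf measurable_fst).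
exact: (cmeasurable_comp mg measurable_snd).
Qed.

Lemma cintegrable_tensor (f : T1 -> R[i]) (g : T2 -> R[i]) :
  cintegrable m1 f -> cintegrable m2 g ->
  cintegrable (prod_measure m1 m2) (fun z => f z.1 * g z.2).
Proof.
move=> fi gi; apply: cintegrable_prod; first exact: (cmeasurable_tensor fi.1 gi.1).
exact: (cintegrable_tensor_lty fi gi).
Qed.

Lemma cintegral_tensor (f : T1 -> R[i]) (g : T2 -> R[i]) :
  cintegrable m1 f -> cintegrable m2 g ->
  cintegral (prod_measure m1 m2) setT (fun z => f z.1 * g z.2) =
  cintegral m1 setT f * cintegral m2 setT g.
Proof.
move=> fi gi; rewrite cintegral_prodE; last exact: cintegrable_tensor.
rewrite [RHS]mulrC -cintegralZ//; apply: eq_cintegral => x /=.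
by rewrite cintegralZ// mulrC.
Qed.

End product_integrals.

Section cintegral_mkcond.
Context {R : realType} {d : measure_display} {T : measurableType d}.
Variable mu : {measure set T -> \bar R}.

Lemma cintegral_indic (D : set T) (f : T -> R[i]) :
  cintegral mu D f = cintegral mu setT (fun x => f x * (\1_D x)%:C%C).
Proof.
rewrite /cintegral !(Rintegral_mkcond _ D).
have H (z : R[i]) (c : R) : z * c%:C%C = ((complex.Re z * c) +i* (complex.Im z * c))%C.
  by rewrite -[LHS]complex_eta ReMc ImMc /= !mulr0 subr0 add0r.
congr (_ +i* _)%C; apply: eq_Rintegral => x _; rewrite H patchE indicE /=.
  by case: ifPn => _; rewrite ?mulr1 ?mulr0.
by case: ifPn => _; rewrite ?mulr1 ?mulr0.
Qed.

End cintegral_mkcond.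

Section square_integrable.
Context {R : realType} {d : measure_display} {T : measurableType d}.
Variable mu : {measure set T -> \bar R}.
Implicit Types f g : T -> R[i].

Lemma measurable_sqr_normc f : cmeasurable setT f ->
  measurable_fun setT (fun x => normc (f x) ^+ 2).
Proof. by move=> mf; apply: measurable_funX; exact: measurable_normc. Qed.

Lemma square_integrable_mul f g : square_integrable mu setT f ->
  square_integrable mu setT g -> cintegrable mu (fun x => f x * g x).
Proof.
move=> [mf foo] [mg goo].
apply: (@le_cintegrable _ _ _ mu _ (fun x => normc (f x) ^+ 2 + normc (g x) ^+ 2)).
- exact: cmeasurableM.
- by apply: measurable_funD; exact: measurable_sqr_normc.
- move=> x; rewrite normcM.
  have := normc_ge0 (f x); have := normc_ge0 (g x); have := sqr_ge0 (normc (f x) - normc (g x)).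
  by nra.
- under eq_integral do rewrite EFinD.
  rewrite ge0_integralD//; first exact: lte_add_pinfty.
  - by move=> x _; rewrite lee_fin sqr_ge0.
  - by apply/measurable_EFinP; exact: measurable_sqr_normc.
  - by move=> x _; rewrite lee_fin sqr_ge0.
  - by apply/measurable_EFinP; exact: measurable_sqr_normc.
Qed.

End square_integrable.

Lemma square_integrable_refl {R : realType} (g : int * measurableTypeR R -> R[i]) x :
  square_integrable (prod_measure (@countZ R) (@lebesgue_measure R)) setT g ->
  square_integrable (prod_measure (@countZ R) (@lebesgue_measure R)) setT
    (fun y => g (x - y)).
Proof.
move=> [mg goo]; split.
  apply: (cmeasurable_comp mg).
  by apply: measurable_freq_sub => //; exact: measurable_cst.
rewrite (@ge0_integral_freq_refl R x (fun y => (normc (g y) ^+ 2)%:E))//.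
  by apply/measurable_EFinP; exact: measurable_sqr_normc.
by move=> y; rewrite lee_fin sqr_ge0.
Qed.

Section synthesis.
Context {R : realType}.
Notation leb := (@lebesgue_measure R).
Notation freq := (int * measurableTypeR R)%type.
Notation plane := (measurableTypeR R * measurableTypeR R)%type.
Notation nu := (prod_measure (@countZ R) leb).
Notation lam := (prod_measure leb leb).
Notation pi2 := (pi *+ 2 : R).
Local Open Scope complex_scope.

(** The character of frequency [y = (n, tau)] at the space-time point
    [p = (t, x)]. *)
Definition chi (y : freq) (p : plane) : R[i] := cis (y.1%:~R * p.2 + y.2 * p.1).

(** The test function against which a distribution is evaluated, cut to one
    period in space: integrals over the plane then become integrals over the
    space-time cylinder. *)
Definition wave (n : int) (psi : R -> R) (p : plane) : R[i] :=
  (psi p.1)%:C * (cis (- (n%:~R * p.2)) * (\1_torus p.2)%:C).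

(** Up to normalization, the Fourier transform of [wave n psi]. *)
Definition mode (n : int) (psi : R -> R) (y : freq) : R[i] :=
  if y.1 == n then inverse_fourier psi y.2 else 0.

Definition synth (f : freq -> R[i]) (p : plane) : R[i] :=
  ((pi2 ^+ 2)^-1)%:C * cintegral nu setT (fun y => f y * chi y p).

Definition conv (f g : freq -> R[i]) (x : freq) : R[i] :=
  cintegral nu setT (fun y => f y * g (x - y)).

Lemma pi2_neq0 : pi2 != 0.
Proof. by rewrite gt_eqF// mulrn_wgt0// pi_gt0. Qed.

Lemma lebesgue_torus_lty : (leb torus < +oo)%E.
Proof.
have -> : leb torus = _ := @lebesgue_measure_itv R `]0, pi *+ 2[%R.
by case: ifPn => _; rewrite ?ltry// -EFinB ltry.
Qed.

Lemma chiD (y z : freq) p : chi (y + z) p = chi y p * chi z p.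
Proof. by rewrite /chi -cisD; congr cis; case: y z => [m s] [n t] /=; rewrite intrD; ring. Qed.

Lemma conj_chi (y : freq) p : (chi y p)^* = chi (- y) p.
Proof. by rewrite /chi conj_cis; congr cis; case: y => [m s] /=; rewrite mulrNz; ring. Qed.

Lemma normc_chi y p : normc (chi y p) = 1.
Proof. exact: normc_cis. Qed.

Lemma cmeasurable_chi d (T : measurableType d) (h : T -> freq) (k : T -> plane) :
  measurable_fun setT h -> measurable_fun setT k ->
  cmeasurable setT (fun x => chi (h x) (k x)).
Proof.
move=> /measurable_fun_pairP[h1 h2] /measurable_fun_pairP[k1 k2].
apply: cmeasurable_cis; apply: measurable_funD; apply: measurable_funM => //.
exact: (@measurable_fun_of_int _ _ _ R (fst \o h) (fun n : int => n%:~R) h1).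
Qed.

Lemma cintegrable_chi_mul (y : freq) (H : plane -> R[i]) : cintegrable lam H ->
  cintegrable lam (fun p => chi y p * H p).
Proof.
apply: (@cintegrableMl _ _ _ _ 1) => //; last by move=> p; rewrite normc_chi.
by apply: cmeasurable_chi => //; exact: measurable_cst.
Qed.

Section pairings.
Variables (I : set R) (psi : R -> R) (n : int).
Hypothesis tpsi : test_function I psi.

Lemma cintegrable_torus_factor (u : R -> R) : measurable_fun setT u ->
  cintegrable leb (fun x => cis (u x) * (\1_torus x)%:C).
Proof.
move=> mu; apply: (@le_cintegrable _ _ _ leb _ (fun x => \1_torus x)).
- apply: cmeasurableM; first exact: cmeasurable_cis.
  apply: cmeasurable_real; exact: (measurable_indic measurable_torus).
- exact: (measurable_indic measurable_torus).
- by move=> x; rewrite normcM normc_cis mul1r normc_real ger0_norm.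
- rewrite integral_indic ?setIT//; last exact: measurable_torus.
  exact: lebesgue_torus_lty.
Qed.

Lemma cintegrable_test_factor (u : R -> R) : measurable_fun setT u ->
  cintegrable leb (fun t => (psi t)%:C * cis (u t)).
Proof.
move=> mu; apply: (@le_cintegrable _ _ _ leb _ (fun x => `|psi x|)).
- apply: cmeasurableM; last exact: cmeasurable_cis.
  by apply: cmeasurable_real; exact: (measurable_test_function tpsi).
- by apply: measurableT_comp => //; exact: (measurable_test_function tpsi).
- by move=> x; rewrite normcM normc_cis mulr1 normc_real.
- by have /integrableP[] := integrable_test_function tpsi.
Qed.

Lemma cintegrable_wave : cintegrable lam (wave n psi).
Proof.
have H1 := @cintegrable_test_factor (fun=> 0) (measurable_cst _).
have H2 : cintegrable leb (fun x => cis (- (n%:~R * x)) * (\1_torus x)%:C).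
  by apply: cintegrable_torus_factor; apply: measurable_funN; exact: measurable_funM.
have := cintegrable_tensor H1 H2.
by under eq_fun do rewrite cis0 mulr1.
Qed.

(** Orthogonality of the characters on the torus leaves a single spatial mode. *)
Lemma wave_pairing (y : freq) :
  cintegral lam setT (fun p => chi y p * wave n psi p) = (pi2 ^+ 2)%:C * mode n psi y.
Proof.
case: y => m tau.
have m1 : measurable_fun setT (fun t : R => tau * t) by exact: measurable_funM.
have m2 : measurable_fun setT (fun x : R => (m - n)%:~R * x) by exact: measurable_funM.
have := cintegral_tensor (cintegrable_test_factor m1) (cintegrable_torus_factor m2).
have E := @cintegral_indic R _ (measurableTypeR R) leb torus (fun x => cis ((m - n)%:~R * x)).
rewrite -E cintegral_torus => H.
transitivity (cintegral lam setT (fun z => (psi z.1)%:C * cis (tau * z.1) *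
    (cis ((m - n)%:~R * z.2) * (\1_torus z.2)%:C))).
  apply: eq_cintegral => -[t x]; rewrite /chi /wave /=.
  rewrite (_ : (m - n)%:~R * x = m%:~R * x + - (n%:~R * x)); last by rewrite intrB mulrBl.
  by rewrite !cisD; ring.
rewrite H /mode /= subr_eq0; case: eqP => _; last by rewrite !mulr0.
rewrite /inverse_fourier mulrA -rmorphM/= [RHS]mulrC; congr (_ * _)%R.
by congr (_%:C); rewrite expr2 mulfK// pi2_neq0.
Qed.

Lemma cmeasurable_mode : cmeasurable setT (mode n psi).
Proof.
have [m1 m2] := cmeasurable_inverse_fourier tpsi.
split; apply: measurable_fun_freq => k; rewrite /mode/=; case: eqP => _ //.
Qed.

Lemma mode_bounded : exists2 C, 0 <= C & forall y, normc (mode n psi y) <= C.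
Proof.
have [C C0 HC] := inverse_fourier_bounded tpsi; exists C => // y.
by rewrite /mode; case: ifPn => _; rewrite ?HC// normc_real normr0.
Qed.

Lemma cintegrable_mode : cintegrable nu (mode n psi).
Proof.
split; first exact: cmeasurable_mode.
rewrite ge0_integral_freq; last 2 first.
- by apply/measurable_EFinP/measurable_normc; exact: cmeasurable_mode.
- by move=> y; rewrite lee_fin normc_ge0.
rewrite (@integral_counting_int_supp _ n).
  by have [_] := cintegrable_inverse_fourier tpsi; rewrite /mode/= eqxx.
move=> m mn; apply: integral0_eq => t _.
by rewrite /mode/= (negbTE mn) normc_real normr0.
Qed.

(** The pairing of a spectrum with a test function is an integral over a single
    spatial mode. *)
Lemma cintegral_mode (f : freq -> R[i]) :
  cintegrable nu (fun y => f y * mode n psi y) ->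
  cintegral nu setT (fun y => f y * mode n psi y) =
  cintegral leb setT (fun tau => f (n, tau) * inverse_fourier psi tau).
Proof.
move=> fi; rewrite (cintegral_freq_supp (n := n))//.
  by apply: eq_cintegral => t; rewrite /mode/= eqxx.
by move=> y yn; rewrite /mode (negbTE yn) mulr0.
Qed.

End pairings.

Section integrable_spectrum.
Variable f : freq -> R[i].
Hypothesis fi : cintegrable nu f.

Lemma cmeasurable_synth : cmeasurable setT (synth f).
Proof.
apply: cmeasurableM; first exact: cmeasurable_cst.
apply: (@cmeasurable_cintegral_prod R _ _ plane freq nu
  (fun z : plane * freq => f z.2 * chi z.2 z.1)).
apply: cmeasurableM; first exact: (cmeasurable_comp fi.1 measurable_snd).
by apply: cmeasurable_chi; [exact: measurable_snd|exact: measurable_fst].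
Qed.

Lemma cintegrable_mul_chi p : cintegrable nu (fun y => f y * chi y p).
Proof.
under eq_fun do rewrite mulrC; apply: (@cintegrableMl _ _ _ _ 1) => //.
  by apply: cmeasurable_chi => //; exact: measurable_cst.
by move=> y; rewrite normc_chi.
Qed.

Lemma synth_bounded : exists2 C, 0 <= C & forall p, normc (synth f p) <= C.
Proof.
pose N := fine (\int[nu]_y (normc (f y))%:E).
have N0 : 0 <= N by apply: fine_ge0; apply: integral_ge0 => y _; rewrite lee_fin normc_ge0.
have c0 : 0 <= (pi2 ^+ 2)^-1 by rewrite invr_ge0 sqr_ge0.
exists ((pi2 ^+ 2)^-1 * (2 * N)); first by rewrite mulr_ge0// mulr_ge0.
move=> p; rewrite /synth normcM normc_real ger0_norm//.
apply: ler_wpM2l => //; rewrite -lee_fin.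
apply: (le_trans (@normc_cintegral_le _ _ _ nu _ (cintegrable_mul_chi p).1)).
rewrite EFinM fineK; last first.
  by rewrite ge0_fin_numE ?fi.2// integral_ge0// => y _; rewrite lee_fin normc_ge0.
under eq_integral do rewrite normcM normc_chi mulr1.
exact: lexx.
Qed.

(** Fubini; the integrability of the spectrum and of [H] is what allows the
    exchange, and square integrable spectra are reached only by approximation. *)
Lemma synth_pairing (H : plane -> R[i]) : cintegrable lam H ->
  cintegral lam setT (fun p => synth f p * H p) =
  ((pi2 ^+ 2)^-1)%:C * cintegral nu setT (fun y => f y * cintegral lam setT (fun p => chi y p * H p)).
Proof.
move=> Hi.
have cH y := cintegrable_chi_mul y Hi.
pose F (z : plane * freq) := H z.1 * (f z.2 * chi z.2 z.1).
have mF : cmeasurable setT F.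
  apply: cmeasurableM; first exact: (cmeasurable_comp Hi.1 measurable_fst).
  apply: cmeasurableM; first exact: (cmeasurable_comp fi.1 measurable_snd).
  by apply: cmeasurable_chi; [exact: measurable_snd|exact: measurable_fst].
have Foo : (\int[lam]_p \int[nu]_y (normc (F (p, y)))%:E < +oo)%E.
  under eq_integral do under eq_integral do rewrite /F/= mulrA normcM normc_chi mulr1.
  exact: (cintegrable_tensor_lty Hi fi).
have EF := @cfubini R _ _ _ _ lam nu F mF Foo.
transitivity (((pi2 ^+ 2)^-1)%:C *
    cintegral lam setT (fun p => cintegral nu setT (fun y => F (p, y)))).
  rewrite -cintegralZ.
    apply: eq_cintegral => p; rewrite /synth -mulrA; congr (_ * _).
    by rewrite mulrC -cintegralZ//; exact: cintegrable_mul_chi.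
  exact: (@cintegrable_cintegral R _ _ _ _ lam nu F mF Foo).
congr (_ * _); rewrite EF; apply: eq_cintegral => y.
by rewrite -cintegralZ//; apply: eq_cintegral => p; rewrite /F/=; ring.
Qed.


Lemma cintegrable_synth_mul (H : plane -> R[i]) : cintegrable lam H ->
  cintegrable lam (fun p => synth f p * H p).
Proof.
move=> Hi; have [C C0 HC] := synth_bounded.
exact: (cintegrableMl cmeasurable_synth HC Hi).
Qed.

Lemma synth_chi_pairing I psi (y : freq) n : test_function I psi ->
  cintegral lam setT (fun p => synth f p * (chi y p * wave n psi p)) =
  cintegral nu setT (fun z => f z * mode n psi (y + z)).
Proof.
move=> tpsi; have wi := cintegrable_wave n tpsi.
rewrite (synth_pairing (cintegrable_chi_mul y wi)).
have E z : cintegral lam setT (fun p => chi z p * (chi y p * wave n psi p)) =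
    (pi2 ^+ 2)%:C * mode n psi (y + z).
  rewrite -(wave_pairing n tpsi (y + z)).
  by apply: eq_cintegral => p; rewrite chiD; ring.
under eq_cintegral do rewrite E mulrCA.
rewrite cintegralZ; last first.
  have [C C0 HC] := mode_bounded n tpsi.
  have HCy (z : freq) : normc (mode n psi (y + z)) <= C by exact: HC.
  have myz : cmeasurable setT (fun z : freq => mode n psi (y + z)).
    apply: (cmeasurable_comp (cmeasurable_mode n tpsi)).
    by apply: measurable_freq_add => //; exact: measurable_cst.
  by under eq_fun do rewrite mulrC; exact: (cintegrableMl myz HCy fi).
by rewrite mulrA -rmorphM/= mulVf ?mul1r// expf_neq0// pi2_neq0.
Qed.

Lemma synth_wave_pairing I psi n : test_function I psi ->
  cintegral lam setT (fun p => synth f p * wave n psi p) =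
  cintegral nu setT (fun y => f y * mode n psi y).
Proof.
move=> tpsi; have := synth_chi_pairing 0 n tpsi.
under eq_cintegral do rewrite /chi !mul0r addr0 cis0 mul1r.
by move=> ->; apply: eq_cintegral => z; rewrite add0r.
Qed.

End integrable_spectrum.

Section conv_integrable.
Variables f g : freq -> R[i].
Hypotheses (fi : cintegrable nu f) (gi : cintegrable nu g).
Hypotheses (f2 : square_integrable nu setT f) (g2 : square_integrable nu setT g).

Let ng := fun y => (normc (g y))%:E.
Let mng : measurable_fun setT ng.
Proof. by apply/measurable_EFinP; exact: (measurable_normc gi.1). Qed.
Let ng0 y : (0 <= ng y)%E. Proof. by rewrite lee_fin normc_ge0. Qed.

Lemma cintegral_freq_shift (h : freq -> R[i]) (y : freq) : cmeasurable setT h ->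
  cintegral nu setT (fun x => h (y + x)) = cintegral nu setT h.
Proof.
move=> [h1 h2].
have H (u : freq -> R) : measurable_fun setT u ->
    Rintegral nu setT (fun x => u (y + x)) = Rintegral nu setT u.
  move=> mu; have mu' : measurable_fun setT (EFin \o u) by exact/measurable_EFinP.
  rewrite /Rintegral; congr fine; rewrite integralE [RHS]integralE; congr (_ - _)%E.
    rewrite -[RHS](@ge0_integral_freq_shift _ y)//; last exact: measurable_funepos.
    by apply: eq_integral => t _; rewrite !funeposE.
  rewrite -[RHS](@ge0_integral_freq_shift _ y)//; last exact: measurable_funeneg.
  by apply: eq_integral => t _; rewrite !funenegE.
by rewrite /cintegral (H _ h1) (H _ h2).
Qed.

(** The product of two synthesized functions is synthesized from the convolution
    of their spectra. *)
Lemma synth_product_pairing I psi n : test_function I psi ->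
  cintegral lam setT (fun p => synth f p * (synth g p * wave n psi p)) =
  ((pi2 ^+ 2)^-1)%:C * cintegral nu setT (fun x => conv f g x * mode n psi x).
Proof.
move=> tpsi; have wi := cintegrable_wave n tpsi.
have [C C0 HC] := mode_bounded n tpsi; have mm := cmeasurable_mode n tpsi.
rewrite (synth_pairing fi (cintegrable_synth_mul gi wi)).
congr (_ * _).
pose F (z : freq * freq) := f z.1 * (g (z.2 - z.1) * mode n psi z.2).
have mF : cmeasurable setT F.
  apply: cmeasurableM; first exact: (cmeasurable_comp fi.1 measurable_fst).
  apply: cmeasurableM; last exact: (cmeasurable_comp mm measurable_snd).
  apply: (cmeasurable_comp gi.1).
  by apply: measurable_freq_sub; [exact: measurable_snd|exact: measurable_fst].
have mN : measurable_fun setT (fun z => (normc (F z))%:E).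
  by apply/measurable_EFinP; exact: measurable_normc.
have N0 z : (0 <= (normc (F z))%:E)%E by rewrite lee_fin normc_ge0.
have Foo : (\int[nu]_y \int[nu]_x (normc (F (y, x)))%:E < +oo)%E.
  apply: (@le_lt_trans _ _ (\int[nu]_y ((C * normc (f y))%:E * \int[nu]_x ng x))%E).
    apply: ge0_le_integral => //.
    - by move=> y _; apply: integral_ge0.
    - exact: (@measurable_fun_fubini_tonelli_F _ _ freq freq R nu _ mN N0).
    - apply: emeasurable_funM => //.
      apply/measurable_EFinP; apply: measurable_funM; first exact: measurable_cst.
      exact: (measurable_normc fi.1).
    - move=> y _; rewrite -(ge0_integral_freq_shiftl y mng ng0).
      have my : measurable_fun setT (fun x : freq => ng (x - y)).
        by apply: (measurableT_comp mng); apply: measurable_freq_sub => //; exact: measurable_cst.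
      rewrite -ge0_integralZl_EFin//; last by rewrite mulr_ge0// normc_ge0.
      apply: ge0_le_integral => //.
      + exact: (measurableT_comp mN (pair1_measurable y)).
      + exact: emeasurable_funM.
      + move=> x _; rewrite /F/ng/= !normcM -EFinM lee_fin -subr_ge0.
        rewrite (_ : _ - _ = (C - normc (mode n psi x)) *
          (normc (f y) * normc (g (x - y)))); last by ring.
        by rewrite mulr_ge0 ?subr_ge0 ?HC// mulr_ge0// normc_ge0.
  have G0 : (0 <= \int[nu]_x ng x)%E by exact: integral_ge0.
  rewrite ge0_integralZr//; last 2 first.
  - apply/measurable_EFinP; apply: measurable_funM; first exact: measurable_cst.
    exact: (measurable_normc fi.1).
  - by move=> y _; rewrite lee_fin mulr_ge0// normc_ge0.
  under eq_integral do rewrite EFinM.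
  rewrite ge0_integralZl_EFin//; last 2 first.
  - by move=> y _; rewrite lee_fin normc_ge0.
  - by apply/measurable_EFinP; exact: (measurable_normc fi.1).
  apply: lte_mul_pinfty.
  - by rewrite mule_ge0// ?lee_fin// integral_ge0// => y _; rewrite lee_fin normc_ge0.
  - rewrite ge0_fin_numE; last first.
      by rewrite mule_ge0// ?lee_fin// integral_ge0// => y _; rewrite lee_fin normc_ge0.
    by rewrite lte_mul_pinfty//; exact: fi.2.
  - exact: gi.2.
have EF := @cfubini R _ _ _ _ nu nu F mF Foo.
transitivity (cintegral nu setT (fun x => cintegral nu setT (fun y => F (y, x)))); last first.
  apply: eq_cintegral => x; rewrite /conv mulrC -cintegralZ.
    by apply: eq_cintegral => y; rewrite /F/=; ring.
  exact: (square_integrable_mul f2 (square_integrable_refl x g2)).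
rewrite -EF; apply: eq_cintegral => y; rewrite /F/=.
have gy : cintegrable nu (fun x => g (x - y)).
  split; last by have := gi.2; rewrite -(ge0_integral_freq_shiftl y mng ng0).
  apply: (cmeasurable_comp gi.1).
  by apply: measurable_freq_sub => //; exact: measurable_cst.
rewrite cintegralZ; last first.
  under eq_fun do rewrite mulrC; exact: (cintegrableMl mm HC gy).
congr (_ * _).
transitivity (cintegral lam setT (fun p => synth g p * (chi y p * wave n psi p))).
  by apply: eq_cintegral => p; ring.
rewrite (synth_chi_pairing gi y n tpsi).
rewrite -(@cintegral_freq_shift (fun x => g (x - y) * mode n psi x) y).
  apply: eq_cintegral => z; have -> // : y + z - y = z.
  by rewrite addrAC subrr add0r.
exact: (cmeasurableM gy.1 mm).
Qed.

End conv_integrable.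

Section young.
Variables phi m : freq -> R.
Hypotheses (mphi : measurable_fun setT phi) (mm : measurable_fun setT m).
Hypotheses (phi0 : forall y, 0 <= phi y) (m0 : forall y, 0 <= m y).

Let mE : measurable_fun setT (fun y => (m y)%:E).
Proof. exact/measurable_EFinP. Qed.

Let msub : measurable_fun setT (fun z : freq * freq => m (z.2 - z.1)).
Proof.
apply: (measurableT_comp mm).
by apply: measurable_freq_sub; [exact: measurable_snd|exact: measurable_fst].
Qed.

Lemma ge0_integral_conv_l : (\int[nu]_y \int[nu]_x (phi y * m (x - y))%:E =
  (\int[nu]_y (phi y)%:E) * \int[nu]_y (m y)%:E)%E.
Proof.
rewrite -ge0_integralZr//; last 3 first.
- exact/measurable_EFinP.
- by move=> y _; rewrite lee_fin.
- by apply: integral_ge0 => y _; rewrite lee_fin.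
apply: eq_integral => y _.
rewrite -(@ge0_integral_freq_shiftl R y (fun x => (m x)%:E))//.
rewrite -ge0_integralZl_EFin//; first by move=> ? _; rewrite lee_fin.
apply: (measurableT_comp mE).
by apply: measurable_freq_sub => //; exact: measurable_cst.
Qed.

Lemma ge0_integral_conv_r : (\int[nu]_y \int[nu]_x (phi x * m (x - y))%:E =
  (\int[nu]_y (phi y)%:E) * \int[nu]_y (m y)%:E)%E.
Proof.
rewrite (@fubini_tonelli _ _ freq freq R nu nu
  (fun z => (phi z.2 * m (z.2 - z.1))%:E)); last 2 first.
- apply/measurable_EFinP; apply: measurable_funM; last exact: msub.
  exact: (measurableT_comp mphi measurable_snd).
- by move=> z; rewrite lee_fin mulr_ge0.
rewrite -ge0_integralZr//; last 3 first.
- exact/measurable_EFinP.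
- by move=> y _; rewrite lee_fin.
- by apply: integral_ge0 => y _; rewrite lee_fin.
apply: eq_integral => x _ /=.
rewrite -(@ge0_integral_freq_refl R x (fun x => (m x)%:E))//.
rewrite -ge0_integralZl_EFin//; first by move=> ? _; rewrite lee_fin.
apply: (measurableT_comp mE).
by apply: measurable_freq_sub => //; exact: measurable_cst.
Qed.

End young.

Section bessel.
Variable T : R.

Let W := bump (-1) (T + 1) 2.
Let tW : test_function setT W.
Proof. exact: bump_test. Qed.

Let W_ge (t : R) : 0 < t < T -> expR (- 2) <= W t.
Proof.
move=> /andP[t0 tT].
have H (x : R) : 1 <= x -> expR (- 1) <= flat 0 x.
  move=> x1; have x0 : 0 < x by rewrite (lt_le_trans _ x1).
  by rewrite /flat x0 expr0 mul1r ler_expR lerN2 invf_le1.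
rewrite (_ : - 2 = - 1 + - 1)%R; last by rewrite -opprD.
by rewrite expRD /W /bump ler_pM ?expR_ge0// H//; lra.
Qed.

Let D : set plane := `]0, T[ `*` torus.

Let mD : measurable D.
Proof. by apply: measurableX => //; exact: measurable_torus. Qed.

Let w0 := wave 0 W.

Let w0E (p : plane) : w0 p = (W p.1 * \1_torus p.2)%:C.
Proof. by rewrite /w0 /wave mul0r oppr0 cis0 mul1r -rmorphM. Qed.

(** Inserting the weight [W], which is bounded below on the time interval, turns
    the left-hand side into a quadratic form in the spectrum whose kernel
    [mode 0 W (z - y)] is integrable; Schur's test bounds it. *)
Lemma synth_bessel : exists2 C : R, 0 <= C & forall f : freq -> R[i],
  cintegrable nu f -> square_integrable nu setT f ->
  (\int[lam]_(p in D) (normc (synth f p) ^+ 2)%:E <=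
   C%:E * \int[nu]_y (normc (f y) ^+ 2)%:E)%E.
Proof.
have wi : cintegrable lam w0 := cintegrable_wave 0 tW.
pose md := mode 0 W.
have mi : cintegrable nu md := cintegrable_mode 0 tW.
pose N := fine (\int[nu]_y (normc (md y))%:E).
have NE : (N%:E = \int[nu]_y (normc (md y))%:E)%E.
  rewrite fineK// ge0_fin_numE; first exact: mi.2.
  by apply: integral_ge0 => y _; rewrite lee_fin normc_ge0.
have N0 : 0 <= N by apply: fine_ge0; apply: integral_ge0 => y _; rewrite lee_fin normc_ge0.
exists (expR 2 * (4 * N)); first by rewrite mulr_ge0 ?expR_ge0// mulr_ge0.
move=> f fi f2.
have ms := cmeasurable_synth fi.
pose V (p : plane) := normc (synth f p) ^+ 2 * (W p.1 * \1_torus p.2).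
have VE p : (V p)%:C = synth f p * ((synth f p)^* * w0 p).
  by rewrite mulrA mulc_conj w0E -rmorphM.
have V0 p : 0 <= V p.
  by rewrite mulr_ge0 ?sqr_ge0// mulr_ge0// bump_ge0.
have ci : cintegrable lam (fun p => (synth f p)^* * w0 p).
  have [K K0 HK] := synth_bounded fi.
  apply: (cintegrableMl (cmeasurable_conj ms) _ wi) => p.
  by rewrite normc_conj; exact: HK.
have Vi : cintegrable lam (fun p => (V p)%:C).
  by under eq_fun do rewrite VE; exact: (cintegrable_synth_mul fi ci).
have mV : measurable_fun setT V by have [[]] := Vi.
have mn := measurable_normc fi.1.
have mmd := measurable_normc mi.1.
pose K (y : freq) := cintegral lam setT (fun p => chi y p * ((synth f p)^* * w0 p)).
have KE y : K y = (cintegral nu setT (fun z => f z * md (- y + z)))^*.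
  rewrite -(synth_chi_pairing fi (- y) 0 tW) -cintegral_conj; last first.
    by apply: (cintegrable_synth_mul fi); exact: cintegrable_chi_mul.
  have cM (z w : R[i]) : (z * w)^* = z^* * w^* by exact: rmorphM.
  apply: eq_cintegral => p; rewrite -/w0.
  have cc : (chi (- y) p)^* = chi y p by rewrite conj_chi opprK.
  have cw : (w0 p)^* = w0 p by rewrite w0E /= oppr0.
  apply: etrans (esym (cM (synth f p) _)).
  apply: etrans (congr1 (fun z => (synth f p)^* * z) (esym (cM (chi (- y) p) _))).
  by rewrite mulrCA; congr (_ * (_ * _)); [exact: esym cc|exact: esym cw].
have mfmd (y : freq) : cmeasurable setT (fun z : freq => f z * md (- y + z)).
  apply: (cmeasurableM fi.1); apply: (cmeasurable_comp mi.1).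
  by apply: measurable_freq_add => //; exact: measurable_cst.
have Kle (y : freq) : ((normc (K y))%:E <=
    2%:E * \int[nu]_z (normc (f z) * normc (md (z - y)))%:E)%E.
  rewrite KE normc_conj.
  apply: (le_trans (@normc_cintegral_le _ _ _ nu _ (mfmd y))).
  apply: lee_wpmul2l; first by rewrite lee_fin.
  under eq_integral do rewrite normcM addrC.
  exact: lexx.
have mK : cmeasurable setT K.
  pose G (z : freq * plane) := chi z.1 z.2 * ((synth f z.2)^* * w0 z.2).
  apply: (@cmeasurable_cintegral_prod R _ _ freq plane lam G).
  apply: cmeasurableM; first by apply: cmeasurable_chi; [exact: measurable_fst|exact: measurable_snd].
  exact: (cmeasurable_comp ci.1 measurable_snd).
pose q (y : freq) (z : freq) := (normc (f y) * (normc (f z) * normc (md (z - y))))%R.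
have mq : measurable_fun setT (fun z : freq * freq => (q z.1 z.2)%:E).
  apply/measurable_EFinP; apply: measurable_funM.
    exact: (measurableT_comp mn measurable_fst).
  apply: measurable_funM; first exact: (measurableT_comp mn measurable_snd).
  apply: (measurableT_comp mmd).
  by apply: measurable_freq_sub; [exact: measurable_snd|exact: measurable_fst].
have q0 y z : 0 <= q y z by rewrite !mulr_ge0// normc_ge0.
have mz (y : freq) : measurable_fun setT (fun z : freq => (normc (f z) * normc (md (z - y)))%:E).
  apply/measurable_EFinP; apply: measurable_funM => //.
  apply: (measurableT_comp mmd).
  by apply: measurable_freq_sub => //; exact: measurable_cst.
pose S := fine (\int[nu]_y (normc (f y) ^+ 2)%:E).
have SE : (\int[nu]_y (normc (f y) ^+ 2)%:E = S%:E)%E.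
  rewrite fineK// ge0_fin_numE; first exact: f2.2.
  by apply: integral_ge0 => y _; rewrite lee_fin sqr_ge0.
(* Schur's test: split each product by the arithmetic-geometric inequality *)
have schur : (\int[nu]_y \int[nu]_z (q y z)%:E <= N%:E * \int[nu]_y (normc (f y) ^+ 2)%:E)%E.
  pose s1 (y z : freq) := (normc (f y) ^+ 2 * normc (md (z - y)))%R.
  pose s2 (y z : freq) := (normc (f z) ^+ 2 * normc (md (z - y)))%R.
  have mf2 : measurable_fun setT (fun y : freq => normc (f y) ^+ 2).
    exact: measurable_sqr_normc fi.1.
  have mzy : measurable_fun setT (fun z : freq * freq => normc (md (z.2 - z.1))).
    apply: (measurableT_comp mmd).
    by apply: measurable_freq_sub; [exact: measurable_snd|exact: measurable_fst].
  have ms1 : measurable_fun setT (fun z : freq * freq => (s1 z.1 z.2)%:E).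
    apply/measurable_EFinP; apply: measurable_funM => //.
    exact: (measurableT_comp mf2 measurable_fst).
  have ms2 : measurable_fun setT (fun z : freq * freq => (s2 z.1 z.2)%:E).
    apply/measurable_EFinP; apply: measurable_funM => //.
    exact: (measurableT_comp mf2 measurable_snd).
  have s10 y z : 0 <= s1 y z by rewrite mulr_ge0 ?sqr_ge0// normc_ge0.
  have s20 y z : 0 <= s2 y z by rewrite mulr_ge0 ?sqr_ge0// normc_ge0.
  have mF1 : measurable_fun setT (fun y : freq => \int[nu]_z (s1 y z)%:E)%E.
    by apply: (@measurable_fun_fubini_tonelli_F _ _ freq freq R nu (fun z => (s1 z.1 z.2)%:E)) => // z;
      rewrite lee_fin.
  have mF2 : measurable_fun setT (fun y : freq => \int[nu]_z (s2 y z)%:E)%E.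
    by apply: (@measurable_fun_fubini_tonelli_F _ _ freq freq R nu (fun z => (s2 z.1 z.2)%:E)) => // z;
      rewrite lee_fin.
  have mFq : measurable_fun setT (fun y : freq => \int[nu]_z (q y z)%:E)%E.
    by apply: (@measurable_fun_fubini_tonelli_F _ _ freq freq R nu (fun z => (q z.1 z.2)%:E)) => // z;
      rewrite lee_fin.
  have half0 : (0 <= 2^-1 :> R) by rewrite invr_ge0.
  apply: (@le_trans _ _ (\int[nu]_y ((2^-1)%:E * (\int[nu]_z (s1 y z)%:E + \int[nu]_z (s2 y z)%:E)))%E).
    apply: ge0_le_integral.
    - exact: measurableT.
    - by move=> y _; apply: integral_ge0 => z _; rewrite lee_fin.
    - exact: mFq.
    - by apply: emeasurable_funM => //; exact: emeasurable_funD.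
    - move=> y _; rewrite -ge0_integralD//; first last.
      + exact: (measurableT_comp ms2 (pair1_measurable y)).
      + by move=> z _; rewrite lee_fin.
      + exact: (measurableT_comp ms1 (pair1_measurable y)).
      + by move=> z _; rewrite lee_fin.
      rewrite -ge0_integralZl_EFin//; first last.
      + apply: emeasurable_funD.
          exact: (measurableT_comp ms1 (pair1_measurable y)).
        exact: (measurableT_comp ms2 (pair1_measurable y)).
      + by move=> z _; rewrite -EFinD lee_fin addr_ge0.
      apply: ge0_le_integral.
      + exact: measurableT.
      + by move=> z _; rewrite lee_fin.
      + exact: (measurableT_comp mq (pair1_measurable y)).
      + apply: emeasurable_funM => //; apply: emeasurable_funD.
          exact: (measurableT_comp ms1 (pair1_measurable y)).
        exact: (measurableT_comp ms2 (pair1_measurable y)).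
      + move=> z _; rewrite -EFinD -EFinM lee_fin /q /s1 /s2 -mulrDl !mulrA.
        apply: ler_wpM2r; first exact: normc_ge0.
        have := sqr_ge0 (normc (f y) - normc (f z)); lra.
  rewrite ge0_integralZl_EFin//; first last.
  - exact: emeasurable_funD.
  - by move=> y _; rewrite adde_ge0// integral_ge0// => z _; rewrite lee_fin.
  rewrite ge0_integralD//; first last.
  - by move=> y _; rewrite integral_ge0// => z _; rewrite lee_fin.
  - by move=> y _; rewrite integral_ge0// => z _; rewrite lee_fin.
  rewrite (ge0_integral_conv_l mf2 mmd)//; first last.
  - by move=> y; exact: normc_ge0.
  - by move=> y; exact: sqr_ge0.
  rewrite (ge0_integral_conv_r mf2 mmd)//; first last.
  - by move=> y; exact: normc_ge0.
  - by move=> y; exact: sqr_ge0.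
  rewrite -NE SE -!EFinM lee_fin.
  by have -> : 2^-1 * (S * N + S * N) = N * S by field.
have mFq : measurable_fun setT (fun y : freq => \int[nu]_z (q y z)%:E)%E.
  by apply: (@measurable_fun_fubini_tonelli_F _ _ freq freq R nu (fun z => (q z.1 z.2)%:E)) => // z;
    rewrite lee_fin.
have key1 : ((normc (cintegral nu setT (fun y => f y * K y)))%:E <= (4 * N * S)%:E)%E.
  apply: (le_trans (@normc_cintegral_le _ _ _ nu _ (cmeasurableM fi.1 mK))).
  rewrite (_ : (4 * N * S)%R = 2 * (2 * (N * S)))%R; last by ring.
  rewrite [leRHS]EFinM; apply: lee_wpmul2l; first by rewrite lee_fin.
  apply: (@le_trans _ _ (\int[nu]_y (2%:E * \int[nu]_z (q y z)%:E))%E).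
    apply: ge0_le_integral.
    - exact: measurableT.
    - by move=> y _; rewrite lee_fin normc_ge0.
    - by apply/measurable_EFinP/measurable_normc; exact: (cmeasurableM fi.1 mK).
    - by apply: emeasurable_funM.
    - move=> y _; rewrite normcM EFinM /q.
      under [in leRHS]eq_integral do rewrite EFinM.
      rewrite [in leRHS]ge0_integralZl_EFin//; last 2 first.
      + by move=> z _; rewrite lee_fin mulr_ge0// normc_ge0.
      + exact: normc_ge0.
      rewrite muleCA; apply: lee_wpmul2l; first by rewrite lee_fin normc_ge0.
      exact: Kle.
  rewrite ge0_integralZl_EFin//; last by move=> y _; apply: integral_ge0 => z _; rewrite lee_fin.
  rewrite [leRHS]EFinM; apply: lee_wpmul2l; first by rewrite lee_fin.
  by rewrite EFinM -SE.
have key : Rintegral lam setT V <= 4 * N * S.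
  have <- : complex.Re (cintegral lam setT (fun p => (V p)%:C)) = Rintegral lam setT V by [].
  apply: (le_trans (ler_norm _)); apply: (le_trans (ler_Re_normc _)).
  have -> : cintegral lam setT (fun p => (V p)%:C) =
      ((pi2 ^+ 2)^-1)%:C * cintegral nu setT (fun y => f y * K y).
    by rewrite -(synth_pairing fi ci); apply: eq_cintegral => p; exact: VE.
  rewrite normcM normc_real ger0_norm ?invr_ge0 ?sqr_ge0//.
  rewrite (le_trans _ (_ : normc (cintegral nu setT (fun y => f y * K y)) <= _))//.
  apply: ler_piMl; first exact: normc_ge0.
  have p0 : 0 < pi2 by rewrite pmulrn_rgt0// pi_gt0.
  rewrite invf_le1; last exact: exprn_gt0.
  apply: exprn_ege1; apply: (@le_trans _ _ (2 : R)); first by rewrite ler1n.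
  by apply: (le_trans (pi_ge2 R)); rewrite mulr2n lerDl pi_ge0.
apply: (@le_trans _ _ (\int[lam]_p ((expR 2)%:E * (V p)%:E))%E).
  rewrite integral_mkcond; apply: ge0_le_integral.
  - exact: measurableT.
  - by move=> p _; rewrite patchE; case: ifPn => // _; rewrite lee_fin sqr_ge0.
  - apply/(measurable_restrictT _ _).1 => //; apply: measurable_funTS.
    by apply/measurable_EFinP; exact: measurable_sqr_normc.
  - by apply: emeasurable_funM => //; exact/measurable_EFinP.
  - move=> p _; rewrite patchE -EFinM; case: ifPn => [|_]; last first.
      by rewrite lee_fin mulr_ge0// expR_ge0.
    rewrite inE => -[/=]; rewrite in_itv/= => tT px.
    rewrite lee_fin /V indicE mem_set// mulr1 mulrCA; apply: ler_peMr; first exact: sqr_ge0.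
    have e1 : expR 2 * expR (- 2) = 1 :> R by rewrite -expRD subrr expR0.
    apply: (@le_trans _ _ (expR 2 * expR (- 2))); first by rewrite e1.
    by apply: ler_wpM2l; [exact: expR_ge0|exact: W_ge].
rewrite ge0_integralZl_EFin ?expR_ge0//; last 2 first.
- by move=> p _; rewrite lee_fin.
- exact/measurable_EFinP.
have -> : (\int[lam]_p (V p)%:E)%E = (Rintegral lam setT V)%:E.
  rewrite /Rintegral fineK//; apply: integrable_fin_num => //.
  exact: (cintegrable_Re Vi).
rewrite SE -!EFinM lee_fin -mulrA; apply: ler_wpM2l; first exact: expR_ge0.
exact: key.
Qed.

End bessel.
End synthesis.

(** * Square integrable functions *)

Local Open Scope complex_scope.

Section energy.
Context {R : realType} {d : measure_display} {T : measurableType d}.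
Variable mu : {measure set T -> \bar R}.
Implicit Types f g : T -> R[i].

Definition energy f : \bar R := (\int[mu]_x (normc (f x) ^+ 2)%:E)%E.

Lemma energy_ge0 f : (0 <= energy f)%E.
Proof. by apply: integral_ge0 => x _; rewrite lee_fin sqr_ge0. Qed.

Lemma measurable_energy f : cmeasurable setT f ->
  measurable_fun setT (fun x => (normc (f x) ^+ 2)%:E).
Proof. by move=> mf; apply/measurable_EFinP; exact: measurable_sqr_normc. Qed.

Lemma le_energy f (h : T -> R) : cmeasurable setT f -> measurable_fun setT h ->
  (forall x, normc (f x) ^+ 2 <= h x) -> (energy f <= \int[mu]_x (h x)%:E)%E.
Proof.
move=> mf mh fh; apply: ge0_le_integral.
- exact: measurableT.
- by move=> x _; rewrite lee_fin sqr_ge0.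
- exact: measurable_energy.
- exact/measurable_EFinP.
- by move=> x _; rewrite lee_fin.
Qed.

Lemma energyD f g : cmeasurable setT f -> cmeasurable setT g ->
  (energy (fun x => f x + g x)%R <= 2%:E * (energy f + energy g))%E.
Proof.
move=> mf mg.
have m1 := measurable_sqr_normc mf; have m2 := measurable_sqr_normc mg.
apply: (@le_trans _ _ (\int[mu]_x (2 * (normc (f x) ^+ 2 + normc (g x) ^+ 2))%:E)%E).
  apply: le_energy; first exact: cmeasurableD.
    by apply: measurable_funM => //; exact: measurable_funD.
  move=> x; have := ler_normcD (f x) (g x); have := normc_ge0 (f x + g x).
  have := normc_ge0 (f x); have := normc_ge0 (g x).
  have := sqr_ge0 (normc (f x) - normc (g x)).
  move: (normc _) (normc _) (normc _) => c b a h0 h1 h2 h3 h4.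
  have : c ^+ 2 <= (a + b) ^+ 2 by rewrite ler_sqr ?nnegrE ?addr_ge0.
  nra.
under eq_integral do rewrite EFinM.
rewrite ge0_integralZl_EFin//; last 2 first.
- by move=> x _; rewrite lee_fin addr_ge0// sqr_ge0.
- by apply/measurable_EFinP; exact: measurable_funD.
under eq_integral do rewrite EFinD.
rewrite ge0_integralD//.
- by move=> x _; rewrite lee_fin sqr_ge0.
- exact/measurable_EFinP.
- by move=> x _; rewrite lee_fin sqr_ge0.
- exact/measurable_EFinP.
Qed.

Lemma energyN f : energy (fun x => - f x)%R = energy f.
Proof. by apply: eq_integral => x _; rewrite normcN. Qed.

Lemma energyMl f g (K : R) : cmeasurable setT f -> cmeasurable setT g ->
  (forall x, normc (g x) <= K) ->
  (energy (fun x => g x * f x)%R <= (K ^+ 2)%:E * energy f)%E.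
Proof.
move=> mf mg gK; rewrite /energy -ge0_integralZl_EFin//; last 3 first.
- by move=> x _; rewrite lee_fin sqr_ge0.
- exact: measurable_energy.
- exact: sqr_ge0.
under [leRHS]eq_integral do rewrite -EFinM.
apply: le_energy; first exact: cmeasurableM.
  by apply: measurable_funM => //; exact: measurable_sqr_normc.
move=> x; rewrite normcM exprMn ler_wpM2r ?sqr_ge0// ler_sqr ?nnegrE ?normc_ge0//.
exact: le_trans (normc_ge0 _) (gK x).
Qed.

Lemma square_integrableD f g : square_integrable mu setT f ->
  square_integrable mu setT g -> square_integrable mu setT (fun x => f x + g x).
Proof.
move=> [mf foo] [mg goo]; split; first exact: cmeasurableD.
apply: (le_lt_trans (energyD mf mg)).
by apply: lte_mul_pinfty => //; exact: lte_add_pinfty.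
Qed.

Lemma square_integrableB f g : square_integrable mu setT f ->
  square_integrable mu setT g -> square_integrable mu setT (fun x => f x - g x).
Proof.
move=> f2 [mg goo]; apply: square_integrableD => //; split; first exact: cmeasurableN.
by have := energyN g; rewrite /energy => ->.
Qed.

Lemma square_integrableMl f g (K : R) : square_integrable mu setT f ->
  cmeasurable setT g -> (forall x, normc (g x) <= K) ->
  square_integrable mu setT (fun x => g x * f x).
Proof.
move=> [mf foo] mg gK; split; first exact: cmeasurableM.
apply: (le_lt_trans (energyMl mf mg gK)).
by rewrite lte_mul_pinfty// lee_fin sqr_ge0.
Qed.

Lemma bounded_square_integrable f (K : R) : cintegrable mu f ->
  (forall x, normc (f x) <= K) -> square_integrable mu setT f.
Proof.
move=> [mf foo] fK; split=> //.
have [K0|K0] := leP 0 K; last first.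
  apply: (@le_lt_trans _ _ 0%E); last exact: ltry.
  rewrite -(@integral0 _ _ _ mu setT); apply: ge0_le_integral => //.
  - by move=> x _; rewrite lee_fin sqr_ge0.
  - exact: measurable_energy.
  - by move=> x _; have := le_trans (normc_ge0 _) (fK x); rewrite leNgt K0.
apply: (@le_lt_trans _ _ (\int[mu]_x (K * normc (f x))%:E)%E).
  apply: le_energy => //.
    by apply: measurable_funM => //; exact: measurable_normc.
  by move=> x; rewrite expr2 ler_wpM2r ?normc_ge0.
under eq_integral do rewrite EFinM.
rewrite ge0_integralZl_EFin//; last 2 first.
- by move=> x _; rewrite lee_fin normc_ge0.
- by apply/measurable_EFinP; exact: measurable_normc.
by rewrite lte_mul_pinfty.
Qed.

Lemma energy_le_sqr f : square_integrable mu setT f ->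
  exists2 A : R, 0 < A & (energy f <= (A ^+ 2)%:E)%E.
Proof.
move=> [mf foo]; exists (1 + fine (energy f)); first by rewrite ltr_pwDl// fine_ge0// energy_ge0.
have E0 : 0 <= fine (energy f) by rewrite fine_ge0// energy_ge0.
rewrite -[leLHS]fineK; last by rewrite ge0_fin_numE// energy_ge0.
rewrite lee_fin; nra.
Qed.

(** Cauchy-Schwarz, with bounds for the two factors instead of their norms: the
    energies enter squared, so no square root of an extended real appears. *)
Lemma normc_mul_le f g (A B : R) : cmeasurable setT f -> cmeasurable setT g ->
  0 <= A -> 0 <= B -> (energy f <= (A ^+ 2)%:E)%E -> (energy g <= (B ^+ 2)%:E)%E ->
  (\int[mu]_x (normc (f x * g x))%:E <= (A * B)%:E)%E.
Proof.
move=> mf mg A0 B0 fA gB.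
have := @integral_sqr_mul_le _ _ _ mu _ _ (measurable_normc mf) (measurable_normc mg)
  (fun x => normc_ge0 _) (fun x => normc_ge0 _).
rewrite (_ : (\int[mu]_x (normc (f x) * normc (g x))%:E)%E =
  (\int[mu]_x (normc (f x * g x))%:E)%E); last first.
  by apply: eq_integral => x _; rewrite normcM.
have X0 : (0 <= \int[mu]_x (normc (f x * g x))%:E)%E.
  by apply: integral_ge0 => x _; rewrite lee_fin normc_ge0.
move=> H.
have {}H : ((\int[mu]_x (normc (f x * g x))%:E) `^ 2 <= ((A * B) ^+ 2)%:E)%E.
  apply: (le_trans H); rewrite exprMn EFinM; apply: lee_pmul => //.
  - by apply: integral_ge0 => x _; rewrite lee_fin sqr_ge0.
  - by apply: integral_ge0 => x _; rewrite lee_fin sqr_ge0.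
move: X0 H; case: (\int[mu]_x _)%E => [r||]//.
  rewrite lee_fin => r0; rewrite poweR_EFin (_ : r `^ 2 = r ^+ 2); last by rewrite -powR_mulrn.
  by rewrite !lee_fin ler_sqr ?nnegrE ?mulr_ge0.
by rewrite poweR2// mulyy.
Qed.

Lemma normc_cintegral_mul_le f g (A B : R) : cmeasurable setT f -> cmeasurable setT g ->
  0 <= A -> 0 <= B -> (energy f <= (A ^+ 2)%:E)%E -> (energy g <= (B ^+ 2)%:E)%E ->
  normc (cintegral mu setT (fun x => f x * g x)) <= 2 * (A * B).
Proof.
move=> mf mg A0 B0 fA gB; rewrite -lee_fin.
apply: (le_trans (@normc_cintegral_le _ _ _ mu _ (cmeasurableM mf mg))).
by rewrite EFinM lee_wpmul2l ?lee_fin//; exact: normc_mul_le.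
Qed.

End energy.

Lemma normc_small_eq {R : realType} (z w : R[i]) (C : R) :
  (forall e, 0 < e -> e <= 1 -> normc (z - w) <= C * e) -> z = w.
Proof.
move=> H; apply/eqP; rewrite -subr_eq0; apply/eqP/normc0_eq0.
apply/eqP; rewrite eq_le normc_ge0 andbT; apply/ler_addgt0Pr => e e0; rewrite add0r.
have C1 : 0 < `|C| + 1 by rewrite ltr_wpDl.
pose e' := Num.min 1 (e / (`|C| + 1)).
have e'0 : 0 < e' by rewrite lt_min ltr01 divr_gt0.
apply: (le_trans (H e' e'0 _)); first by rewrite ge_min lexx.
have e'e : e' * (`|C| + 1) <= e by rewrite -ler_pdivlMr// ge_min lexx orbT.
by have := ler_norm C; nra.
Qed.

Section geometric.
Context {R : realType}.

(** The sequences [u i - 2 K / 2 ^ i] and [u i + 2 K / 2 ^ i] are monotone and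
    enclose the limit. *)
Lemma geometric_limit (u : nat -> R) (K : R) :
  (forall i, `|u i.+1 - u i| <= K / 2 ^+ i) ->
  exists2 l, u @ \oo --> l & forall j, `|l - u j| <= 2 * K / 2 ^+ j.
Proof.
move=> uK.
have K0 : 0 <= K by have := uK 0%N; rewrite expr0 divr1; exact: le_trans.
pose g i : R := 2 * K / 2 ^+ i.
have g0 i : 0 <= g i by rewrite divr_ge0 ?mulr_ge0// exprn_ge0.
have gS i : g i.+1 = g i - K / 2 ^+ i by rewrite /g exprS; field; rewrite expf_neq0.
pose v i := u i - g i; pose w i := u i + g i.
have vS i : v i <= v i.+1.
  by have := uK i; rewrite /v gS ler_norml => /andP[]; lra.
have wS i : w i.+1 <= w i.
  have : g i.+1 = K / 2 ^+ i by rewrite /g exprS; field; rewrite expf_neq0.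
  by have := uK i; rewrite /w gS ler_norml => /andP[]; lra.
have ndv : nondecreasing_seq v by apply/nondecreasing_seqP.
have niw : nonincreasing_seq w by apply/nonincreasing_seqP.
have vw i j : v i <= w j.
  have vwi k : v k <= w k by rewrite /v /w; have := g0 k; lra.
  have [ij|/ltnW ji] := leqP i j; first exact: le_trans (ndv _ _ ij) (vwi j).
  exact: le_trans (vwi i) (niw _ _ ji).
have ubv : has_ubound (range v) by exists (w 0%N) => _ [i _ <-].
have cv := nondecreasing_cvgn ndv ubv.
exists (sup (range v)); last first.
  move=> j; rewrite ler_norml; apply/andP; split.
    have : v j <= sup (range v) by apply: ub_le_sup => //; exists j.
    by rewrite /v /g; lra.
  have : sup (range v) <= w j by apply: ge_sup; [exists (v 0%N), 0%N|move=> _ [i _ <-]].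
  by rewrite /w /g; lra.
have cg : g @ \oo --> (0 : R).
  have : geometric (2 * K) (2^-1) @ \oo --> (0 : R).
    by apply: cvg_geometric; rewrite ger0_norm ?invr_ge0// invf_lt1// ltr1n.
  by apply: cvg_trans; apply: near_eq_cvg; near=> n; rewrite /g /= exprVn.
have -> : u = (fun n => v n + g n) by apply/funext => n; rewrite /v subrK.
by rewrite -[X in _ --> X]addr0; exact: cvgD.
Unshelve. all: by end_near. Qed.

End geometric.

Section completeness.
Context {R : realType} {d : measure_display} {T : measurableType d}.
Variable mu : {measure set T -> \bar R}.

(** If [S] bounds the squared increments weighted by [4 ^ i], then wherever it
   is finite the sequence converges geometrically; where it is infinite the
   final estimate holds for free, so no exceptional set is needed. *)
Lemma riesz_fischer (a : nat -> T -> R[i]) (C : R) :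
  (forall j, square_integrable mu setT (a j)) ->
  (forall j, (energy mu (fun x => a j.+1 x - a j x)%R <= (C / 16 ^+ j)%:E)%E) ->
  exists2 b, square_integrable mu setT b &
    forall e, 0 < e -> exists k, forall j, (k <= j)%N ->
      (energy mu (fun x => b x - a j x)%R <= e%:E)%E.
Proof.
move=> a2 aC.
have ma j := (a2 j).1.
pose h j x : \bar R := (4 ^+ j * normc (a j.+1 x - a j x) ^+ 2)%:E.
have h0 j x : (0 <= h j x)%E by rewrite lee_fin; apply: mulr_ge0; [exact: exprn_ge0|exact: sqr_ge0].
have mh j : measurable_fun setT (h j).
  apply/measurable_EFinP; apply: measurable_funM => //.
  by apply: measurable_sqr_normc; exact: cmeasurableB.
pose S x := (\sum_(j <oo) h j x)%E.
have mS : measurable_fun setT S.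
  by apply: (@ge0_emeasurable_sum _ _ _ setT h xpredT) => // k _; exact: mh.
have S0 x : (0 <= S x)%E by apply: nneseries_ge0 => *.
have hS j x : (h j x <= S x)%E.
  apply: (le_trans _ (@nneseries_lim_ge R (fun i => h i x) xpredT 0 j.+1 _)) => //.
  by rewrite big_nat_recr//= leeDr// sume_ge0.
have C0 : 0 <= C.
  have := le_trans (energy_ge0 mu _) (aC 0%N).
  by rewrite lee_fin expr0 divr1.
have SC : (\int[mu]_x S x <= (2 * C)%:E)%E.
  rewrite /S integral_nneseries//.
  apply: (@le_trans _ _ (\sum_(j <oo) (C / (2 ^ (j + 0))%:R)%:E)%E); last first.
    have := @cvg_geometric_eseries_half R (2 * C) 0.
    rewrite expr0 divr1 => /cvg_lim <-//; rewrite le_eqVlt; apply/orP; left; apply/eqP.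
    apply: congr_lim; apply/funext => n; apply: eq_bigr => j _; congr EFin.
    by rewrite addn0 addn1 expnS natrM; field; rewrite natrX expf_neq0.
  apply: lee_nneseries => j _; first by move=> _; exact: integral_ge0.
  rewrite /h; under eq_integral do rewrite EFinM.
  rewrite ge0_integralZl_EFin ?exprn_ge0//; last 2 first.
  - by move=> x _; rewrite lee_fin sqr_ge0.
  - by apply: measurable_energy; exact: cmeasurableB.
  apply: (le_trans (lee_wpmul2l _ (aC j))); first by rewrite lee_fin exprn_ge0.
  rewrite -EFinM lee_fin addn0 natrX.
  have -> : 4 = 2 * 2 :> R by ring.
  have -> : 16 = 2 * 2 * (2 * 2) :> R by ring.
  rewrite !exprMn; have : 1 <= 2 ^+ j :> R by rewrite exprn_ege1// ler1n.
  move: (2 ^+ j) => x x1; have x0 : x != 0 by rewrite gt_eqF//; lra.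
  rewrite (_ : x * x * (C / (x * x * (x * x))) = C / (x * x)); last by field.
  apply: ler_wpM2l => //; rewrite lef_pV2 ?posrE//; nra.
have SE x : (S x < +oo)%E -> S x = (fine (S x))%:E.
  by move=> Sx; rewrite fineK// ge0_fin_numE.
have step x j : (S x < +oo)%E ->
    normc (a j.+1 x - a j x) <= Num.sqrt (fine (S x)) / 2 ^+ j.
  move=> Sx; have H : 4 ^+ j * normc (a j.+1 x - a j x) ^+ 2 <= fine (S x).
    by rewrite -lee_fin -SE//; exact: hS.
  have p0 : 0 < 2 ^+ j :> R by rewrite exprn_gt0.
  have n0 := normc_ge0 (a j.+1 x - a j x).
  rewrite ler_pdivlMr// -[leLHS]ger0_norm; last by rewrite mulr_ge0// ltW.
  rewrite -sqrtr_sqr; apply: ler_wsqrtr.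
  rewrite exprMn mulrC -exprM mulnC exprM; suff -> : 2 ^+ 2 = 4 :> R by [].
  by ring.
pose Z : set T := [set x | (S x < +oo)%E].
have mZ : measurable Z.
  by have := emeasurable_fun_infty_o measurableT mS +oo%E; rewrite setTI.
pose a' j x := a j x * (\1_Z x)%:C.
have ma' j : cmeasurable setT (a' j).
  by apply: cmeasurableM => //; apply: cmeasurable_real; exact: measurable_indic.
have a'E j x : (S x < +oo)%E -> a' j x = a j x.
  by move=> Sx; rewrite /a' indicE mem_set// mulr1.
have a'0 j x : ~ (S x < +oo)%E -> a' j x = 0.
  by move=> Sx; rewrite /a' indicE memNset// mulr0.
have step' x j : normc (a' j.+1 x - a' j x) <= Num.sqrt (fine (S x)) / 2 ^+ j.
  have [Sx|Sx] := pselect (S x < +oo)%E; first by rewrite !a'E//; exact: step.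
  by rewrite !a'0// subr0 -[0]/((0 : R)%:C) normc_real normr0 divr_ge0 ?sqrtr_ge0// exprn_ge0.
have stepRe x j : `|complex.Re (a' j.+1 x) - complex.Re (a' j x)| <= Num.sqrt (fine (S x)) / 2 ^+ j.
  by apply: le_trans (step' x j); rewrite -ReNc -ReDc; exact: ler_Re_normc.
have stepIm x j : `|complex.Im (a' j.+1 x) - complex.Im (a' j x)| <= Num.sqrt (fine (S x)) / 2 ^+ j.
  by apply: le_trans (step' x j); rewrite -ImNc -ImDc; exact: ler_Im_normc.
pose bR x := projT1 (cid2 (geometric_limit (stepRe x))).
pose bI x := projT1 (cid2 (geometric_limit (stepIm x))).
pose b x : R[i] := bR x +i* bI x.
have mb : cmeasurable setT b.
  split=> /=.
    apply: (@measurable_fun_cvg _ _ _ setT (fun j x => complex.Re (a' j x))).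
      by move=> j; have [] := ma' j.
    by move=> x _; rewrite /bR; case: cid2.
  apply: (@measurable_fun_cvg _ _ _ setT (fun j x => complex.Im (a' j x))).
    by move=> j; have [] := ma' j.
  by move=> x _; rewrite /bI; case: cid2.
have bb x j : (S x < +oo)%E -> normc (b x - a j x) ^+ 2 <= 8 / 4 ^+ j * fine (S x).
  move=> Sx; rewrite -(a'E j)// sqr_normcE ReDc ImDc ReNc ImNc.
  have H (y : R) : `|y| <= 2 * Num.sqrt (fine (S x)) / 2 ^+ j ->
      y ^+ 2 <= 4 / 4 ^+ j * fine (S x).
    rewrite -(@ler_pXn2r _ 2) ?nnegrE ?divr_ge0 ?mulr_ge0 ?sqrtr_ge0 ?exprn_ge0//.
    rewrite real_normK ?num_real// !exprMn sqr_sqrtr ?fine_ge0// exprVn -exprM mulnC exprM.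
    rewrite (_ : 2 ^+ 2 = 4 :> R); last by ring.
    by rewrite mulrAC.
  have h1 : (complex.Re (b x) - complex.Re (a' j x)) ^+ 2 <= 4 / 4 ^+ j * fine (S x).
    by apply: H; rewrite /b /= /bR; case: cid2.
  have h2 : (complex.Im (b x) - complex.Im (a' j x)) ^+ 2 <= 4 / 4 ^+ j * fine (S x).
    by apply: H; rewrite /b /= /bI; case: cid2.
  have -> : 8 / 4 ^+ j * fine (S x) = 4 / 4 ^+ j * fine (S x) + 4 / 4 ^+ j * fine (S x).
    by ring.
  exact: (lerD h1 h2).
have eb j : (energy mu (fun x => b x - a j x)%R <= (16 * C / 4 ^+ j)%:E)%E.
  have c0 : 0 <= 8 / 4 ^+ j :> R by rewrite divr_ge0// exprn_ge0.
  apply: (@le_trans _ _ (\int[mu]_x ((8 / 4 ^+ j)%:E * S x))%E).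
    apply: ge0_le_integral => //.
    - by move=> x _; rewrite lee_fin sqr_ge0.
    - by apply: measurable_energy; exact: cmeasurableB.
    - by apply: emeasurable_funM.
    - move=> x _; have [Sx|] := ltP (S x) +oo%E; first by rewrite SE// -EFinM lee_fin; exact: bb.
      by rewrite leye_eq => /eqP ->; rewrite gt0_muley ?leey// lte_fin divr_gt0// exprn_gt0.
  rewrite ge0_integralZl_EFin//.
  apply: (le_trans (lee_wpmul2l _ SC)); first by rewrite lee_fin.
  by rewrite -EFinM lee_fin (_ : 8 / _ * _ = 16 * C / 4 ^+ j)//; ring.
exists b.
  have H : square_integrable mu setT (fun x => b x - a 0 x)%R.
    split; first exact: cmeasurableB.
    by apply: (le_lt_trans (eb 0%N)); exact: ltry.
  by have := square_integrableD H (a2 0%N); under eq_fun do rewrite subrK.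
move=> e e0.
have cg : geometric (16 * C) (4^-1) @ \oo --> (0 : R).
  by apply: cvg_geometric; rewrite ger0_norm ?invr_ge0// invf_lt1// ltr1n.
have /cvgrPdist_le/(_ e e0) := cg.
case=> k _ Hk; exists k => j kj; apply: (le_trans (eb j)); rewrite lee_fin.
have := Hk j kj; rewrite sub0r normrN /= exprVn ger0_norm//.
by rewrite divr_ge0 ?mulr_ge0// exprn_ge0.
Qed.
End completeness.

(** * Functions with a square integrable spectrum *)

Lemma test_function_bounded {R : realType} (I : set R) psi : test_function I psi ->
  exists2 K, 0 <= K & forall t, `|psi t| <= K.
Proof.
move=> tpsi; have [L L0 HL] := test_function_supported tpsi.
have LL : - L <= L by lra.
have c : {within `[- L, L], continuous (fun t => `|psi t|)}.
  apply: continuous_subspaceT => t; apply: cvg_norm.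
  by have := @test_function_continuous _ _ _ 0 tpsi t; rewrite derive1n0.
have [m _ Hm] := EVT_max LL c; exists `|psi m| => // t.
have [tL|Lt] := leP `|t| L; first by apply: Hm; rewrite in_itv/= -ler_norml.
by have := HL 0%N t Lt; rewrite derive1n0 => ->; rewrite normr0.
Qed.

Section truncation.
Context {R : realType}.
Notation leb := (@lebesgue_measure R).
Notation freq := (int * measurableTypeR R)%type.
Notation nu := (prod_measure (@countZ R) leb).

Let phi (y : freq) : R := decay 2 y.1%:~R * decay 2 y.2.

Let phi_gt0 y : 0 < phi y.
Proof. by rewrite mulr_gt0// decay_gt0. Qed.

Let cintegrable_decayZ : cintegrable (@countZ R) (fun n : int => (decay 2 n%:~R : R)%:C).
Proof.
split; first by split; exact: measurable_fun_int.
under eq_integral do rewrite normc_real ger0_norm ?decay_ge0//.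
by apply: sum_decay_lty; rewrite ltr1n.
Qed.

Let cintegrable_decay : cintegrable leb (fun t => (decay 2 t : R)%:C).
Proof.
split; first by apply: cmeasurable_real; exact: measurable_decay.
under eq_integral do rewrite normc_real ger0_norm ?decay_ge0//.
by apply: integral_decay_lty; rewrite ltr1n.
Qed.

Let phi_square_integrable : square_integrable nu setT (fun y => (phi y)%:C).
Proof.
have d1 (x : R) : decay 2 x <= 1.
  rewrite /decay powRN invf_le1 ?powR_gt0 ?ltr_pwDl//.
  by rewrite powR_mulrn ?addr_ge0// exprn_ege1// lerDl.
apply: (@bounded_square_integrable _ _ _ nu _ 1); last first.
  move=> y; rewrite normc_real ger0_norm; last exact: ltW.
  by rewrite mulr_ile1// ?decay_ge0.
have := cintegrable_tensor cintegrable_decayZ cintegrable_decay.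
by under eq_fun do rewrite -rmorphM.
Qed.

(** Multiplication by [min 1 (k * phi)], with [phi] a fixed positive square
    integrable weight, makes [f] integrable and tends to the identity. *)
Lemma integrable_square_integrable_dense (f : freq -> R[i]) (e : R) : 0 < e ->
  square_integrable nu setT f ->
  exists g, [/\ cintegrable nu g, square_integrable nu setT g &
    (energy nu (fun y => f y - g y)%R <= e%:E)%E].
Proof.
move=> e0 f2; have mf := f2.1.
pose m (k : nat) (y : freq) : R := Num.min 1 (k%:R * phi y).
have m0 k y : 0 <= m k y by rewrite le_min ler01 mulr_ge0// ltW.
have m1 k y : m k y <= 1 by rewrite ge_min lexx.
have mphi : measurable_fun setT phi by have [[]] := phi_square_integrable.
have mm k : measurable_fun setT (m k).
  by apply: measurable_minr => //; exact: measurable_funM.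
have mmc k : cmeasurable setT (fun y => (m k y)%:C) by exact: cmeasurable_real.
pose h k (y : freq) : \bar R := (normc (f y - (m k y)%:C * f y) ^+ 2)%:E.
have mh k : measurable_fun setT (h k).
  by apply: measurable_energy; apply: cmeasurableB => //; exact: cmeasurableM.
have hE k y : h k y = (((1 - m k y) * normc (f y)) ^+ 2)%:E.
  rewrite /h (_ : f y - (m k y)%:C * f y = (1 - m k y)%:C * f y); last first.
    by rewrite rmorphB mulrBl mul1r.
  by rewrite normcM normc_real ger0_norm// subr_ge0.
have hcvg y : h k y @[k --> \oo] --> (0 : \bar R)%E.
  apply: cvg_near_cst; near=> k; rewrite hE (_ : m k y = 1) ?subrr ?mul0r ?expr0n//.
  apply/min_idPl; rewrite -ler_pdivrMr//.
  by near: k; exact: nbhs_infty_ger.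
have Ff : nu.-integrable setT (fun y : freq => (normc (f y) ^+ 2)%:E).
  apply/integrableP; split; first exact: measurable_energy.
  by under eq_integral do rewrite gee0_abs ?lee_fin ?sqr_ge0//; exact: f2.2.
have hle : {ae nu, forall y, forall k, setT y -> (`|h k y| <= (normc (f y) ^+ 2)%:E)%E}.
  apply: aeW => y k _; rewrite hE gee0_abs ?lee_fin ?sqr_ge0// exprMn.
  rewrite ler_piMl ?sqr_ge0// expr_le1// ?subr_ge0//.
  by rewrite lerBlDr lerDl.
have h0 : {ae nu, forall y, setT y -> h k y @[k --> \oo] --> (cst 0%E y : \bar R)}.
  by apply: aeW => y _; exact: hcvg.
have [_ _] := dominated_convergence measurableT mh (measurable_cst _) h0 Ff hle.
rewrite integral0 => /fine_cvgP[[k1 _ fin1] /cvgrPdist_le/(_ e e0)[k2 _ H2]].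
pose k := maxn k1 k2.
have H : (energy nu (fun y => f y - (m k y)%:C * f y)%R <= e%:E)%E.
  have := H2 k (leq_maxr _ _); have := fin1 k (leq_maxl _ _) => /= fink.
  rewrite sub0r normrN -lee_fin => H; rewrite /energy -[leLHS]fineK//.
  by apply: le_trans H; rewrite lee_fin ler_norm.
have mk1 y : normc (m k y)%:C <= 1 by rewrite normc_real ger0_norm.
exists (fun y => (m k y)%:C * f y); split=> //; last exact: square_integrableMl mk1.
have fphi : cintegrable nu (fun y => k%:R%:C * (f y * (phi y)%:C)).
  by apply: cintegrableZ; exact: square_integrable_mul.
apply: (@le_cintegrable _ _ _ nu _ (fun y => normc (k%:R%:C * (f y * (phi y)%:C)))).
- exact: cmeasurableM.
- exact: measurable_normc fphi.1.
- move=> y; rewrite !normcM !normc_real !ger0_norm//; last exact: ltW.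
  rewrite [leRHS]mulrCA mulrC ler_wpM2l ?normc_ge0//.
  by rewrite ge_min lexx orbT.
- exact: fphi.2.
Unshelve. all: by end_near. Qed.

End truncation.

Section representation.
Context {R : realType}.
Notation leb := (@lebesgue_measure R).
Notation freq := (int * measurableTypeR R)%type.
Notation plane := (measurableTypeR R * measurableTypeR R)%type.
Notation nu := (prod_measure (@countZ R) leb).
Notation lam := (prod_measure leb leb).
Notation pi2 := (pi *+ 2 : R).
Implicit Types f g : freq -> R[i].
Implicit Types a b : plane -> R[i].

Lemma cmeasurable_conv f g : cmeasurable setT f -> cmeasurable setT g ->
  cmeasurable setT (conv f g).
Proof.
move=> mf mg.
pose G (z : freq * freq) := f z.2 * g (z.1 - z.2).
apply: (@cmeasurable_cintegral_prod R _ _ freq freq nu G).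
apply: cmeasurableM; first exact: (cmeasurable_comp mf measurable_snd).
apply: (cmeasurable_comp mg).
by apply: measurable_freq_sub; [exact: measurable_fst|exact: measurable_snd].
Qed.

Lemma energy_refl g x : cmeasurable setT g ->
  energy nu (fun y => g (x - y)) = energy nu g.
Proof.
move=> mg; rewrite /energy.
by rewrite (@ge0_integral_freq_refl R x (fun y => (normc (g y) ^+ 2)%:E))//;
  [exact: measurable_energy|move=> y; rewrite lee_fin sqr_ge0].
Qed.

Lemma normc_conv_le f g (A B : R) x : cmeasurable setT f -> cmeasurable setT g ->
  0 <= A -> 0 <= B -> (energy nu f <= (A ^+ 2)%:E)%E -> (energy nu g <= (B ^+ 2)%:E)%E ->
  normc (conv f g x) <= 2 * (A * B).
Proof.
move=> mf mg A0 B0 fA gB; apply: normc_cintegral_mul_le => //.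
  apply: (cmeasurable_comp mg).
  by apply: measurable_freq_sub => //; exact: measurable_cst.
by rewrite energy_refl.
Qed.

Lemma convB f g f' g' x : square_integrable nu setT f -> square_integrable nu setT g ->
  square_integrable nu setT f' -> square_integrable nu setT g' ->
  conv f g x - conv f' g' x =
  conv (fun y => f y - f' y) g x + conv f' (fun y => g y - g' y) x.
Proof.
move=> f2 g2 f'2 g'2.
have i (u v : freq -> R[i]) : square_integrable nu setT u -> square_integrable nu setT v ->
    cintegrable nu (fun y => u y * v (x - y)).
  by move=> u2 v2; apply: square_integrable_mul => //; exact: square_integrable_refl.
rewrite /conv -cintegralB; [|exact: i|exact: i].
rewrite -cintegralD; [|apply: (i (fun y => f y - f' y) g) => //; exact: square_integrableB
  |apply: (i f' (fun y => g y - g' y)) => //; exact: square_integrableB].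
by apply: eq_cintegral => y; ring.
Qed.

Section wave_energy.
Variables (I : set R) (psi : R -> R) (n : int).
Hypothesis tpsi : test_function I psi.

Lemma wave_bounded : exists2 K, 0 <= K & forall p, normc (wave n psi p) <= K.
Proof.
have [K K0 HK] := test_function_bounded tpsi; exists K => // p.
rewrite /wave !normcM normc_cis mul1r !normc_real.
apply: (le_trans _ (HK p.1)); rewrite ler_piMr//.
by rewrite ger0_norm// indicE; case: (_ \in _).
Qed.

Lemma wave_square_integrable : square_integrable lam setT (wave n psi).
Proof.
have [K _ HK] := wave_bounded.
exact: (bounded_square_integrable (cintegrable_wave n tpsi) HK).
Qed.

Lemma mode_square_integrable : square_integrable nu setT (mode n psi).
Proof.
have [K _ HK] := mode_bounded n tpsi.
exact: (bounded_square_integrable (cintegrable_mode n tpsi) HK).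
Qed.

End wave_energy.

Variable T : R.
Notation D := (`]0%R, T[%classic `*` torus).

Lemma measurable_cylinder : measurable (D : set plane).
Proof. by apply: measurableX => //; exact: measurable_torus. Qed.

Definition cut a (p : plane) : R[i] := a p * (\1_D p)%:C.

Lemma cmeasurable_cut a : cmeasurable setT a -> cmeasurable setT (cut a).
Proof.
move=> ma; apply: cmeasurableM => //; apply: cmeasurable_real.
by apply: measurable_indic; exact: measurable_cylinder.
Qed.

Lemma energy_cut a : cmeasurable setT a ->
  energy lam (cut a) = (\int[lam]_(p in D) (normc (a p) ^+ 2)%:E)%E.
Proof.
move=> ma; rewrite [RHS]integral_mkcond; apply: eq_integral => p _.
rewrite patchE /cut indicE; case: ifPn => _; first by rewrite mulr1.
by rewrite mulr0 normc_real normr0 expr0n.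
Qed.

Lemma wave_cut psi n a p : test_function `]0, T[ psi ->
  cut a p * wave n psi p = a p * wave n psi p.
Proof.
move=> [_ [K [_ KI K0]]]; rewrite /cut /wave indicE.
have [|pD] := boolP (p \in D); first by rewrite mulr1.
have [pT|pT] := boolP (p.2 \in torus); last first.
  by rewrite !indicE (negbTE pT) !mulr0.
rewrite K0 ?mul0r ?mulr0// => /KI pI; case/negP: pD; rewrite inE; split=> //.
by rewrite inE in pT.
Qed.

(** [a] is the function on the space-time cylinder with spectrum [f]: synthesis
    is only defined by an integral for integrable spectra, so the relation is
    taken up to limits in the mean. *)
Definition synthesizes f a : Prop :=
  [/\ square_integrable nu setT f, square_integrable lam setT a &
   forall e, 0 < e -> exists g, [/\ cintegrable nu g, square_integrable nu setT g,
     (energy nu (fun y => f y - g y)%R <= (e ^+ 2)%:E)%E &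
     (energy lam (fun p => a p - cut (synth g) p)%R <= (e ^+ 2)%:E)%E]].

Lemma square_integrable_cut_synth g : cintegrable nu g -> square_integrable nu setT g ->
  square_integrable lam setT (cut (synth g)).
Proof.
move=> gi g2; have mg := cmeasurable_synth gi; split; first exact: cmeasurable_cut.
rewrite -/(energy lam (cut (synth g))) energy_cut//; have [C C0 HC] := synth_bessel T.
apply: (le_lt_trans (HC g gi g2)).
by rewrite lte_mul_pinfty//; exact: g2.2.
Qed.

Lemma synthesizes_pairing f a psi n : synthesizes f a -> test_function `]0, T[ psi ->
  cintegral lam setT (fun p => a p * wave n psi p) =
  cintegral nu setT (fun y => f y * mode n psi y).
Proof.
move=> [f2 a2 approx] tpsi.
have w2 := wave_square_integrable n tpsi; have m2 := mode_square_integrable n tpsi.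
have [W W0 WE] := energy_le_sqr w2; have [M M0 ME] := energy_le_sqr m2.
apply: (@normc_small_eq _ _ _ (2 * (W + M))) => e e0 _.
have [g [gi g2 fg ag]] := approx e e0.
have s2 := square_integrable_cut_synth gi g2.
have E : cintegral lam setT (fun p => a p * wave n psi p) -
    cintegral nu setT (fun y => f y * mode n psi y) =
    cintegral lam setT (fun p => (a p - cut (synth g) p) * wave n psi p) -
    cintegral nu setT (fun y => (f y - g y) * mode n psi y).
  under [X in _ = X - _]eq_cintegral do rewrite mulrBl.
  under [X in _ = _ - X]eq_cintegral do rewrite mulrBl.
  rewrite cintegralB; [|exact: square_integrable_mul|exact: square_integrable_mul].
  rewrite cintegralB; [|exact: square_integrable_mul|exact: square_integrable_mul].
  under [X in _ = _ - X - _]eq_cintegral do rewrite (wave_cut _ _ _ tpsi).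
  rewrite (synth_wave_pairing gi n tpsi); ring.
rewrite E; apply: (le_trans (ler_normcB _ _)).
rewrite (_ : _ * e = 2 * (e * W) + 2 * (e * M)); last by ring.
apply: lerD.
  apply: normc_cintegral_mul_le => //; [|exact: w2.1|exact: ltW|exact: ltW].
  exact: (cmeasurableB a2.1 s2.1).
apply: normc_cintegral_mul_le => //; [|exact: m2.1|exact: ltW|exact: ltW].
exact: (cmeasurableB f2.1 g2.1).
Qed.

(** Both sides are bilinear and continuous in the mean, so the formula for
    integrable spectra extends to limits. *)
Lemma synthesizes_product f a g b psi n : synthesizes f a -> synthesizes g b ->
  test_function `]0, T[ psi ->
  cintegral lam setT (fun p => a p * b p * wave n psi p) =
  ((pi2 ^+ 2)^-1)%:C * cintegral nu setT (fun y => conv f g y * mode n psi y).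
Proof.
move=> [f2 a2 fa] [g2 b2 gb] tpsi.
have wi := cintegrable_wave n tpsi; have mi := cintegrable_mode n tpsi.
have [K K0 wK] := wave_bounded n tpsi.
have [A A0 aA] := energy_le_sqr a2; have [B B0 bB] := energy_le_sqr b2.
have [F F0 fF] := energy_le_sqr f2; have [G G0 gG] := energy_le_sqr g2.
pose M := fine (\int[nu]_y (normc (mode n psi y))%:E).
have ME : (\int[nu]_y (normc (mode n psi y))%:E = M%:E)%E.
  rewrite fineK// ge0_fin_numE; first exact: mi.2.
  by apply: integral_ge0 => y _; rewrite lee_fin normc_ge0.
have M0 : 0 <= M by apply: fine_ge0; apply: integral_ge0 => y _; rewrite lee_fin normc_ge0.
pose c : R[i] := ((pi2 ^+ 2)^-1)%:C.
(* an approximant within distance e <= 1 has norm at most 2 r + 2 *)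
have near_bound d (X : measurableType d) (mu : {measure set X -> \bar R}) (u v : X -> R[i]) (r e : R) :
    square_integrable mu setT u -> square_integrable mu setT v -> 0 < r -> 0 < e -> e <= 1 ->
    (energy mu u <= (r ^+ 2)%:E)%E ->
    (energy mu (fun x => u x - v x)%R <= (e ^+ 2)%:E)%E ->
    (energy mu v <= ((2 * r + 2) ^+ 2)%:E)%E.
  move=> u2 v2 r0 e0 e1 ur uv.
  have H : (energy mu v <= 2%:E * (energy mu u + energy mu (fun x => v x - u x)%R))%E.
    rewrite (_ : v = (fun x => u x + (v x - u x))); last by apply/funext => x; ring.
    have E : (fun x => u x + (v x - u x) - u x) = (fun x => v x - u x).
      by apply/funext => x; ring.
    by rewrite E; apply: energyD; [exact: u2.1|exact: (cmeasurableB v2.1 u2.1)].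
  have vu : energy mu (fun x => v x - u x)%R = energy mu (fun x => u x - v x)%R.
    by rewrite -energyN; congr energy; apply/funext => x; ring.
  rewrite vu in H; apply: (le_trans H).
  apply: (@le_trans _ _ (2%:E * ((r ^+ 2)%:E + (e ^+ 2)%:E))%E).
    by apply: lee_wpmul2l; rewrite ?lee_fin//; exact: leeD.
  by rewrite -EFinD -EFinM lee_fin; nra.
apply: (@normc_small_eq _ _ _ (2 * (K * B) + 2 * (K * (2 * A + 2)) +
  normc c * (2 * ((2 * G + 2 * (2 * F + 2)) * M)))) => e e0 e1.
have [f' [f'i f'2 ff' aa']] := fa e e0; have [g' [g'i g'2 gg' bb']] := gb e e0.
have a'2 := square_integrable_cut_synth f'i f'2.
have b'2 := square_integrable_cut_synth g'i g'2.
pose a' := cut (synth f'); pose b' := cut (synth g').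
have w (u : plane -> R[i]) : square_integrable lam setT u ->
    square_integrable lam setT (fun p => wave n psi p * u p).
  by move=> u2; exact: (square_integrableMl u2 wi.1 wK).
have P : cintegral lam setT (fun p => a' p * b' p * wave n psi p) =
    c * cintegral nu setT (fun y => conv f' g' y * mode n psi y).
  rewrite -(synth_product_pairing f'i g'i f'2 g'2 n tpsi); apply: eq_cintegral => p.
  by rewrite -mulrA (wave_cut _ _ _ tpsi) mulrCA (wave_cut _ _ _ tpsi); ring.
have E1 : cintegral lam setT (fun p => a p * b p * wave n psi p) -
    cintegral lam setT (fun p => a' p * b' p * wave n psi p) =
    cintegral lam setT (fun p => (a p - a' p) * (wave n psi p * b p)) +
    cintegral lam setT (fun p => (b p - b' p) * (wave n psi p * a' p)).
  rewrite -cintegralD;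
    [|exact: (square_integrable_mul (square_integrableB a2 a'2) (w _ b2))
     |exact: (square_integrable_mul (square_integrableB b2 b'2) (w _ a'2))].
  rewrite -cintegralB; first by apply: eq_cintegral => p; ring.
  - rewrite (_ : (fun p => _) = (fun p => a p * (wave n psi p * b p))).
      exact: (square_integrable_mul a2 (w _ b2)).
    by apply/funext => p; ring.
  - rewrite (_ : (fun p => _) = (fun p => a' p * (wave n psi p * b' p))).
      exact: (square_integrable_mul a'2 (w _ b'2)).
    by apply/funext => p; ring.
have cb (u v : freq -> R[i]) : square_integrable nu setT u -> square_integrable nu setT v ->
    cintegrable nu (fun y => conv u v y * mode n psi y).
  move=> u2 v2; have [U U0 uU] := energy_le_sqr u2; have [V V0 vV] := energy_le_sqr v2.
  apply: (cintegrableMl (cmeasurable_conv u2.1 v2.1) _ mi) => x.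
  exact: (normc_conv_le x u2.1 v2.1 (ltW U0) (ltW V0) uU vV).
have E2 : cintegral nu setT (fun y => conv f g y * mode n psi y) -
    cintegral nu setT (fun y => conv f' g' y * mode n psi y) =
    cintegral nu setT (fun y => (conv f g y - conv f' g' y) * mode n psi y).
  rewrite -cintegralB; [|exact: cb|exact: cb].
  by apply: eq_cintegral => y; ring.
set X := cintegral lam _ _; set Y := cintegral nu _ _.
have -> : X - c * Y = (X - cintegral lam setT (fun p => a' p * b' p * wave n psi p)) -
    c * (Y - cintegral nu setT (fun y => conv f' g' y * mode n psi y)).
  by rewrite P; ring.
rewrite E1 E2; apply: (le_trans (ler_normcB _ _)); rewrite mulrDl; apply: lerD.
  apply: (le_trans (ler_normcD _ _)).
  rewrite [leRHS](_ : _ = 2 * (e * (K * B)) + 2 * (e * (K * (2 * A + 2)))); last by ring.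
  have K2 (u : plane -> R[i]) (r : R) : cmeasurable setT u -> 0 <= r ->
      (energy lam u <= (r ^+ 2)%:E)%E ->
      (energy lam (fun p => wave n psi p * u p)%R <= ((K * r) ^+ 2)%:E)%E.
    move=> mu0 r0 ur; apply: (le_trans (energyMl lam mu0 wi.1 wK)).
    rewrite [leRHS](_ : _ = (K ^+ 2)%:E * (r ^+ 2)%:E)%E; last by rewrite -EFinM exprMn.
    by apply: lee_wpmul2l => //; rewrite lee_fin sqr_ge0.
  have A2 : 0 <= 2 * A + 2 by rewrite addr_ge0// mulr_ge0// ltW.
  have KB0 : 0 <= K * B by rewrite mulr_ge0// ltW.
  have a'A := near_bound _ _ _ a a' A e a2 a'2 A0 e0 e1 aA aa'.
  apply: lerD.
    exact: (normc_cintegral_mul_le (cmeasurableB a2.1 a'2.1) (w _ b2).1 (ltW e0) KB0 aa'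
      (K2 _ _ b2.1 (ltW B0) bB)).
  exact: (normc_cintegral_mul_le (cmeasurableB b2.1 b'2.1) (w _ a'2).1 (ltW e0)
    (mulr_ge0 K0 A2) bb' (K2 _ _ a'2.1 A2 a'A)).
rewrite normcM -mulrA ler_wpM2l ?normc_ge0// -lee_fin.
have F2 : 0 <= 2 * F + 2 by rewrite addr_ge0// mulr_ge0// ltW.
have mcc : cmeasurable setT (fun y => conv f g y - conv f' g' y).
  by apply: cmeasurableB; apply: cmeasurable_conv; [exact: f2.1|exact: g2.1|exact: f'2.1|exact: g'2.1].
have cle (y : freq) : normc (conv f g y - conv f' g' y) <= (2 * G + 2 * (2 * F + 2)) * e.
  rewrite convB//; apply: (le_trans (ler_normcD _ _)).
  rewrite [leRHS](_ : _ = 2 * (e * G) + 2 * ((2 * F + 2) * e)); last by ring.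
  have f'F := near_bound _ _ _ f f' F e f2 f'2 F0 e0 e1 fF ff'.
  apply: lerD.
    exact: (normc_conv_le y (cmeasurableB f2.1 f'2.1) g2.1 (ltW e0) (ltW G0) ff' gG).
  exact: (normc_conv_le y f'2.1 (cmeasurableB g2.1 g'2.1) F2 (ltW e0) f'F gg').
apply: (le_trans (@normc_cintegral_le _ _ _ nu _ (cmeasurableM mcc mi.1))).
rewrite -mulrA [leRHS]EFinM; apply: lee_wpmul2l; first by rewrite lee_fin.
rewrite [(_ * M * e)%R]mulrAC [leRHS]EFinM -ME -ge0_integralZl_EFin//; last 3 first.
- by move=> y _; rewrite lee_fin normc_ge0.
- by apply/measurable_EFinP; exact: measurable_normc mi.1.
- by rewrite mulr_ge0 ?(ltW e0)// addr_ge0// mulr_ge0// ltW.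
apply: ge0_le_integral => //.
- by move=> y _; rewrite lee_fin normc_ge0.
- by apply/measurable_EFinP; exact: (measurable_normc (cmeasurableM mcc mi.1)).
- by apply: emeasurable_funM => //; apply/measurable_EFinP; exact: (measurable_normc mi.1).
- by move=> y _; rewrite -EFinM lee_fin normcM ler_wpM2r ?normc_ge0.
Qed.

Lemma synthB g h p : cintegrable nu g -> cintegrable nu h ->
  synth g p - synth h p = synth (fun y => g y - h y) p.
Proof.
move=> gi hi; rewrite /synth -mulrBr -cintegralB; [|exact: cintegrable_mul_chi..].
by congr (_ * _); apply: eq_cintegral => y; rewrite mulrBl.
Qed.

(** Bessel's inequality turns a rapidly converging sequence of integrable
    approximations of [f] into a Cauchy sequence of functions on the cylinder. *)
Lemma synthesizes_ex f : square_integrable nu setT f -> exists a, synthesizes f a.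
Proof.
move=> f2; have [C C0 HC] := synth_bessel T.
have p0 j : 0 < (16^-1) ^+ j :> R by rewrite exprn_gt0.
have /choice[g gP] j := integrable_square_integrable_dense (p0 j) f2.
have gi j : cintegrable nu (g j) by have [] := gP j.
have g2 j : square_integrable nu setT (g j) by have [] := gP j.
have fg j : (energy nu (fun y => f y - g j y)%R <= ((16^-1) ^+ j)%:E)%E by have [] := gP j.
have s2 j := square_integrable_cut_synth (gi j) (g2 j).
have step j : (energy lam (fun p => cut (synth (g j.+1)) p - cut (synth (g j)) p)%R <=
    (C * 4 / 16 ^+ j)%:E)%E.
  have E : (fun p => cut (synth (g j.+1)) p - cut (synth (g j)) p) =
      cut (synth (fun y => g j.+1 y - g j y)).
    by apply/funext => p; rewrite /cut -mulrBl synthB.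
  have di : cintegrable nu (fun y => g j.+1 y - g j y).
    by apply: cintegrableD => //; exact: cintegrableN.
  have d2 := square_integrableB (g2 j.+1) (g2 j).
  rewrite E energy_cut; last exact: cmeasurable_synth.
  apply: (le_trans (HC _ di d2)).
  rewrite -mulrA EFinM; apply: lee_wpmul2l; first by rewrite lee_fin.
  have E' : (fun y => g j.+1 y - g j y) = (fun y => - (f y - g j.+1 y) + (f y - g j y)).
    by apply/funext => y; ring.
  rewrite -/(energy nu (fun y => g j.+1 y - g j y)) E'.
  have m1 := cmeasurableB f2.1 (g2 j.+1).1; have m2 := cmeasurableB f2.1 (g2 j).1.
  apply: (le_trans (energyD nu (cmeasurableN m1) m2)).
  rewrite energyN; apply: (le_trans (lee_wpmul2l _ (leeD (fg j.+1) (fg j)))); first by rewrite lee_fin.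
  rewrite -EFinD -EFinM lee_fin exprS -exprVn.
  by have := p0 j; lra.
have [a a2 aP] := riesz_fischer s2 step.
exists a; split=> // e e0; have e20 : 0 < e ^+ 2 by rewrite exprn_gt0.
have [k1 H1] := aP _ e20.
have cg : geometric 1 (16^-1) @ \oo --> (0 : R).
  by apply: cvg_geometric; rewrite ger0_norm ?invr_ge0// invf_lt1// ltr1n.
have /cvgrPdist_le/(_ _ e20)[k2 _ H2] := cg.
pose k := maxn k1 k2.
exists (g k); split=> //; last exact: (H1 k (leq_maxl _ _)).
apply: (le_trans (fg k)); rewrite lee_fin; have := H2 k (leq_maxr _ _).
by rewrite /= sub0r normrN mul1r ger0_norm// ltW.
Qed.

End representation.

(** * Uniqueness of the Fourier coefficients on the cylinder *)

Section bernoulli.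
Context {R : realType}.
Implicit Types q y : R.

Lemma bernoulli_le y N : -1 <= y -> 1 + N%:R * y <= (1 + y) ^+ N.
Proof.
move=> y1; elim: N => [|N IHN]; first by rewrite mul0r addr0 expr0.
have H : 0 <= (1 + y) * ((1 + y) ^+ N - (1 + N%:R * y)).
  by rewrite mulr_ge0 ?subr_ge0//; lra.
rewrite exprS -natr1; have := sqr_ge0 y; have : 0 <= N%:R :> R by [].
by nra.
Qed.

Lemma cvg_natM_expr q : 0 <= q < 1 -> k%:R * q ^+ k @[k --> \oo] --> (0 : R).
Proof.
move=> /andP[]; rewrite le_eqVlt => /orP[/eqP <- _|q0 q1].
  apply: cvg_near_cst; near=> k; rewrite expr0n.
  have : (0 < k)%N by near: k; exact: nbhs_infty_gt.
  by rewrite lt0n => /negbTE ->; rewrite mulr0.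
pose s := Num.sqrt q.
have s0 : 0 < s by rewrite sqrtr_gt0.
have sq : s ^+ 2 = q by rewrite sqr_sqrtr// ltW.
have s1 : s < 1 by rewrite -(@ltr_pXn2r _ 2) ?nnegrE ?ltW// sq expr1n.
pose d := s^-1 - 1.
have d0 : 0 < d by rewrite subr_gt0 -[ltLHS]invr1 ltf_pV2 ?posrE.
have bound k : k%:R * q ^+ k <= d^-1 * s ^+ k.
  rewrite -sq -exprM mulnC exprM expr2 mulrA ler_wpM2r ?exprn_ge0 ?(ltW s0)//.
  have p0 : 0 < s ^+ k by rewrite exprn_gt0.
  have H : 1 + k%:R * d <= (s ^+ k)^-1.
    rewrite -exprVn (_ : s^-1 = 1 + d); last by rewrite /d addrC subrK.
    by apply: bernoulli_le; lra.
  rewrite -(ler_pM2r d0) mulVf ?gt_eqF//.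
  have : (1 + k%:R * d) * s ^+ k <= 1 by rewrite -ler_pdivlMr ?div1r.
  by have := ltW p0; nra.
apply: (@squeeze_cvgr _ _ _ _ (cst 0) (fun k => d^-1 * s ^+ k)).
- by near=> k; rewrite bound andbT mulr_ge0// exprn_ge0// ltW.
- exact: cvg_cst.
- have := @cvg_geometric R d^-1 s; apply.
  by rewrite ger0_norm ?(ltW s0).
Unshelve. all: by end_near. Qed.

(** [1 - (1 - z ^ k) ^ (k 2 ^ k)]: a polynomial in [z] that tends, on [[0, 1]],
    to the indicator of [1 / 2 <= z]. *)
Definition step_poly (k : nat) (z : R) : R := 1 - (1 - z ^+ k) ^+ (k * 2 ^ k).

Lemma step_poly_itv k z : 0 <= z <= 1 -> 0 <= step_poly k z <= 1.
Proof.
move=> /andP[z0 z1]; have zk0 : 0 <= z ^+ k by rewrite exprn_ge0.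
have zk1 : z ^+ k <= 1 by rewrite exprn_ile1.
rewrite /step_poly; set N := (k * _)%N.
have h0 : 0 <= (1 - z ^+ k) ^+ N by rewrite exprn_ge0// subr_ge0.
have h1 : (1 - z ^+ k) ^+ N <= 1 by rewrite exprn_ile1 ?subr_ge0// lerBlDr lerDl.
by apply/andP; split; lra.
Qed.

(** To the left of [1 / 2], the value is at most [k * (2 z) ^ k] by Bernoulli's
    inequality; to the right, [(1 - z ^ k) ^ (k 2 ^ k)] is at most [1 / (1 + k)]
    since [(1 - y) ^ N * (1 + N y) <= 1]. *)
Lemma step_poly_cvg z : 0 <= z <= 1 ->
  step_poly k z @[k --> \oo] --> ((2^-1 <= z)%R%:R : R).
Proof.
move=> z01; have /andP[z0 z1] := z01; have [zge|zlt] := leP 2^-1 z.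
  have cg : k.+1%:R^-1 @[k --> \oo] --> (0 : R) by exact: cvg_harmonic.
  apply: (@squeeze_cvgr _ _ _ _ (fun k => 1 - k.+1%:R^-1) (cst 1)).
  - near=> k; have /andP[_ ->] := step_poly_itv k z01; rewrite andbT.
    rewrite /step_poly lerD2l lerN2.
    have zk0 : 0 <= z ^+ k by rewrite exprn_ge0.
    have zk1 : z ^+ k <= 1 by rewrite exprn_ile1.
    set N := (k * _)%N.
    have h0 : 0 <= (1 - z ^+ k) ^+ N by rewrite exprn_ge0// subr_ge0.
    have B : 1 + N%:R * z ^+ k <= (1 + z ^+ k) ^+ N by apply: bernoulli_le; lra.
    have Nk : k%:R <= N%:R * z ^+ k.
      rewrite natrM -mulrA ler_peMr// natrX -exprMn exprn_ege1//; lra.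
    have P : (1 - z ^+ k) ^+ N * (1 + z ^+ k) ^+ N <= 1.
      rewrite -exprMn exprn_ile1//; nra.
    have k0 : 0 <= k%:R :> R by [].
    rewrite -[leRHS]div1r ler_pdivlMr// -natr1.
    apply: le_trans P; apply: ler_wpM2l => //; lra.
  - rewrite -[X in _ --> X]subr0; apply: cvgB => //; exact: cvg_cst.
  - exact: cvg_cst.
apply: (@squeeze_cvgr _ _ _ _ (cst 0) (fun k => k%:R * (2 * z) ^+ k)).
- near=> k; have /andP[-> _] := step_poly_itv k z01; rewrite /=.
  have zk1 : z ^+ k <= 1 by rewrite exprn_ile1.
  have := @bernoulli_le (- z ^+ k) (k * 2 ^ k).
  rewrite lerN2 => /(_ zk1) H; rewrite /step_poly exprMn mulrA.
  move: H; rewrite natrM natrX mulrN; lra.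
- exact: cvg_cst.
- by apply: cvg_natM_expr; lra.
Unshelve. all: by end_near. Qed.

End bernoulli.

Section trigonometric_polynomials.
Context {R : realType}.
Implicit Types f g : R -> R[i].

(** Finite combinations of the spatial exponentials, as a class of functions
    closed under products; its members inherit every linear property of the
    exponentials. *)
Inductive trigpoly : (R -> R[i]) -> Prop :=
| trigpoly_cis (n : int) : trigpoly (fun x => cis (- (n%:~R * x)))
| trigpolyD f g : trigpoly f -> trigpoly g -> trigpoly (fun x => f x + g x)
| trigpolyZ (z : R[i]) f : trigpoly f -> trigpoly (fun x => z * f x).

Lemma trigpoly_cst (z : R[i]) : trigpoly (fun=> z).
Proof.
have := trigpolyZ z (trigpoly_cis 0); congr trigpoly; apply/funext => x.
by rewrite mul0r oppr0 cis0 mulr1.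
Qed.

Lemma trigpolyM f g : trigpoly f -> trigpoly g -> trigpoly (fun x => f x * g x).
Proof.
move=> tf tg; elim: tf => [n|f1 f2 _ H1 _ H2|z f1 _ H1].
- elim: tg => [m|g1 g2 _ H1 _ H2|z g1 _ H1].
  + have := trigpoly_cis (n + m); congr trigpoly; apply/funext => x.
    by rewrite -cisD; congr cis; rewrite intrD; ring.
  + by under eq_fun do rewrite mulrDr; exact: trigpolyD.
  + by under eq_fun do rewrite mulrCA; exact: trigpolyZ.
- by under eq_fun do rewrite mulrDl; exact: trigpolyD.
- by under eq_fun do rewrite -mulrA; exact: trigpolyZ.
Qed.

Lemma trigpolyX f k : trigpoly f -> trigpoly (fun x => f x ^+ k).
Proof.
move=> tf; elim: k => [|k IHk]; first exact: (trigpoly_cst 1).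
by under eq_fun do rewrite exprS; exact: trigpolyM.
Qed.

Lemma trigpoly_measurable f : trigpoly f -> cmeasurable setT f.
Proof.
elim => [n|f1 f2 _ H1 _ H2|z f1 _ H1].
- by apply: cmeasurable_cis; apply: measurable_funN; exact: measurable_funM.
- exact: cmeasurableD.
- by apply: cmeasurableM => //; exact: cmeasurable_cst.
Qed.

Lemma trigpoly_bounded f : trigpoly f -> exists K, forall x, normc (f x) <= K.
Proof.
elim => [n|f1 f2 _ [K1 H1] _ [K2 H2]|z f1 _ [K1 H1]].
- by exists 1 => x; rewrite normc_cis.
- by exists (K1 + K2) => x; apply: (le_trans (ler_normcD _ _)); exact: lerD.
- by exists (normc z * K1) => x; rewrite normcM ler_wpM2l ?normc_ge0.
Qed.

(** On [(0, 2 pi)] this is at least [1 / 2] exactly to the right of [b]. *)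
Definition tilt (b x : R) : R := 2^-1 + (cos (b / 2) - cos (x - b / 2)) / 4.

Lemma tilt_itv b x : 0 <= tilt b x <= 1.
Proof.
rewrite /tilt; have := cos_geN1 (b / 2); have := cos_geN1 (x - b / 2).
have := cos_le1 (b / 2); have := cos_le1 (x - b / 2).
by move: (cos _) (cos _) => u v *; apply/andP; split; lra.
Qed.

(** Twice the excess over [1 / 2] is [sin (x / 2) * sin ((x - b) / 2)], whose first
    factor is positive on a period. *)
Lemma tilt_ge b x : 0 <= b <= pi *+ 2 -> 0 < x < pi *+ 2 -> (2^-1 <= tilt b x) = (b <= x).
Proof.
rewrite mulr2n => /andP[b0 b1] /andP[x0 x1].
have -> : tilt b x = 2^-1 + sin (x / 2) * sin ((x - b) / 2) / 2.
  rewrite /tilt (_ : x - b / 2 = x / 2 + (x - b) / 2); last by field.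
  rewrite (_ : b / 2 = x / 2 - (x - b) / 2); last by field.
  by rewrite cosB cosD; field.
have sx : 0 < sin (x / 2) by apply: sin_gt0_pi; lra.
rewrite lerDl -mulrA pmulr_rge0// pmulr_lge0//.
have [bx|xb] := leP b x.
  by apply: sin_ge0_pi; lra.
apply/negbTE; rewrite -ltNge -oppr_gt0 -sinN.
by apply: sin_gt0_pi; lra.
Qed.

Lemma trigpoly_tilt b : trigpoly (fun x => (tilt b x)%:C).
Proof.
have E (x : R) : (tilt b x)%:C = (2^-1 + cos (b / 2) / 4)%:C +
    ((- 8^-1)%:C * cis (b / 2) * cis (- ((1 : int)%:~R * x)) +
     (- 8^-1)%:C * cis (- (b / 2)) * cis (- ((-1 : int)%:~R * x))).
  rewrite -!mulrA -!cisD mul1r mulN1r opprK /cis /tilt.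
  have -> : - (b / 2) + x = x - b / 2 by ring.
  have -> : b / 2 - x = - (x - b / 2) by ring.
  rewrite cosN sinN; move: (cos _) (cos _) (sin _) => u v w.
  by apply/eqP; rewrite eq_complex /=; apply/andP; split; apply/eqP; field.
rewrite (funext E); apply: trigpolyD; first exact: trigpoly_cst.
by apply: trigpolyD; apply: trigpolyZ; exact: trigpoly_cis.
Qed.

Lemma trigpoly_step k b : trigpoly (fun x => (step_poly k (tilt b x))%:C).
Proof.
have E (x : R) : (step_poly k (tilt b x))%:C =
    1 + (- 1) * (1 + (- 1) * (tilt b x)%:C ^+ k) ^+ (k * 2 ^ k).
  by rewrite /step_poly rmorphB rmorphXn rmorphB rmorphXn !mulN1r.
rewrite (funext E); apply: trigpolyD; first exact: (trigpoly_cst 1).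
apply: trigpolyZ; apply: trigpolyX; apply: trigpolyD; first exact: (trigpoly_cst 1).
by apply: trigpolyZ; apply: trigpolyX; exact: trigpoly_tilt.
Qed.

End trigonometric_polynomials.

Section vanishing_integrals.
Context {R : realType}.

(** The sets over which an integrable function has zero integral form a lambda
    system. The map [h] and the fixed set [B] make the argument applicable to one
    coordinate at a time, and then to the rectangles. *)
Lemma zero_integral_dynkin d (T : measurableType d) (mu : {measure set T -> \bar R})
    (u : T -> \bar R) d' (X : measurableType d') (h : T -> X) (B : set T) (G : set (set X)) :
  mu.-integrable setT u -> measurable_fun setT h -> measurable B ->
  @measurable _ X = <<s G >> -> setI_closed G ->
  (\int[mu]_(x in B) u x = 0)%E ->
  (forall S, G S -> (\int[mu]_(x in h @^-1` S `&` B) u x = 0)%E) ->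
  forall S, measurable S -> (\int[mu]_(x in h @^-1` S `&` B) u x = 0)%E.
Proof.
move=> ui mh mB GE GI B0 G0 S mS.
have mSB (A : set X) : measurable A -> measurable (h @^-1` A `&` B).
  by move=> mA; apply: measurableI => //; rewrite -[X in measurable X]setTI; exact: mh.
have iB (A : set T) : measurable A -> mu.-integrable A u.
  by move=> mA; apply: (integrableS measurableT mA) ui.
apply: (dynkin_induction GE GI (P := fun A => (\int[mu]_(x in h @^-1` A `&` B) u x = 0)%E)) => //.
- by rewrite preimage_setT setTI.
- move=> A mA A0.
  have mA' : measurable (~` (h @^-1` A) `&` B) by apply: (mSB (~` A)); exact: measurableC.
  rewrite (_ : h @^-1` (~` A) = ~` (h @^-1` A))//.
  have : (\int[mu]_(x in (h @^-1` A `&` B) `|` (~` (h @^-1` A) `&` B)) u x = 0)%E.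
    by rewrite -setIUl setUv setTI.
  rewrite integral_setU//; first by rewrite A0 add0e.
  - exact: mSB.
  - by apply: measurable_funTS; exact: measurable_int ui.
  - by apply/disj_setPLR => x [+ _] [+ _] => /[swap].
- move=> F mF tF F0; rewrite preimage_bigcup setI_bigcupl integral_bigcup.
  + by apply: eseries0 => i _ _; exact: F0.
  + apply/trivIsetP => i j _ _ ij; apply/seteqP; split=> // x [[Fi _] [Fj _]].
    by have /trivIsetP/(_ i j I I ij)/seteqP[/(_ (h x)) + _] := tF; apply.
  + by move=> k; exact: mSB.
  + by apply: iB; apply: bigcup_measurable => k _; exact: mSB.
- by rewrite -GE.
Qed.

Variables (T : R).
Notation leb := (@lebesgue_measure R).
Notation plane := (measurableTypeR R * measurableTypeR R)%type.
Notation lam := (prod_measure leb leb).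
Notation D := (`]0%R, T[%classic `*` torus).

Section real_density.
Variable u : plane -> R.
Hypothesis ui : lam.-integrable setT (EFin \o u).
Hypothesis uD : forall p, ~ D p -> u p = 0.
Hypothesis u0 : forall psi b k, test_function `]0, T[ psi ->
  (\int[lam]_p (u p * (psi p.1 * step_poly k (tilt b p.2)))%:E = 0)%E.

Let measurable_u : measurable_fun setT u.
Proof. by apply/measurable_EFinP; exact: measurable_int ui. Qed.

(** Test functions in time and step polynomials in space converge boundedly to
    the indicators of half lines. The corner [(a, b)] is first moved into the
    closure of the cylinder, outside which [u] vanishes. *)
Let quadrant (a b : R) : (\int[lam]_(p in fst @^-1` `]a, +oo[ `&` snd @^-1` `[b, +oo[) (u p)%:E = 0)%E.
Proof.
pose a' := Num.max a 0; pose b' := Num.min (Num.max b 0) (pi *+ 2).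
have b'I : 0 <= b' <= pi *+ 2.
  have p0 : 0 <= pi *+ 2 :> R by rewrite mulrn_wge0// pi_ge0.
  by rewrite /b' le_min le_max lexx orbT p0 ge_min lexx orbT.
pose F k (p : plane) := u p * (bump a' T k p.1 * step_poly k (tilt b' p.2)).
have tb k : test_function `]0, T[ (bump a' T k).
  apply: bump_test => t /=; rewrite !in_itv/= => /andP[+ ->]; rewrite andbT.
  by apply: le_lt_trans; rewrite le_max lexx orbT.
have mS k : measurable_fun setT (fun p : plane => step_poly k (tilt b' p.2)).
  have [+ _] := trigpoly_measurable (trigpoly_step k b') => H.
  exact: (measurableT_comp H measurable_snd).
have mF k : measurable_fun setT (EFin \o F k).
  apply/measurable_EFinP; apply: measurable_funM => //; apply: measurable_funM => //.
  exact: (measurableT_comp (measurable_test_function (tb k)) measurable_fst).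
pose E := fst @^-1` `]a, +oo[%classic `&` snd @^-1` `[b, +oo[%classic : set plane.
have mE : measurable E.
  by apply: measurableI; rewrite -[X in measurable X]setTI;
    [apply: measurable_fst|apply: measurable_snd].
rewrite -/E; pose Fl (p : plane) : \bar R := ((EFin \o u) \_ E) p.
have cF p : setT p -> EFin \o F ^~ p @ \oo --> Fl p.
  move=> _; rewrite /Fl patchE.
  have [pD|pD] := pselect (D p); last first.
    rewrite /= uD//; have -> : (if p \in E then 0%:E else 0%E : \bar R) = 0%:E by case: ifP.
    by apply: cvg_near_cst; near=> k; rewrite /= /F uD// mul0r.
  have [tT xT] := pD; move: tT xT; rewrite /= !in_itv/= => /andP[t0 tT] xT.
  have cS : step_poly k (tilt b' p.2) @[k --> \oo] --> ((b <= p.2)%R%:R : R).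
    have := step_poly_cvg (tilt_itv b' p.2).
    rewrite (tilt_ge b'I)//; suff -> : (b' <= p.2) = (b <= p.2) by [].
    have /andP[x0 x2] : 0 < p.2 < pi *+ 2 by move: xT; rewrite /torus/= in_itv.
    rewrite /b' ge_min ge_max (leNgt (pi *+ 2)) x2 orbF (ltW x0) andbT.
    by [].
  have cB : bump a' T k p.1 @[k --> \oo] --> ((a < p.1)%R%:R : R).
    have aE : (a' < p.1) = (a < p.1) by rewrite /a' gt_max t0 andbT.
    have [ap|ap] := boolP (a < p.1).
      by apply: bump_cvg; rewrite aE ap tT.
    apply: cvg_near_cst; near=> k; apply: bump_out.
    by rewrite aE (negbTE ap).
  have : F k p @[k --> \oo] --> (u p * ((a < p.1)%R%:R * (b <= p.2)%R%:R) : R).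
    by apply: cvgM; [exact: cvg_cst|exact: cvgM].
  have -> : (if p \in E then (EFin \o u) p else 0%E : \bar R) =
      (u p * ((a < p.1)%R%:R * (b <= p.2)%R%:R))%:E.
    have -> : (p \in E) = (a < p.1) && (b <= p.2).
      apply/idP/idP => [|/andP[h1 h2]].
        by rewrite inE => -[]; rewrite /= !in_itv/= !andbT => -> ->.
      by rewrite inE; split; rewrite /= in_itv/= andbT.
    by case: (a < p.1); case: (b <= p.2); rewrite /= ?mulr1 ?mulr0.
  by move=> H; apply: cvg_EFin => //; exact: nearW.
have dom : {ae lam, forall p, forall k, setT p -> (`|(EFin \o F k) p| <= (`|u p|%R)%:E)%E}.
  apply: aeW => p k _ /=; rewrite lee_fin normrM ler_piMr// ger0_norm.
    have /andP[s0 s1] := step_poly_itv k (tilt_itv b' p.2).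
    by rewrite mulr_ile1// ?bump_ge0 ?bump_le1.
  have /andP[s0 s1] := step_poly_itv k (tilt_itv b' p.2).
  by rewrite mulr_ge0// bump_ge0.
have iu : lam.-integrable setT (fun p => (`|u p|%R)%:E).
  by have := integrable_norm ui.
have mFl : measurable_fun setT Fl.
  by apply/(measurable_restrictT _ _).1 => //; apply: measurable_funTS; exact/measurable_EFinP.
have [_ _] := dominated_convergence measurableT mF mFl (aeW _ cF) iu dom.
rewrite /Fl -integral_mkcond => H.
have /cvg_lim <- := H; rewrite // (_ : [sequence _]_n = cst 0%E) ?lim_cst//.
by apply/funext => k /=; exact: u0.
Unshelve. all: by end_near. Qed.

Lemma real_density_ae_eq0 : ae_eq lam setT (EFin \o u) (cst 0%E).
Proof.
have mh : measurable_fun setT (EFin \o u) by exact/measurable_EFinP.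
have off (A B : set plane) : measurable A -> measurable B ->
    (forall p, D p -> A p <-> B p) ->
    (\int[lam]_(p in A) (u p)%:E = \int[lam]_(p in B) (u p)%:E)%E.
  move=> mA mB AB; rewrite integral_mkcond [RHS]integral_mkcond; apply: eq_integral => p _.
  rewrite !patchE; have [pD|pD] := pselect (D p); last by rewrite /= uD//; do 2 case: ifP.
  by rewrite (_ : (p \in A) = (p \in B))//; apply/idP/idP; rewrite !inE => /(AB p pD).
have mfst (A : set (measurableTypeR R)) : measurable A -> measurable (fst @^-1` A : set plane).
  by move=> mA; rewrite -[X in measurable X]setTI; exact: measurable_fst.
have msnd (A : set (measurableTypeR R)) : measurable A -> measurable (snd @^-1` A : set plane).
  by move=> mA; rewrite -[X in measurable X]setTI; exact: measurable_snd.
have S1 b (A : set (measurableTypeR R)) : measurable A ->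
    (\int[lam]_(p in fst @^-1` A `&` snd @^-1` `[b, +oo[) (u p)%:E = 0)%E.
  have GI : setI_closed (RGenOInfty.G (R := R)).
    move=> _ _ [x ->] [y ->]; exists (Num.max x y); apply/seteqP; split => z /=;
      rewrite !in_itv/= !andbT gt_max; first by move=> [-> ->].
    by move=> /andP[].
  have mb : measurable (snd @^-1` `[b, +oo[ : set plane) by exact: msnd.
  have B0 : (\int[lam]_(p in snd @^-1` `[b, +oo[) (u p)%:E = 0)%E.
    rewrite -(quadrant 0 b); apply: off; [exact: mb| |].
      by apply: measurableI; [exact: mfst|exact: msnd].
    move=> p [+ _]; rewrite /= !in_itv/= !andbT => /andP[t0 _].
    by split; [move=> H; split|move=> []].
  have G0 (S : set R) : RGenOInfty.G S ->
      (\int[lam]_(p in fst @^-1` S `&` snd @^-1` `[b, +oo[) (u p)%:E = 0)%E.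
    by move=> [x ->]; exact: quadrant.
  exact: (zero_integral_dynkin ui (measurable_fst (T1 := measurableTypeR R)
    (T2 := measurableTypeR R)) mb (RGenOInfty.measurableE R) GI B0 G0).
have S2 (A B : set (measurableTypeR R)) : measurable A -> measurable B ->
    (\int[lam]_(p in snd @^-1` B `&` fst @^-1` A) (u p)%:E = 0)%E.
  move=> mA.
  have GI : setI_closed (RGenCInfty.G (R := R)).
    move=> _ _ [x ->] [y ->]; exists (Num.max x y); apply/seteqP; split => z /=;
      rewrite !in_itv/= !andbT ge_max; first by move=> [-> ->].
    by move=> /andP[].
  have B0 : (\int[lam]_(p in fst @^-1` A) (u p)%:E = 0)%E.
    rewrite -(S1 0 A mA); apply: off; [exact: mfst| |].
      by apply: measurableI; [exact: mfst|exact: msnd].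
    move=> p [_ +]; rewrite /= /torus/= !in_itv/= !andbT => /andP[/ltW t0 _].
    by split; [move=> H; split|move=> []].
  have G0 (S : set R) : RGenCInfty.G S ->
      (\int[lam]_(p in snd @^-1` S `&` fst @^-1` A) (u p)%:E = 0)%E.
    by move=> [x ->]; rewrite setIC; exact: S1.
  exact: (zero_integral_dynkin ui (measurable_snd (T1 := measurableTypeR R)
    (T2 := measurableTypeR R)) (mfst A mA) (RGenCInfty.measurableE R) GI B0 G0).
apply: integral_ae_eq => // E _ mE; rewrite integral0 -[E]setIT.
pose G := [set A `*` B | A in @measurable _ (measurableTypeR R) &
  B in @measurable _ (measurableTypeR R)].
have GI : setI_closed G.
  move=> _ _ [A1 mA1 [B1 mB1 <-]] [A2 mA2 [B2 mB2 <-]].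
  exists (A1 `&` A2); first exact: measurableI.
  exists (B1 `&` B2); first exact: measurableI.
  by rewrite setXI.
have T0 : (\int[lam]_(p in setT) (u p)%:E = 0)%E.
  have := S2 setT setT measurableT measurableT.
  by rewrite !preimage_setT setTI.
have G0 (S : set plane) : G S -> (\int[lam]_(p in id @^-1` S `&` setT) (u p)%:E = 0)%E.
  move=> [A mA [B mB <-]]; rewrite setIT -(S2 A B mA mB).
  by rewrite (_ : id @^-1` (A `*` B) = snd @^-1` B `&` fst @^-1` A)//;
    apply/seteqP; split => p /= [].
exact: (zero_integral_dynkin ui (@measurable_id _ plane setT) measurableT
  (@measurable_prod_measurableType _ _ (measurableTypeR R) (measurableTypeR R)) GI T0 G0).
Qed.

End real_density.
Lemma square_integrable_indic : square_integrable lam setT (fun p => (\1_D p)%:C).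
Proof.
have i (A : set (measurableTypeR R)) : measurable A -> (leb A < +oo)%E ->
    cintegrable leb (fun t => (\1_A t)%:C).
  move=> mA Aoo; split; first by apply: cmeasurable_real; exact: measurable_indic.
  under eq_integral do rewrite normc_real ger0_norm//.
  by rewrite integral_indic// setIT.
apply: (@bounded_square_integrable _ _ _ lam _ 1); last first.
  by move=> p; rewrite normc_real ger0_norm// indicE; case: (_ \in _).
have it : (leb (`]0%R, T[%classic : set R) < +oo)%E.
  have -> : leb (`]0%R, T[%classic : set R) = _ := @lebesgue_measure_itv R `]0, T[%R.
  by case: ifPn => _; rewrite ?ltry// -EFinB ltry.
have := cintegrable_tensor (i _ (measurable_itv _) it) (i _ measurable_torus lebesgue_torus_lty).
congr cintegrable; apply/funext => p; rewrite -rmorphM; congr (_%:C).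
by rewrite !indicE in_setX; case: (_ \in _); case: (_ \in _); rewrite ?mulr1 ?mulr0.
Qed.

Lemma cintegrable_cut a : square_integrable lam setT a -> cintegrable lam (cut T a).
Proof. by move=> a2; exact: (square_integrable_mul a2 square_integrable_indic). Qed.

Lemma cintegral_ae_eq0 (f : plane -> R[i]) : cmeasurable setT f ->
  {ae lam, forall p, f p = 0} -> cintegral lam setT f = 0.
Proof.
move=> [mr mi] f0.
have H (v : plane -> R) : measurable_fun setT v -> {ae lam, forall p, v p = 0} ->
    Rintegral lam setT v = 0.
  move=> mv v0; rewrite /Rintegral (@ae_eq_integral _ _ _ lam setT (cst 0%E))//.
  - by rewrite integral0.
  - exact/measurable_EFinP.
  - by apply: filterS v0 => p -> _.
by rewrite /cintegral !H//; apply: filterS f0 => p ->.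
Qed.

Section complex_density.
Variable c : plane -> R[i].
Hypothesis ci : cintegrable lam c.
Hypothesis cD : forall p, ~ D p -> c p = 0.
Hypothesis c0 : forall n psi, test_function `]0, T[ psi ->
  cintegral lam setT (fun p => c p * wave n psi p) = 0.

Lemma trigpoly_pairing_eq0 psi theta : test_function `]0, T[ psi -> trigpoly theta ->
  cintegral lam setT (fun p => c p * ((psi p.1)%:C * theta p.2)) = 0.
Proof.
move=> tpsi; have [K K0 HK] := test_function_bounded tpsi.
have i (g : R -> R[i]) : trigpoly g ->
    cintegrable lam (fun p => c p * ((psi p.1)%:C * g p.2)).
  move=> tg; have [M HM] := trigpoly_bounded tg.
  under eq_fun do rewrite mulrC.
  apply: (cintegrableMl (K := K * M)) => //.
    apply: cmeasurableM; last exact: (cmeasurable_comp (trigpoly_measurable tg) measurable_snd).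
    apply: (cmeasurable_real (f := psi \o fst)).
    exact: (measurableT_comp (measurable_test_function tpsi) measurable_fst).
  move=> p; rewrite normcM normc_real.
  by apply: ler_pM; rewrite ?normc_ge0.
elim => [n|f g tf Hf tg Hg|z f tf Hf].
- rewrite -[RHS](c0 n tpsi); apply: eq_cintegral => p; rewrite /wave indicE.
  have [pD|/cD ->] := pselect (D p); last by rewrite !mul0r.
  by have [_ pT] := pD; rewrite mem_set// mulr1.
- under eq_cintegral do rewrite mulrDr mulrDr.
  by rewrite cintegralD ?Hf ?Hg ?addr0//; exact: i.
- under eq_cintegral do rewrite (mulrCA _ z) (mulrCA _ z).
  by rewrite cintegralZ ?Hf ?mulr0//; exact: i.
Qed.

Lemma density_ae_eq0 : {ae lam, forall p, c p = 0}.
Proof.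
have H psi b k : test_function `]0, T[ psi ->
    cintegral lam setT (fun p => c p * (psi p.1 * step_poly k (tilt b p.2))%:C) = 0.
  move=> tpsi; rewrite -[RHS](trigpoly_pairing_eq0 tpsi (trigpoly_step k b)).
  by apply: eq_cintegral => p; rewrite rmorphM.
have bounded psi b k : test_function `]0, T[ psi ->
    cintegrable lam (fun p => c p * (psi p.1 * step_poly k (tilt b p.2))%:C).
  move=> tpsi; have [K K0 HK] := test_function_bounded tpsi.
  under eq_fun do rewrite mulrC.
  apply: (cintegrableMl (K := K)) => //.
    apply: (cmeasurable_real (f := fun p : plane => psi p.1 * step_poly k (tilt b p.2))).
    apply: measurable_funM.
      exact: (measurableT_comp (measurable_test_function tpsi) measurable_fst).
    have [+ _] := trigpoly_measurable (trigpoly_step k b) => mS.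
    exact: (measurableT_comp mS measurable_snd).
  move=> p; have /andP[s0 s1] := step_poly_itv k (tilt_itv b p.2).
  by rewrite normc_real normrM (le_trans _ (HK p.1))// ler_piMr// ger0_norm.
have ReE (z : R[i]) (r : R) : complex.Re (z * r%:C) = complex.Re z * r.
  by rewrite ReMc /= mulr0 subr0.
have ImE (z : R[i]) (r : R) : complex.Im (z * r%:C) = complex.Im z * r.
  by rewrite ImMc /= mulr0 add0r.
have RE : ae_eq lam setT (EFin \o (fun p => complex.Re (c p))) (cst 0%E).
  apply: real_density_ae_eq0; first exact: cintegrable_Re.
    by move=> p /cD ->.
  move=> psi b k tpsi; have /(congr1 (@complex.Re R)) := H psi b k tpsi.
  rewrite /cintegral/= /Rintegral.
  have := cintegrable_Re (bounded psi b k tpsi).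
  rewrite /comp; under eq_fun do rewrite ReE.
  by move=> iR E0; rewrite -[LHS]fineK ?E0//; exact: integrable_fin_num.
have IE : ae_eq lam setT (EFin \o (fun p => complex.Im (c p))) (cst 0%E).
  apply: real_density_ae_eq0; first exact: cintegrable_Im.
    by move=> p /cD ->.
  move=> psi b k tpsi; have /(congr1 (@complex.Im R)) := H psi b k tpsi.
  rewrite /cintegral/= /Rintegral.
  have := cintegrable_Im (bounded psi b k tpsi).
  rewrite /comp; under eq_fun do rewrite ImE.
  by move=> iI E0; rewrite -[LHS]fineK ?E0//; exact: integrable_fin_num.
apply: filterS2 RE IE => p /(_ I) /= [r0] /(_ I) /= [i0].
by rewrite -[c p]complex_eta r0 i0.
Qed.

End complex_density.

(** A square integrable function on the cylinder is determined by its pairings,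
    so it may be exchanged in any product. *)
Lemma product_pairing_eq (a a' b : plane -> R[i]) n psi :
  square_integrable lam setT a -> square_integrable lam setT a' ->
  square_integrable lam setT b -> test_function `]0, T[ psi ->
  (forall m phi, test_function `]0, T[ phi ->
     cintegral lam setT (fun p => a p * wave m phi p) =
     cintegral lam setT (fun p => a' p * wave m phi p)) ->
  cintegral lam setT (fun p => a p * b p * wave n psi p) =
  cintegral lam setT (fun p => a' p * b p * wave n psi p).
Proof.
move=> a2 a'2 b2 tpsi aa'.
have d2 := square_integrableB a2 a'2.
pose c := cut T (fun p => a p - a' p).
have c0 : {ae lam, forall p, c p = 0}.
  apply: density_ae_eq0; first exact: cintegrable_cut.
    by move=> p pD; rewrite /c /cut indicE memNset// mulr0.
  move=> m phi tphi; rewrite /c; under eq_cintegral do rewrite (wave_cut _ _ _ tphi) mulrBl.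
  rewrite cintegralB; first by apply/eqP; rewrite subr_eq0; apply/eqP; exact: aa'.
  - exact: (square_integrable_mul a2 (wave_square_integrable m tphi)).
  - exact: (square_integrable_mul a'2 (wave_square_integrable m tphi)).
have [K K0 wK] := wave_bounded n tpsi.
have mw := (cintegrable_wave n tpsi).1.
have i (u : plane -> R[i]) : square_integrable lam setT u ->
    cintegrable lam (fun p => u p * b p * wave n psi p).
  move=> u2; under eq_fun do rewrite mulrC.
  by apply: (cintegrableMl mw wK); exact: square_integrable_mul.
apply/eqP; rewrite -subr_eq0 -cintegralB; [|exact: i|exact: i]; apply/eqP.
rewrite -[RHS](@cintegral_ae_eq0 (fun p => c p * b p * wave n psi p)).
- apply: eq_cintegral => p.
  have := wave_cut n (fun p => a p - a' p) p tpsi; rewrite -/c => E.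
  by rewrite -!mulrBl (mulrAC (c p)) E mulrAC.
- exact: (cmeasurableM (cmeasurableM (cmeasurable_cut T d2.1) b2.1) mw).
- by apply: filterS c0 => p ->; rewrite !mul0r.
Qed.

End vanishing_integrals.

(** * The multiplier estimate *)

Section log_estimates.
Context {R : realType}.
Variable eps : R.
Hypotheses (eps_gt0 : 0 < eps) (eps_lt : eps < 1 / 16).

(** The exponent for which the balance of powers in [log_core] is exact; it
    exceeds 1, so that sums and integrals converge, precisely when
    [eps < 1 / 16]. *)
Definition summability_exponent : R := (4 - 16 * eps) / 3.
Local Notation q := summability_exponent.
Local Notation p := (1 - 2 * eps).
Local Notation L := (ln 2 : R).

Lemma summability_exponent_gt1 : 1 < q.
Proof. by rewrite /summability_exponent; have := eps_lt; lra. Qed.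

Lemma summability_exponent_lt2 : q < 2.
Proof. by rewrite /summability_exponent; have := eps_gt0; lra. Qed.

Let L_gt0 : 0 < L.
Proof. by rewrite ln_gt0// ltr1n. Qed.

Let log_core_ordered (aa ab ba bb : R) : 0 <= ab <= aa -> 0 <= ba -> 0 <= bb ->
  2 * aa <= ba + L ->
  expR (8 * eps * aa - p * (ba + bb)) <=
  2 * (expR (- q * aa) * (expR (- q * ba) + expR (- q * bb))).
Proof.
move=> /andP[ab0 ab_aa] ba0 bb0 ja; have e0 := eps_gt0; have e1 := eps_lt.
have r0 : 0 <= 2 * p - q by rewrite /summability_exponent; lra.
have r1 : 2 * p - q <= 1 by rewrite /summability_exponent; lra.
have qp : 0 <= q - p by rewrite /summability_exponent; lra.
have p0 : 0 <= p by lra.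
have E t : expR (L + t) = 2 * expR t by rewrite expRD lnK// posrE.
have q3 : 3 * q = 4 - 16 * eps by rewrite /summability_exponent; field.
have H1 : 0 <= (2 * p - q) * (ba + L - 2 * aa) by rewrite mulr_ge0// subr_ge0.
have H2 : 0 <= (1 - (2 * p - q)) * L by apply: mulr_ge0; [lra|exact: ltW].
have [bab|/ltW bba] := leP ba bb.
  apply: (@le_trans _ _ (expR (L + (- q * aa + - q * ba)))); last first.
    by rewrite E expRD ler_pM2l// ler_pM2l ?expR_gt0// lerDl expR_ge0.
  rewrite ler_expR.
  have H3 : 0 <= p * (bb - ba) by rewrite mulr_ge0// subr_ge0.
  move: H1 H2 H3 q3; nra.
apply: (@le_trans _ _ (expR (L + (- q * aa + - q * bb)))); last first.
  by rewrite E expRD ler_pM2l// ler_pM2l ?expR_gt0// lerDr expR_ge0.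
rewrite ler_expR.
have H3 : 0 <= (q - p) * (ba - bb) by rewrite mulr_ge0// subr_ge0.
move: H1 H2 H3 q3; nra.
Qed.

(** The two modulations carry the power [p] each, together more than the exponent
    [q] that the smaller one is to receive; the surplus [2 p - q] is traded, through
    the dissipative bound of the frequency by the modulation, for the decay [q] in
    the larger frequency and for the loss [8 eps]. *)
Lemma log_core (aa ab ba bb : R) : 0 <= aa -> 0 <= ab -> 0 <= ba -> 0 <= bb ->
  2 * aa <= ba + L -> 2 * ab <= bb + L ->
  expR (8 * eps * Num.max aa ab - p * (ba + bb)) <=
  2 * ((expR (- q * aa) + expR (- q * ab)) * (expR (- q * ba) + expR (- q * bb))).
Proof.
move=> a0 b0 ba0 bb0 ja jb.
have S0 : 0 <= expR (- q * ba) + expR (- q * bb) by rewrite addr_ge0 ?expR_ge0.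
have [aab|/ltW aba] := leP aa ab.
  have := @log_core_ordered ab aa bb ba; rewrite a0 aab => /(_ isT bb0 ba0 jb).
  rewrite (addrC bb ba) (addrC (expR (- q * bb))) => H.
  apply: (le_trans H); rewrite ler_pM2l// ler_wpM2r//.
  by rewrite lerDr expR_ge0.
have := @log_core_ordered aa ab ba bb; rewrite b0 aba => /(_ isT ba0 bb0 ja) H.
apply: (le_trans H); rewrite ler_pM2l// ler_wpM2r//.
by rewrite lerDl expR_ge0.
Qed.

Variables s gamma : R.
Hypotheses (s_ge : - (1 / 2) - eps <= s) (gamma_le : gamma <= eps).

(** The logarithmic form of the multiplier estimate, when the largest of the
    three modulations is the one that belongs to the third frequency [c]: the
    resonance identity trades it for the product of all spatial frequencies. *)
Lemma log_multiplier (a a1 a2 b b1 b2 aa ab ac ba bb bc : R) :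
  0 <= a -> 0 <= a1 -> 0 <= a2 -> 0 <= b ->
  0 <= aa -> 0 <= ab -> 0 <= ba -> 0 <= bb ->
  a <= a1 + a2 + L -> 2 * aa <= ba + L -> 2 * ab <= bb + L ->
  a + a1 + a2 = aa + ab + ac -> b + b1 + b2 = ba + bb + bc ->
  a1 + a2 <= 2 * Num.max aa ab + L -> a + a1 + a2 <= bc + ln 3 ->
  expR (2 * a + 2 * s * a + 2 * (- (1 / 2) + gamma) * b) <=
  expR (2 * (s + 1 / 2 + eps) * L + ln 3 + 2 * L) *
  (expR (2 * s * (a1 + a2) + 2 * (1 / 2 - eps) * (b1 + b2)) *
   ((expR (- q * aa) + expR (- q * ab)) * (expR (- q * ba) + expR (- q * bb)))).
Proof.
move=> a0 a10 a20 b0 aa0 ab0 ba0 bb0 tri ja jb aE bE am res.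
have e0 := eps_gt0; have e1 := eps_lt; have s1 := s_ge.
have g1 := gamma_le; have L0 := L_gt0.
have core := log_core aa0 ab0 ba0 bb0 ja jb.
set K := (expR (- q * aa) + _) * _ in core *.
have {}core : expR (8 * eps * Num.max aa ab - p * (ba + bb) - L) <= K.
  by rewrite expRB lnK ?posrE// ler_pdivrMr// (mulrC K).
rewrite mulrA; apply: le_trans (ler_wpM2l _ core); last by rewrite -expRD expR_ge0.
rewrite -!expRD ler_expR.
set t := s + 1 / 2 + eps; have t0 : 0 <= t by rewrite /t; lra.
have -> : s = t - 1 / 2 - eps by rewrite /t; lra.
have H1 : 0 <= t * (a1 + a2 + L - a) by rewrite mulr_ge0//; lra.
have H2 : 0 <= (eps - gamma) * b by rewrite mulr_ge0//; lra.
have H3 : 0 <= p * (bc + ln 3 - (a + a1 + a2)) by rewrite mulr_ge0//; lra.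
have H4 : 0 <= eps * (2 * Num.max aa ab + L - (a1 + a2)) by rewrite mulr_ge0//; lra.
have H5 : 0 <= (1 / 16 - eps) * L by rewrite mulr_ge0//; lra.
have l3 : 0 <= ln 3 :> R by rewrite ln_ge0// ler1n.
have H6 : 0 <= eps * ln 3 by rewrite mulr_ge0//; lra.
have H7 : p * bc = p * (b + b1 + b2) - p * (ba + bb) by rewrite bE; ring.
move: (Num.max aa ab) H1 H2 H3 H4 H5 H6 H7 => m => H1 H2 H3 H4 H5 H6 H7.
lra.
Qed.

End log_estimates.

Section logarithms.
Context {R : realType}.
Implicit Types u v w x y z t : R.

Let ge1_gt0 u : 1 <= u -> 0 < u. Proof. exact: lt_le_trans. Qed.

Lemma powR_expR x t : 1 <= x -> x `^ t = expR (t * ln x).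
Proof. by move=> x1; rewrite /powR gt_eqF// ge1_gt0. Qed.

Lemma ln_le u v : 1 <= u -> u <= v -> ln u <= ln v.
Proof. by move=> u1 uv; rewrite ler_ln ?posrE ?ge1_gt0// (le_trans u1). Qed.

Lemma ln_mul2 u : 1 <= u -> ln (2 * u) = ln u + ln 2.
Proof. by move=> u1; rewrite lnM; [exact: addrC|by rewrite posrE|by rewrite posrE ge1_gt0]. Qed.

Lemma ln_sqr_le u v : 1 <= u -> 1 <= v -> u ^+ 2 <= 2 * v -> 2 * ln u <= ln v + ln 2.
Proof.
move=> u1 v1 uv; rewrite -ln_mul2// mulrDl mul1r -lnM ?posrE ?ge1_gt0//.
by rewrite -expr2; apply: ln_le => //; rewrite exprn_ege1.
Qed.

Lemma ln_le_max u v w : 1 <= u -> 1 <= v -> 1 <= w -> u <= v + w ->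
  ln u <= Num.max (ln v) (ln w) + ln 2.
Proof.
move=> u1 v1 w1 uvw; rewrite maxEle; case: ifP => [|/negbT].
  rewrite ler_ln ?posrE ?ge1_gt0// => vw; rewrite -ln_mul2//; apply: ln_le => //.
  by apply: (le_trans uvw); lra.
rewrite -ltNge => /ltW; rewrite ler_ln ?posrE ?ge1_gt0// => wv.
by rewrite -ln_mul2//; apply: ln_le => //; lra.
Qed.

Lemma ln_le_add u v w : 1 <= u -> 1 <= v -> 1 <= w -> u <= v + w ->
  ln u <= ln v + ln w + ln 2.
Proof.
move=> u1 v1 w1 uvw; rewrite -lnM ?posrE ?ge1_gt0//.
have vw1 : 1 <= v * w by rewrite -[1]mulr1 ler_pM.
by rewrite -ln_mul2//; apply: ln_le => //; nra.
Qed.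

Lemma ln_product_le x y z w : 1 <= x -> 1 <= y -> 1 <= z -> 1 <= w ->
  x * y * z <= 3 * w -> ln x + ln y + ln z <= ln w + ln 3.
Proof.
move=> x1 y1 z1 w1 H.
have xy1 : 1 <= x * y by rewrite -[1]mulr1 ler_pM.
have xyz1 : 1 <= x * y * z by rewrite -[1]mulr1 ler_pM.
have p0 : (3 : R) \is Num.pos by rewrite posrE.
rewrite -(lnM (ge1_gt0 x1) (ge1_gt0 y1)) -(lnM (ge1_gt0 xy1) (ge1_gt0 z1)).
by rewrite -(lnM (ge1_gt0 w1) p0); apply: ln_le => //; rewrite (mulrC w).
Qed.

Lemma add3_le u v w x : u <= x -> v <= x -> w <= x -> u + v + w <= 3 * x.
Proof. by move=> *; lra. Qed.

Lemma add2_le u v w x : u <= w + x -> v <= w -> u + v <= 2 * w + x.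
Proof. by move=> *; lra. Qed.

End logarithms.

Section weights.
Context {R : realType}.
Notation freq := (int * measurableTypeR R)%type.
Implicit Types y z : freq.

Definition spatial y : R := japanese (y.1%:~R : R[i]).

(** The distance in [tau] to the dispersion curve of the Airy equation. *)
Definition detuning y : R := y.2 - y.1%:~R ^+ 3.

Definition modulation y : R := japanese (y.1%:~R ^+ 2 +i* detuning y).

Definition bourgain_weight (s b : R) y : R :=
  spatial y `^ (2 * s) * modulation y `^ (2 * b).

Lemma japanese_ge1 (z : R[i]) : 1 <= japanese z.
Proof. by rewrite -[leLHS]sqrtr1 ler_wsqrtr// lerDl sqr_ge0. Qed.

Lemma spatialE y : spatial y ^+ 2 = 1 + y.1%:~R ^+ 2.
Proof.
rewrite /spatial /japanese sqr_sqrtr ?addr_ge0 ?sqr_ge0//.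
by rewrite -(rmorph_int (@real_complex R)) normc_real real_normK ?num_real.
Qed.

Lemma modulationE y : modulation y ^+ 2 = 1 + (y.1%:~R ^+ 2) ^+ 2 + detuning y ^+ 2.
Proof.
rewrite /modulation /japanese sqr_sqrtr ?addr_ge0 ?sqr_ge0//.
by rewrite sqr_normcE/= addrA.
Qed.

Lemma spatial_ge1 y : 1 <= spatial y. Proof. exact: japanese_ge1. Qed.
Lemma modulation_ge1 y : 1 <= modulation y. Proof. exact: japanese_ge1. Qed.

Lemma spatial_gt0 y : 0 < spatial y.
Proof. exact: lt_le_trans (spatial_ge1 y). Qed.

Lemma modulation_gt0 y : 0 < modulation y.
Proof. exact: lt_le_trans (modulation_ge1 y). Qed.

Lemma ler_of_sqr (x t : R) : 0 <= t -> x ^+ 2 <= t ^+ 2 -> x <= t.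
Proof.
move=> t0 xt; have [//|tx] := leP x t.
have x0 : 0 <= x := le_trans t0 (ltW tx).
by move: xt; rewrite leNgt ltr_pXn2r ?nnegrE// tx.
Qed.

Lemma ler_norm_spatial y : `|y.1%:~R| <= spatial y.
Proof.
apply: ler_of_sqr; first exact: ltW (spatial_gt0 y).
by rewrite spatialE real_normK ?num_real// lerDr.
Qed.

Lemma ler_norm_detuning y : `|detuning y| <= modulation y.
Proof.
apply: ler_of_sqr; first exact: ltW (modulation_gt0 y).
by rewrite modulationE real_normK ?num_real// lerDr addr_ge0// sqr_ge0.
Qed.

(** The dissipative term [n^2] bounds the modulation from below whatever the
    detuning. *)
Lemma sqr_spatial_le y : spatial y ^+ 2 <= 2 * modulation y.
Proof.
apply: ler_of_sqr; first by rewrite mulr_ge0// ltW// modulation_gt0.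
rewrite spatialE [leRHS]exprMn modulationE; have := sqr_ge0 (1 - y.1%:~R ^+ 2 : R).
by have := sqr_ge0 (detuning y); nra.
Qed.

Lemma spatialN y : spatial (- y) = spatial y.
Proof.
apply/eqP; rewrite -(@eqrXn2 _ 2)// ?(ltW (spatial_gt0 _))// !spatialE.
by rewrite /= mulrNz sqrrN.
Qed.

Lemma spatialD_le y z : spatial (y + z) <= spatial y + spatial z.
Proof.
have u0 := spatial_gt0 y; have v0 := spatial_gt0 z.
apply: ler_of_sqr; first by rewrite addr_ge0 ?ltW.
have uE := spatialE y; have vE := spatialE z.
have hu := ler_norm_spatial y; have hv := ler_norm_spatial z.
have H : `|y.1%:~R * z.1%:~R| <= spatial y * spatial z by rewrite normrM ler_pM.
have := ler_norm (y.1%:~R * z.1%:~R : R).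
rewrite sqrrD uE vE spatialE /= intrD.
by move=> H2; have := le_trans H2 H; lra.
Qed.

Lemma spatial_triangle y z : spatial y <= spatial (y + z) + spatial z.
Proof.
by have := spatialD_le (y + z) (- z); rewrite addrK spatialN.
Qed.

Lemma sqr_int_ge1 (n : int) : n != 0 -> 1 <= n%:~R ^+ 2 :> R.
Proof.
by move=> n0; rewrite -rmorphXn/= -[1]/(1%:~R) ler_int -gtz0_ge1 exprn_even_gt0.
Qed.

(** The resonance identity: the three detunings cannot all be small, because
    they add up to three times the product of the spatial frequencies. *)
Lemma spatial_product_le y z : y.1 != 0 -> z.1 != 0 -> (y + z).1 != 0 ->
  spatial (y + z) * spatial y * spatial z <=
  modulation (y + z) + modulation y + modulation z.
Proof.
move=> y0 z0 x0.
have dy := ler_norm_detuning y; have dz := ler_norm_detuning z.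
have dx := ler_norm_detuning (y + z).
set S := leRHS.
have res : detuning y + detuning z - detuning (y + z) =
    3 * ((y + z).1%:~R * y.1%:~R * z.1%:~R).
  by rewrite /detuning/= intrD; ring.
have H : `|3 * ((y + z).1%:~R * y.1%:~R * z.1%:~R)| <= S.
  rewrite -res; apply: (le_trans (ler_normB _ _)).
  by have := ler_normD (detuning y) (detuning z); rewrite /S; lra.
apply: ler_of_sqr; first exact: le_trans H.
apply: (@le_trans _ _ (`|3 * ((y + z).1%:~R * y.1%:~R * z.1%:~R)| ^+ 2)); last first.
  by rewrite ler_sqr ?nnegrE// (le_trans _ H).
rewrite real_normK ?num_real// !exprMn !spatialE.
have := sqr_int_ge1 y0; have := sqr_int_ge1 z0; have := sqr_int_ge1 x0.
move: (_ ^+ 2) (_ ^+ 2) (_ ^+ 2) => c b a h1 h2 h3.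
have ab : (1 + a) * (1 + c) <= 2 * a * (2 * c) by apply: ler_pM; lra.
have abc : (1 + a) * (1 + c) * (1 + b) <= 2 * a * (2 * c) * (2 * b).
  by apply: ler_pM => //; [apply: mulr_ge0; lra|lra..].
have abc0 : 0 <= a * c * b by rewrite !mulr_ge0//; lra.
apply: (le_trans abc); lra.
Qed.

Section multiplier.
Variables eps s gamma : R.
Hypotheses (eps_gt0 : 0 < eps) (eps_lt : eps < 1 / 16).
Hypotheses (s_ge : - (1 / 2) - eps <= s) (gamma_le : gamma <= eps).
Local Notation q := (summability_exponent eps).

(** Summable in the spatial frequency and integrable in the detuning, which may
    be taken from different arguments. *)
Definition kern y z : R :=
  (decay q y.1%:~R + decay q z.1%:~R) * (decay q (detuning y) + decay q (detuning z)).

Lemma kern_ge0 y z : 0 <= kern y z.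
Proof. by rewrite mulr_ge0// addr_ge0// decay_ge0. Qed.

Lemma powR_decay (x t : R) : 1 <= x -> `|t| <= x -> expR (- q * ln x) <= 4 * decay q t.
Proof.
move=> x1 tx; have x0 : 0 < x by exact: lt_le_trans x1.
have q1 := summability_exponent_gt1 eps_lt.
have q2 := summability_exponent_lt2 eps_gt0.
have -> : decay q t = expR (- q * ln (1 + `|t|)) by rewrite /decay powR_expR// lerDl.
have -> : 4 = expR (2 * ln 2) :> R.
  by rewrite mulrDl mul1r expRD lnK ?posrE//; ring.
rewrite -expRD ler_expR.
have H : ln (1 + `|t|) <= ln x + ln 2.
  by rewrite -ln_mul2//; apply: ln_le; [rewrite lerDl|lra].
have l0 : 0 <= ln 2 :> R by rewrite ln_ge0// ler1n.
have H1 : 0 <= q * (ln x + ln 2 - ln (1 + `|t|)) by rewrite mulr_ge0//; lra.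
have H2 : 0 <= (2 - q) * ln 2 by rewrite mulr_ge0//; lra.
lra.
Qed.

Lemma kern_ge_expR y z :
  (expR (- q * ln (spatial y)) + expR (- q * ln (spatial z))) *
  (expR (- q * ln (modulation y)) + expR (- q * ln (modulation z))) <= 16 * kern y z.
Proof.
rewrite (_ : 16 * kern y z = (4 * (decay q y.1%:~R + decay q z.1%:~R)) *
   (4 * (decay q (detuning y) + decay q (detuning z)))); last by rewrite /kern; ring.
by apply: ler_pM; rewrite ?addr_ge0 ?expR_ge0// mulrDr; apply: lerD; apply: powR_decay;
  rewrite ?spatial_ge1 ?modulation_ge1 ?ler_norm_spatial ?ler_norm_detuning.
Qed.

Let multC : R := expR (2 * (s + 1 / 2 + eps) * ln 2 + ln 3 + 2 * ln 2) * 16.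

(** The largest of the three modulations is the one of the output or of an
    input, and the kernel involves the two frequencies that remain. *)
Lemma multiplier_bound y z : y.1 != 0 -> z.1 != 0 -> (y + z).1 != 0 ->
  (y + z).1%:~R ^+ 2 * bourgain_weight s (- (1 / 2) + gamma) (y + z) <=
  multC * (bourgain_weight s (1 / 2 - eps) y * bourgain_weight s (1 / 2 - eps) z *
    (kern y z + kern (y + z) z + kern (y + z) y)).
Proof.
move=> y0 z0 x0; have prod := spatial_product_le y0 z0 x0.
have tx := spatialD_le y z; have ty := spatial_triangle y z.
have tz := spatial_triangle z y; rewrite (addrC z y) in tz.
have jy := sqr_spatial_le y; have jz := sqr_spatial_le z; have jx := sqr_spatial_le (y + z).
have nx := ler_norm_spatial (y + z).
have Jx1 := spatial_ge1 (y + z); have Jy1 := spatial_ge1 y; have Jz1 := spatial_ge1 z.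
have wx1 := modulation_ge1 (y + z); have wy1 := modulation_ge1 y; have wz1 := modulation_ge1 z.
have a0 := ln_ge0 Jx1; have a10 := ln_ge0 Jy1; have a20 := ln_ge0 Jz1.
have b0 := ln_ge0 wx1; have b10 := ln_ge0 wy1; have b20 := ln_ge0 wz1.
have LHS : (y + z).1%:~R ^+ 2 * bourgain_weight s (- (1 / 2) + gamma) (y + z) <=
    expR (2 * ln (spatial (y + z)) + 2 * s * ln (spatial (y + z)) +
      2 * (- (1 / 2) + gamma) * ln (modulation (y + z))).
  rewrite /bourgain_weight !powR_expR// -expRD -addrA [leRHS]expRD ler_wpM2r ?expR_ge0//.
  rewrite [2 * _]mulrDl mul1r expRD lnK ?posrE ?spatial_gt0//.
  by rewrite -expr2 -[leLHS]real_normK ?num_real// ler_sqr ?nnegrE// ltW// spatial_gt0.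
have RHS : bourgain_weight s (1 / 2 - eps) y * bourgain_weight s (1 / 2 - eps) z =
   expR (2 * s * (ln (spatial y) + ln (spatial z)) +
     2 * (1 / 2 - eps) * (ln (modulation y) + ln (modulation z))).
  by rewrite /bourgain_weight !powR_expR// -!expRD; congr expR; ring.
apply: (le_trans LHS); rewrite RHS /multC.
have k1 := kern_ge0 y z; have k2 := kern_ge0 (y + z) z; have k3 := kern_ge0 (y + z) y.
have rot3 (u v w : R) : u + v + w = v + w + u by rewrite -addrA addrC.
have final (E1 E2 X S K K' : R) : 0 <= E1 -> 0 <= E2 -> K <= S -> K' <= 16 * K ->
    X <= E1 * (E2 * K') -> X <= E1 * 16 * (E2 * S).
  move=> E10 E20 KS KK XE; apply: (le_trans XE).
  have -> : E1 * 16 * (E2 * S) = E1 * (E2 * (16 * S)) by ring.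
  apply: ler_wpM2l => //; apply: ler_wpM2l => //; apply: (le_trans KK).
  by rewrite ler_wpM2l.
have Ka : kern y z <= kern y z + kern (y + z) z + kern (y + z) y.
  by rewrite -addrA lerDl addr_ge0.
have Kb : kern (y + z) z <= kern y z + kern (y + z) z + kern (y + z) y.
  by rewrite addrAC lerDr addr_ge0.
have Kc : kern (y + z) y <= kern y z + kern (y + z) z + kern (y + z) y.
  by rewrite lerDr addr_ge0.
have m1 (u v : R) : u <= Num.max u v by rewrite le_max lexx.
have m2 (u v : R) : v <= Num.max u v by rewrite le_max lexx orbT.
have tri12 := ln_le_add Jx1 Jy1 Jz1 tx.
have sx := ln_sqr_le Jx1 wx1 jx; have sy := ln_sqr_le Jy1 wy1 jy; have sz := ln_sqr_le Jz1 wz1 jz.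
have L0 : 0 <= ln 2 :> R by rewrite ln_ge0// ler1n.
have LM := log_multiplier eps_gt0 eps_lt s_ge gamma_le a0 a10 a20 b0.
have [yx|xy] := leP (modulation y) (modulation (y + z)).
  have [zx|xz] := leP (modulation z) (modulation (y + z)).
    (* the modulation of the output dominates *)
    apply: (final _ _ _ _ _ _ (expR_ge0 _) (expR_ge0 _) Ka (kern_ge_expR y z)).
    have am : ln (spatial y) + ln (spatial z) <=
        2 * Num.max (ln (spatial y)) (ln (spatial z)) + ln 2.
      by apply: add2_le (m2 _ _); apply: (le_trans (m1 _ (ln (spatial z)))); rewrite lerDl.
    have res := ln_product_le Jx1 Jy1 Jz1 wx1 (le_trans prod (add3_le (lexx _) yx zx)).
    exact: (LM _ _ _ _ _ _ _ _ a10 a20 b10 b20 tri12 sy sz (rot3 _ _ _) (rot3 _ _ _) am res).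
  (* the modulation of z dominates *)
  apply: (final _ _ _ _ _ _ (expR_ge0 _) (expR_ge0 _) Kc (kern_ge_expR (y + z) y)).
  have am : ln (spatial y) + ln (spatial z) <=
      2 * Num.max (ln (spatial (y + z))) (ln (spatial y)) + ln 2.
    by rewrite addrC; exact: add2_le (ln_le_max Jz1 Jx1 Jy1 tz) (m2 _ _).
  have res := ln_product_le Jx1 Jy1 Jz1 wz1
    (le_trans prod (add3_le (ltW xz) (le_trans yx (ltW xz)) (lexx _))).
  exact: (LM _ _ _ _ _ _ _ _ a0 a10 b0 b10 tri12 sx sy erefl erefl am res).
have [zy|yz] := leP (modulation z) (modulation y).
  (* the modulation of y dominates *)
  apply: (final _ _ _ _ _ _ (expR_ge0 _) (expR_ge0 _) Kb (kern_ge_expR (y + z) z)).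
  have am : ln (spatial y) + ln (spatial z) <=
      2 * Num.max (ln (spatial (y + z))) (ln (spatial z)) + ln 2.
    exact: add2_le (ln_le_max Jy1 Jx1 Jz1 ty) (m2 _ _).
  have res := ln_product_le Jx1 Jy1 Jz1 wy1
    (le_trans prod (add3_le (ltW xy) (lexx _) zy)).
  exact: (LM _ _ _ _ _ _ _ _ a0 a20 b0 b20 tri12 sx sz (addrAC _ _ _) (addrAC _ _ _) am res).
apply: (final _ _ _ _ _ _ (expR_ge0 _) (expR_ge0 _) Kc (kern_ge_expR (y + z) y)).
have am : ln (spatial y) + ln (spatial z) <=
    2 * Num.max (ln (spatial (y + z))) (ln (spatial y)) + ln 2.
  by rewrite addrC; exact: add2_le (ln_le_max Jz1 Jx1 Jy1 tz) (m2 _ _).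
have res := ln_product_le Jx1 Jy1 Jz1 wz1
  (le_trans prod (add3_le (ltW (lt_trans xy yz)) (ltW yz) (lexx _))).
exact: (LM _ _ _ _ _ _ _ _ a0 a10 b0 b10 tri12 sx sy erefl erefl am res).
Qed.

End multiplier.
End weights.

(** * The bilinear estimate in frequency space *)

Section schur.
Context {R : realType}.
Notation leb := (@lebesgue_measure R).
Notation freq := (int * measurableTypeR R)%type.
Notation nu := (prod_measure (@countZ R) leb).
Variables (k : freq -> freq -> R) (F G : freq -> R) (S : R).
Hypothesis k0 : forall x y, 0 <= k x y.
Hypothesis mk : measurable_fun setT (fun z : freq * freq => k z.1 z.2).
Hypotheses (F0 : forall y, 0 <= F y) (G0 : forall y, 0 <= G y).
Hypotheses (mF : measurable_fun setT F) (mG : measurable_fun setT G).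
Hypothesis S0 : 0 <= S.

Definition trilinear (x : freq) : \bar R :=
  (\int[nu]_y (Num.sqrt (k x y) * (F y * G (x - y)))%:E)%E.

Let F2 (y : freq) : R := F y ^+ 2.
Let G2 (y : freq) : R := G y ^+ 2.
Let mF2 : measurable_fun setT F2. Proof. exact: measurable_funX. Qed.
Let mG2 : measurable_fun setT G2. Proof. exact: measurable_funX. Qed.
Let F20 y : 0 <= F2 y. Proof. exact: sqr_ge0. Qed.
Let G20 y : 0 <= G2 y. Proof. exact: sqr_ge0. Qed.

Let fst_sub_snd (h : freq -> R) : measurable_fun setT h ->
  measurable_fun setT (fun z : freq * freq => h (z.1 - z.2)).
Proof.
move=> mh; apply: (measurableT_comp mh).
by apply: measurable_freq_sub; [exact: measurable_fst|exact: measurable_snd].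
Qed.

Let on_snd (h : freq -> R) : measurable_fun setT h ->
  measurable_fun setT (fun z : freq * freq => h z.2).
Proof. by move=> mh; exact: (measurableT_comp mh measurable_snd). Qed.

Let msqrt : measurable_fun setT (fun z : freq * freq => Num.sqrt (k z.1 z.2)).
Proof.
apply: (@measurableT_comp _ _ _ _ _ _ (@Num.sqrt R)) => //.
by apply: continuous_measurable_fun; exact: sqrt_continuous.
Qed.

Let section1 (h : freq * freq -> R) (x : freq) : measurable_fun setT h ->
  measurable_fun setT (fun y => h (x, y)).
Proof. by move=> mh; exact: (measurableT_comp mh (pair1_measurable x)). Qed.

Let iterated (h : freq * freq -> R) : measurable_fun setT h -> (forall z, 0 <= h z) ->
  measurable_fun setT (fun x : freq => \int[nu]_y (h (x, y))%:E)%E.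
Proof.
move=> mh h0.
apply: (@measurable_fun_fubini_tonelli_F _ _ freq freq R nu (fun z => (h z)%:E)).
  exact/measurable_EFinP.
by move=> z; rewrite lee_fin.
Qed.

Let iterated2 (h : freq * freq -> R) : measurable_fun setT h -> (forall z, 0 <= h z) ->
  measurable_fun setT (fun y : freq => \int[nu]_x (h (x, y))%:E)%E.
Proof.
move=> mh h0.
apply: (@measurable_fun_fubini_tonelli_G _ _ freq freq R nu (fun z => (h z)%:E)).
  exact/measurable_EFinP.
by move=> z; rewrite lee_fin.
Qed.

Let swap (h : freq * freq -> R) : measurable_fun setT h -> (forall z, 0 <= h z) ->
  (\int[nu]_x \int[nu]_y (h (x, y))%:E = \int[nu]_y \int[nu]_x (h (x, y))%:E)%E.
Proof.
move=> mh h0; apply: (@fubini_tonelli _ _ freq freq R nu nu (fun z => (h z)%:E)).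
  exact/measurable_EFinP.
by move=> z; rewrite lee_fin.
Qed.

Let cauchy_schwarz (f g : freq -> R) :
  measurable_fun setT f -> measurable_fun setT g ->
  (forall y, 0 <= f y) -> (forall y, 0 <= g y) ->
  ((\int[nu]_y (f y * g y)%:E) * (\int[nu]_y (f y * g y)%:E) <=
   \int[nu]_y (f y ^+ 2)%:E * \int[nu]_y (g y ^+ 2)%:E)%E.
Proof.
move=> mf mg f0 g0; rewrite -poweR2; last first.
  by apply: integral_ge0 => y _; rewrite lee_fin mulr_ge0.
exact: (integral_sqr_mul_le nu mf mg f0 g0).
Qed.

Lemma trilinear_ge0 x : (0 <= trilinear x)%E.
Proof. by apply: integral_ge0 => y _; rewrite lee_fin !mulr_ge0// sqrtr_ge0. Qed.

Let mT3 : measurable_fun setT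
  (fun z : freq * freq => Num.sqrt (k z.1 z.2) * (F z.2 * G (z.1 - z.2))).
Proof.
apply: measurable_funM; first exact: msqrt.
by apply: measurable_funM; [exact: on_snd|exact: fst_sub_snd].
Qed.

Lemma measurable_trilinear : measurable_fun setT trilinear.
Proof. by apply: (iterated mT3) => z; rewrite !mulr_ge0// sqrtr_ge0. Qed.

Let sqrk x y : Num.sqrt (k x y) ^+ 2 = k x y. Proof. by rewrite sqr_sqrtr. Qed.

Let msqrt1 x : measurable_fun setT (fun y : freq => Num.sqrt (k x y)).
Proof. exact: (section1 x msqrt). Qed.

Let mG1 x : measurable_fun setT (fun y : freq => G (x - y)).
Proof. exact: (section1 x (fst_sub_snd mG)). Qed.

Let integrate (Phi : freq -> \bar R) (c d : \bar R) :
  measurable_fun setT Phi -> (forall x, 0 <= Phi x)%E -> (0 <= c)%E ->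
  (forall x, trilinear x * trilinear x <= Phi x * c)%E ->
  (\int[nu]_x Phi x <= d)%E -> (\int[nu]_x (trilinear x * trilinear x) <= d * c)%E.
Proof.
move=> mPhi Phi0 c0 H Hd.
apply: (@le_trans _ _ (\int[nu]_x (Phi x * c))%E).
  apply: ge0_le_integral.
  - exact: measurableT.
  - by move=> x _; rewrite mule_ge0// trilinear_ge0.
  - by apply: emeasurable_funM; exact: measurable_trilinear.
  - by apply: emeasurable_funM => //; exact: measurable_cst.
  - by move=> x _; exact: H.
rewrite ge0_integralZr//; exact: lee_wpmul2r.
Qed.

(** Three ways to distribute the kernel in the Cauchy-Schwarz inequality. *)
Lemma trilinear_bound_output : (forall x, \int[nu]_y (k x y)%:E <= S%:E)%E ->
  (\int[nu]_x (trilinear x * trilinear x) <=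
   S%:E * (\int[nu]_y (F2 y)%:E * \int[nu]_y (G2 y)%:E))%E.
Proof.
move=> kS.
have mFG : measurable_fun setT (fun z : freq * freq => F2 z.2 * G2 (z.1 - z.2)).
  by apply: measurable_funM; [exact: on_snd|exact: fst_sub_snd].
have FG0 (z : freq * freq) : 0 <= F2 z.2 * G2 (z.1 - z.2) by rewrite mulr_ge0.
rewrite -(ge0_integral_conv_l mF2 mG2 F20 G20) -(swap mFG FG0) muleC.
apply: (@integrate (fun x => \int[nu]_y (F2 y * G2 (x - y))%:E)%E) => //.
- exact: (iterated mFG FG0).
- by move=> x; apply: integral_ge0 => y _; rewrite lee_fin mulr_ge0.
move=> x; rewrite muleC.
have mfg : measurable_fun setT (fun y => F y * G (x - y)).
  apply: (section1 (h := fun z => F z.2 * G (z.1 - z.2))).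
  by apply: measurable_funM; [exact: on_snd|exact: fst_sub_snd].
apply: (le_trans (cauchy_schwarz (msqrt1 x) mfg _ _)).
- by move=> y; exact: sqrtr_ge0.
- by move=> y; rewrite mulr_ge0.
apply: lee_pmul.
- by apply: integral_ge0 => y _; rewrite lee_fin sqr_ge0.
- by apply: integral_ge0 => y _; rewrite lee_fin sqr_ge0.
- under eq_integral do rewrite sqrk.
  exact: kS.
- under eq_integral do rewrite exprMn.
  exact: lexx.
Qed.

Lemma trilinear_bound_left : (forall y, \int[nu]_x (k x y)%:E <= S%:E)%E ->
  (\int[nu]_x (trilinear x * trilinear x) <=
   S%:E * (\int[nu]_y (F2 y)%:E * \int[nu]_y (G2 y)%:E))%E.
Proof.
move=> kS.
have mkF : measurable_fun setT (fun z : freq * freq => F2 z.2 * k z.1 z.2).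
  by apply: measurable_funM => //; exact: on_snd.
have kF0 (z : freq * freq) : 0 <= F2 z.2 * k z.1 z.2 by rewrite mulr_ge0.
rewrite muleA.
apply: (@integrate (fun x => \int[nu]_y (F2 y * k x y)%:E)%E).
- exact: (iterated mkF kF0).
- by move=> x; apply: integral_ge0 => y _; rewrite lee_fin mulr_ge0.
- by apply: integral_ge0 => y _; rewrite lee_fin.
- move=> x.
  have m1 : measurable_fun setT (fun y => Num.sqrt (k x y) * F y).
    by apply: measurable_funM => //; exact: msqrt1.
  have -> : trilinear x = (\int[nu]_y ((Num.sqrt (k x y) * F y) * G (x - y))%:E)%E.
    by apply: eq_integral => y _; rewrite mulrA.
  apply: (le_trans (cauchy_schwarz m1 (mG1 x) _ _)).
  - by move=> y; rewrite mulr_ge0// sqrtr_ge0.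
  - by move=> y; exact: G0.
  apply: lee_pmul.
  - by apply: integral_ge0 => y _; rewrite lee_fin sqr_ge0.
  - by apply: integral_ge0 => y _; rewrite lee_fin sqr_ge0.
  - under eq_integral do rewrite exprMn sqrk mulrC.
    exact: lexx.
  - rewrite (@ge0_integral_freq_refl R x (fun y => (G y ^+ 2)%:E))//.
    exact/measurable_EFinP.
- rewrite (swap mkF kF0) -ge0_integralZl_EFin//; last 2 first.
  + by move=> y _; rewrite lee_fin.
  + exact/measurable_EFinP.
  apply: ge0_le_integral.
  + exact: measurableT.
  + by move=> y _; apply: integral_ge0 => x _; rewrite lee_fin mulr_ge0.
  + exact: (iterated2 mkF kF0).
  + by apply: emeasurable_funM => //; exact/measurable_EFinP.
  + move=> y _; under eq_integral do rewrite EFinM /=.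
    rewrite ge0_integralZl_EFin//; last 2 first.
    * by move=> x _; rewrite lee_fin.
    * apply/measurable_EFinP; exact: (measurableT_comp mk (pair2_measurable y)).
    by rewrite [leRHS]muleC; apply: lee_wpmul2l; [rewrite lee_fin|exact: kS].
Qed.

Lemma trilinear_bound_right : (forall z, \int[nu]_y (k (y + z) y)%:E <= S%:E)%E ->
  (\int[nu]_x (trilinear x * trilinear x) <=
   S%:E * (\int[nu]_y (F2 y)%:E * \int[nu]_y (G2 y)%:E))%E.
Proof.
move=> kS.
have mkG : measurable_fun setT (fun z : freq * freq => G2 (z.1 - z.2) * k z.1 z.2).
  by apply: measurable_funM => //; exact: fst_sub_snd.
have kG0 (z : freq * freq) : 0 <= G2 (z.1 - z.2) * k z.1 z.2 by rewrite mulr_ge0.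
rewrite [(\int[nu]_y (F2 y)%:E * _)%E]muleC muleA.
apply: (@integrate (fun x => \int[nu]_y (G2 (x - y) * k x y)%:E)%E).
- exact: (iterated mkG kG0).
- by move=> x; apply: integral_ge0 => y _; rewrite lee_fin mulr_ge0.
- by apply: integral_ge0 => y _; rewrite lee_fin.
- move=> x.
  have m1 : measurable_fun setT (fun y => Num.sqrt (k x y) * G (x - y)).
    by apply: measurable_funM; [exact: msqrt1|exact: mG1].
  have -> : trilinear x = (\int[nu]_y ((Num.sqrt (k x y) * G (x - y)) * F y)%:E)%E.
    by apply: eq_integral => y _; rewrite -mulrA (mulrC (F y)).
  apply: (le_trans (cauchy_schwarz m1 mF _ F0)).
    by move=> y; rewrite mulr_ge0// sqrtr_ge0.
  apply: lee_pmul.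
  - by apply: integral_ge0 => y _; rewrite lee_fin sqr_ge0.
  - by apply: integral_ge0 => y _; rewrite lee_fin sqr_ge0.
  - under eq_integral do rewrite exprMn sqrk mulrC.
    exact: lexx.
  - exact: lexx.
- rewrite (swap mkG kG0).
  have mkG' : measurable_fun setT (fun z : freq * freq => G2 z.2 * k (z.1 + z.2) z.1).
    apply: measurable_funM; first exact: on_snd.
    have mh : measurable_fun setT (fun z : freq * freq => (z.1 + z.2, z.1)).
      apply/measurable_fun_pairP; split; last exact: measurable_fst.
      by apply: measurable_freq_add; [exact: measurable_fst|exact: measurable_snd].
    exact: (measurableT_comp mk mh).
  have kG'0 (z : freq * freq) : 0 <= G2 z.2 * k (z.1 + z.2) z.1 by rewrite mulr_ge0.
  have -> : (\int[nu]_y \int[nu]_x (G2 (x - y) * k x y)%:E =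
      \int[nu]_y \int[nu]_z (G2 z * k (y + z) y)%:E)%E.
    apply: eq_integral => y _.
    rewrite -[LHS](@ge0_integral_freq_shift R y (fun x => (G2 (x - y) * k x y)%:E)).
    - by apply: eq_integral => z _; rewrite (addrC y z) addrK.
    - by apply/measurable_EFinP; exact: (measurableT_comp mkG (pair2_measurable y)).
    - by move=> x; rewrite lee_fin mulr_ge0.
  rewrite (swap mkG' kG'0) -ge0_integralZl_EFin//; last 2 first.
  + by move=> y _; rewrite lee_fin.
  + exact/measurable_EFinP.
  apply: ge0_le_integral.
  + exact: measurableT.
  + by move=> y _; apply: integral_ge0 => x _; rewrite lee_fin mulr_ge0.
  + exact: (iterated2 mkG' kG'0).
  + by apply: emeasurable_funM => //; exact/measurable_EFinP.
  + move=> z _; under eq_integral do rewrite EFinM /=.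
    rewrite ge0_integralZl_EFin//; last 2 first.
    * by move=> x _; rewrite lee_fin.
    * apply/measurable_EFinP.
      have mh : measurable_fun setT (fun y : freq => (y + z, y)).
        apply/measurable_fun_pairP; split; last exact: measurable_id.
        by apply: measurable_freq_add; [exact: measurable_id|exact: measurable_cst].
      exact: (measurableT_comp mk mh).
    by rewrite [leRHS]muleC; apply: lee_wpmul2l; [rewrite lee_fin|exact: kS].
Qed.

End schur.

Section bilinear.
Context {R : realType}.
Notation leb := (@lebesgue_measure R).
Notation freq := (int * measurableTypeR R)%type.
Notation nu := (prod_measure (@countZ R) leb).
Variables eps s gamma : R.
Hypotheses (eps_gt0 : 0 < eps) (eps_lt : eps < 1 / 16).
Local Notation q := (summability_exponent eps).

Lemma decayN (r t : R) : decay r (- t) = decay r t.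
Proof. by rewrite /decay normrN. Qed.

Lemma detuningN (y : freq) : detuning (- y) = - detuning y.
Proof. by rewrite /detuning /= mulrNz; ring. Qed.

Lemma measurable_detuning : measurable_fun setT (@detuning R).
Proof.
apply: measurable_fun_freq => n; rewrite /detuning/=.
by apply: measurable_funB => //; exact: measurable_cst.
Qed.

Lemma kernN (y z : freq) : kern eps y (- z) = kern eps y z.
Proof. by rewrite /kern /= mulrNz detuningN !decayN. Qed.

Lemma kernC (y z : freq) : kern eps y z = kern eps z y.
Proof. by rewrite /kern addrC (addrC (decay q (detuning y))). Qed.

Lemma measurable_kern d (X : measurableType d) (h k : X -> freq) :
  measurable_fun setT h -> measurable_fun setT k ->
  measurable_fun setT (fun x => kern eps (h x) (k x)).
Proof.
have md1 (g : X -> freq) : measurable_fun setT g ->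
    measurable_fun setT (fun x => decay q (g x).1%:~R).
  move=> /measurable_fun_pairP[g1 _].
  exact: (@measurable_fun_of_int _ _ _ _ (fst \o g) (fun n : int => decay q n%:~R) g1).
have md2 (g : X -> freq) : measurable_fun setT g ->
    measurable_fun setT (fun x => decay q (detuning (g x))).
  move=> mg; apply: (measurableT_comp (measurable_decay q)).
  exact: (measurableT_comp measurable_detuning mg).
move=> mh mk; apply: measurable_funM; apply: measurable_funD.
- exact: md1.
- exact: md1.
- exact: md2.
- exact: md2.
Qed.

(** The detuning is integrated first, at fixed spatial frequency, where the
    cubic term is a translation; the sum over the spatial frequency is then
    decoupled. *)
Lemma integral_kern_le : exists2 S : R, 0 <= S &
  forall x : freq, (\int[nu]_y (kern eps y (x - y))%:E <= S%:E)%E.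
Proof.
have q1 := summability_exponent_gt1 eps_lt.
pose I := fine (\int[leb]_t (decay q t)%:E).
pose Z := fine (\int[@countZ R]_n (decay q n%:~R)%:E).
have I0 : (0 <= \int[leb]_t (decay q t)%:E)%E.
  by apply: integral_ge0 => t _; rewrite lee_fin decay_ge0.
have Z0 : (0 <= \int[@countZ R]_n (decay q n%:~R)%:E)%E.
  by apply: integral_ge0 => t _; rewrite lee_fin decay_ge0.
have IE : (\int[leb]_t (decay q t)%:E = I%:E)%E.
  by rewrite fineK// ge0_fin_numE//; exact: integral_decay_lty.
have ZE : (\int[@countZ R]_n (decay q n%:~R)%:E = Z%:E)%E.
  by rewrite fineK// ge0_fin_numE//; exact: sum_decay_lty.
exists ((Z + Z) * (I + I)); first by rewrite mulr_ge0// addr_ge0// fine_ge0.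
move=> [m t].
have md : measurable_fun setT (fun u : R => (decay q u)%:E).
  by apply/measurable_EFinP; exact: measurable_decay.
have d0 (u : R) : (0 <= (decay q u)%:E)%E by rewrite lee_fin decay_ge0.
have I1 (c : R) : (\int[leb]_tau (decay q (tau - c))%:E = I%:E)%E.
  rewrite -IE -[RHS](@ge0_integral_shift R (- c) (fun u => (decay q u)%:E) md d0).
  by apply: eq_integral => tau _; rewrite addrC.
have I2 (c : R) : (\int[leb]_tau (decay q (c - tau))%:E = I%:E)%E.
  by rewrite -IE -[RHS](@ge0_integral_refl R c (fun u => (decay q u)%:E) md d0).
rewrite ge0_integral_freq; last 2 first.
- apply/measurable_EFinP; apply: measurable_kern; first exact: measurable_id.
  by apply: measurable_freq_sub => //; exact: measurable_cst.
- by move=> y; rewrite lee_fin kern_ge0.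
have inner n : (\int[leb]_tau (kern eps (n, tau) ((m, t) - (n, tau)))%:E =
    ((decay q n%:~R + decay q (m - n)%:~R) * (I + I))%:E)%E.
  rewrite /kern/=; under eq_integral do rewrite EFinM.
  have mD1 : measurable_fun setT (fun tau : R => (decay q (detuning (n, tau)))%:E).
    apply/measurable_EFinP; apply: (measurableT_comp (measurable_decay q)).
    by rewrite /detuning/=; apply: measurable_funB => //; exact: measurable_cst.
  have mD2 : measurable_fun setT (fun tau : R => (decay q (detuning ((m, t) - (n, tau))))%:E).
    apply/measurable_EFinP; apply: (measurableT_comp (measurable_decay q)).
    rewrite /detuning/=; apply: measurable_funB; last exact: measurable_cst.
    exact: measurable_refl.
  rewrite ge0_integralZl_EFin//; last 3 first.
  - by move=> tau _; rewrite lee_fin addr_ge0// decay_ge0.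
  - by under eq_fun do rewrite EFinD; exact: emeasurable_funD.
  - by rewrite addr_ge0// decay_ge0.
  rewrite EFinM; congr (_ * _)%E.
  under eq_integral do rewrite EFinD.
  rewrite ge0_integralD//.
  rewrite EFinD; congr (_ + _)%E; first by rewrite -(I1 (n%:~R ^+ 3)).
  rewrite -(I2 (t - (m - n)%:~R ^+ 3)); apply: eq_integral => tau _.
  by congr (decay q _)%:E; rewrite /detuning/= addrAC.
under eq_integral do rewrite inner mulrC EFinM.
rewrite ge0_integralZl_EFin//; last 2 first.
- by move=> n _; rewrite lee_fin addr_ge0// decay_ge0.
- by rewrite addr_ge0// fine_ge0.
under eq_integral do rewrite EFinD.
rewrite ge0_integralD//.
rewrite (@ge0_integral_counting_int_refl R m (fun n => (decay q n%:~R)%:E))//.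
by rewrite ZE -EFinD -EFinM mulrC.
Qed.

Section estimate.
Hypotheses (s_ge : - (1 / 2) - eps <= s) (gamma_le : gamma <= eps).

Lemma bourgain_weight_ge0 (r b : R) (y : freq) : 0 <= bourgain_weight r b y.
Proof. by rewrite mulr_ge0// powR_ge0. Qed.

Lemma measurable_bourgain_weight (r b : R) : measurable_fun setT (@bourgain_weight R r b).
Proof.
have mE (y : freq) : modulation y = Num.sqrt (1 + (y.1%:~R ^+ 2) ^+ 2 + detuning y ^+ 2).
  by rewrite -modulationE sqrtr_sqr ger0_norm// ltW// modulation_gt0.
have msq : measurable_fun setT (@Num.sqrt R).
  by apply: continuous_measurable_fun; exact: sqrt_continuous.
apply: measurable_funM.
  apply: (measurableT_comp (measurable_powR (R := R) (2 * r))).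
  by apply: measurable_fun_freq => n; rewrite /spatial/=; exact: measurable_cst.
apply: (measurableT_comp (measurable_powR (R := R) (2 * b))).
rewrite (funext mE); apply: (measurableT_comp msq); apply: measurable_funD.
  by apply: measurable_fun_freq => n /=; exact: measurable_cst.
by apply: measurable_funX; exact: measurable_detuning.
Qed.

(** The squared [X^{r,b}] norm of the distribution with spectrum [f]. *)
Definition weighted_energy (r b : R) (f : freq -> R[i]) : \bar R :=
  (\int[nu]_y (bourgain_weight r b y * normc (f y) ^+ 2)%:E)%E.

Lemma sqrtD_le (a b : R) : 0 <= a -> 0 <= b -> Num.sqrt (a + b) <= Num.sqrt a + Num.sqrt b.
Proof.
move=> a0 b0; apply: ler_of_sqr; first by rewrite addr_ge0 ?sqrtr_ge0.
rewrite sqrrD !sqr_sqrtr ?addr_ge0//.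
have := sqrtr_ge0 a; have := sqrtr_ge0 b; nra.
Qed.

Lemma sqr_add3_le (a b c : \bar R) : (0 <= a)%E -> (0 <= b)%E -> (0 <= c)%E ->
  ((a + b + c) * (a + b + c) <= 3%:E * (a * a + b * b + c * c))%E.
Proof.
case: a => [a| |]//; case: b => [b| |]//; case: c => [c| |]// a0 b0 c0.
  rewrite -!EFinD -!EFinM lee_fin.
  have := sqr_ge0 (a - b); have := sqr_ge0 (b - c); have := sqr_ge0 (a - c); lra.
all: by rewrite -?EFinM ?mulyy ?addye ?addey// gt0_muley ?lte_fin// leey.
Qed.

Let regroup (c a b d1 d2 d3 u v : R) :
  c * (a * b * (d1 + d2 + d3)) * (u * v) =
  c * (d1 * (a * u * (b * v)) + d2 * (a * u * (b * v)) + d3 * (a * u * (b * v))).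
Proof. by ring. Qed.

(** The multiplier bound reduces the convolution to three trilinear expressions,
    one for each dominant modulation, each handled by its own way of applying the
    Cauchy-Schwarz inequality. Frequency zero is excluded because the resonance
    identity gives nothing there. *)
Lemma bilinear_estimate : exists2 C : R, 0 < C & forall f g : freq -> R[i],
  cmeasurable setT f -> cmeasurable setT g ->
  (forall tau, f (0, tau) = 0) -> (forall tau, g (0, tau) = 0) ->
  (\int[nu]_x (x.1%:~R ^+ 2 * bourgain_weight s (- (1 / 2) + gamma) x *
     normc (conv f g x) ^+ 2)%:E <=
   C%:E * (weighted_energy s (1 / 2 - eps) f * weighted_energy s (1 / 2 - eps) g))%E.
Proof.
have [S S0 HS] := integral_kern_le.
have MB := multiplier_bound eps_gt0 eps_lt s_ge gamma_le.
pose C0 := expR (2 * (s + 1 / 2 + eps) * ln 2 + ln 3 + 2 * ln 2) * 16.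
have C0pos : 0 < C0 by rewrite mulr_gt0// expR_gt0.
exists (2 * 2 * C0 * (3 * (3 * (S + 1)))).
  have S1 : 0 < S + 1 by exact: ltr_wpDl.
  by apply: mulr_gt0; apply: mulr_gt0 => //; exact: mulr_gt0.
move=> f g mf mg f0 g0.
pose w := @bourgain_weight R s (1 / 2 - eps).
pose W := @bourgain_weight R s (- (1 / 2) + gamma).
have w0 y : 0 <= w y := bourgain_weight_ge0 _ _ _.
have W0 y : 0 <= W y := bourgain_weight_ge0 _ _ _.
pose F (y : freq) := Num.sqrt (w y) * normc (f y).
pose G (y : freq) := Num.sqrt (w y) * normc (g y).
have F0 y : 0 <= F y by rewrite mulr_ge0 ?sqrtr_ge0 ?normc_ge0.
have G0 y : 0 <= G y by rewrite mulr_ge0 ?sqrtr_ge0 ?normc_ge0.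
have msq : measurable_fun setT (@Num.sqrt R).
  by apply: continuous_measurable_fun; exact: sqrt_continuous.
have mw : measurable_fun setT (fun y => Num.sqrt (w y)).
  exact: (measurableT_comp msq (measurable_bourgain_weight s (1 / 2 - eps))).
have mF : measurable_fun setT F by apply: measurable_funM => //; exact: measurable_normc.
have mG : measurable_fun setT G by apply: measurable_funM => //; exact: measurable_normc.
pose k1 (x y : freq) := kern eps y (x - y).
pose k2 (x y : freq) := kern eps x (x - y).
pose k3 (x y : freq) := kern eps x y.
have k10 x y : 0 <= k1 x y by exact: kern_ge0.
have k20 x y : 0 <= k2 x y by exact: kern_ge0.
have k30 x y : 0 <= k3 x y by exact: kern_ge0.
have msub : measurable_fun setT (fun z : freq * freq => z.1 - z.2).
  by apply: measurable_freq_sub; [exact: measurable_fst|exact: measurable_snd].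
have mk1 : measurable_fun setT (fun z : freq * freq => k1 z.1 z.2).
  by apply: measurable_kern; [exact: measurable_snd|exact: msub].
have mk2 : measurable_fun setT (fun z : freq * freq => k2 z.1 z.2).
  by apply: measurable_kern; [exact: measurable_fst|exact: msub].
have mk3 : measurable_fun setT (fun z : freq * freq => k3 z.1 z.2).
  by apply: measurable_kern; [exact: measurable_fst|exact: measurable_snd].
have B1 := trilinear_bound_output k10 mk1 F0 G0 mF mG S0 HS.
have B2 : (\int[nu]_x (trilinear k2 F G x * trilinear k2 F G x) <=
    S%:E * (\int[nu]_y (F y ^+ 2)%:E * \int[nu]_y (G y ^+ 2)%:E))%E.
  apply: (trilinear_bound_left k20 mk2 F0 G0 mF mG S0) => y.
  apply: le_trans (HS y); under eq_integral do rewrite /k2 -kernN opprB.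
  exact: lexx.
have B3 : (\int[nu]_x (trilinear k3 F G x * trilinear k3 F G x) <=
    S%:E * (\int[nu]_y (F y ^+ 2)%:E * \int[nu]_y (G y ^+ 2)%:E))%E.
  apply: (trilinear_bound_right k30 mk3 F0 G0 mF mG S0) => z.
  apply: le_trans (HS (- z)); under eq_integral do rewrite /k3 kernC -kernN opprD (addrC (- _)).
  exact: lexx.
have FE : (\int[nu]_y (F y ^+ 2)%:E = weighted_energy s (1 / 2 - eps) f)%E.
  by apply: eq_integral => y _; rewrite exprMn sqr_sqrtr.
have GE : (\int[nu]_y (G y ^+ 2)%:E = weighted_energy s (1 / 2 - eps) g)%E.
  by apply: eq_integral => y _; rewrite exprMn sqr_sqrtr.
rewrite -FE -GE.
pose P := (\int[nu]_y (F y ^+ 2)%:E * \int[nu]_y (G y ^+ 2)%:E)%E.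
have P0 : (0 <= P)%E by apply: mule_ge0; apply: integral_ge0 => y _; rewrite lee_fin sqr_ge0.
pose X (x : freq) := `|x.1%:~R| * Num.sqrt (W x) * normc (conv f g x).
have X0 x : 0 <= X x by rewrite !mulr_ge0 ?sqrtr_ge0 ?normc_ge0.
have XE x : (x.1%:~R ^+ 2 * W x * normc (conv f g x) ^+ 2) = X x * X x.
  have hx : `|x.1%:~R| ^+ 2 = x.1%:~R ^+ 2 :> R by exact: real_normK (num_real _).
  have hw : Num.sqrt (W x) ^+ 2 = W x by exact: sqr_sqrtr.
  by rewrite -[in LHS]hx -[in LHS]hw /X; ring.
(* the pointwise multiplier bound, after taking square roots *)
have pw (x y : freq) : `|x.1%:~R| * Num.sqrt (W x) * normc (f y * g (x - y)) <=
    Num.sqrt C0 * (Num.sqrt (k1 x y) * (F y * G (x - y)) +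
      Num.sqrt (k2 x y) * (F y * G (x - y)) + Num.sqrt (k3 x y) * (F y * G (x - y))).
  have rhs0 : 0 <= Num.sqrt C0 * (Num.sqrt (k1 x y) * (F y * G (x - y)) +
      Num.sqrt (k2 x y) * (F y * G (x - y)) + Num.sqrt (k3 x y) * (F y * G (x - y))).
    by rewrite mulr_ge0 ?sqrtr_ge0// !addr_ge0// mulr_ge0 ?sqrtr_ge0// mulr_ge0.
  have n0 : normc (0 : R[i]) = 0 by rewrite (normc_real 0) normr0.
  have [x0|x0] := eqVneq x.1 0; first by rewrite x0 normr0 !mul0r.
  have [y0|y0] := eqVneq y.1 0.
    by rewrite (_ : f y = 0) ?mul0r ?n0 ?mulr0// [y]surjective_pairing y0 f0.
  have [z0|z0] := eqVneq (x - y).1 0.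
    by rewrite (_ : g (x - y) = 0) ?mulr0 ?n0 ?mulr0// [x - y]surjective_pairing z0 g0.
  have yz : y + (x - y) = x by rewrite addrC subrK.
  have := MB y (x - y) y0 z0; rewrite yz => /(_ x0); rewrite -/C0 -/W -/w -/(k1 x y) -/(k2 x y) -/(k3 x y).
  move=> H.
  have H1 : `|x.1%:~R| * Num.sqrt (W x) <= Num.sqrt C0 * (Num.sqrt (w y) * Num.sqrt (w (x - y)) *
      (Num.sqrt (k1 x y) + Num.sqrt (k2 x y) + Num.sqrt (k3 x y))).
    have E : `|x.1%:~R| * Num.sqrt (W x) = Num.sqrt (x.1%:~R ^+ 2 * W x).
      by rewrite (sqrtrM _ (sqr_ge0 _)) sqrtr_sqr.
    rewrite E; apply: (le_trans (ler_wsqrtr H)).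
    rewrite (sqrtrM _ (ltW C0pos)); apply: ler_wpM2l; first exact: sqrtr_ge0.
    rewrite (sqrtrM _ (mulr_ge0 (w0 y) (w0 (x - y)))) (sqrtrM _ (w0 y)).
    apply: ler_wpM2l; first by rewrite mulr_ge0 ?sqrtr_ge0.
    apply: (le_trans (sqrtD_le (addr_ge0 (k10 x y) (k20 x y)) (k30 x y))).
    by rewrite lerD2r; exact: sqrtD_le.
  rewrite normcM; have nn : 0 <= normc (f y) * normc (g (x - y)) by rewrite mulr_ge0 ?normc_ge0.
  apply: (le_trans (ler_wpM2r nn H1)); rewrite le_eqVlt; apply/orP; left; apply/eqP.
  exact: regroup.
have mt (k : freq -> freq -> R) x : measurable_fun setT (fun z : freq * freq => k z.1 z.2) ->
    measurable_fun setT (fun y => (Num.sqrt (k x y) * (F y * G (x - y)))%:E).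
  move=> mk; apply/measurable_EFinP; apply: measurable_funM.
    apply: (measurableT_comp msq); exact: (measurableT_comp mk (pair1_measurable x)).
  apply: measurable_funM => //; apply: (measurableT_comp mG).
  by apply: measurable_freq_sub => //; exact: measurable_cst.
have t0 (k : freq -> freq -> R) x y : (0 <= (Num.sqrt (k x y) * (F y * G (x - y)))%:E)%E.
  by rewrite lee_fin mulr_ge0 ?sqrtr_ge0// mulr_ge0.
pose t x := (trilinear k1 F G x + trilinear k2 F G x + trilinear k3 F G x)%E.
have Xt x : ((X x)%:E <= (2 * Num.sqrt C0)%:E * t x)%E.
  have mfg : cmeasurable setT (fun y => f y * g (x - y)).
    apply: (cmeasurableM mf); apply: (cmeasurable_comp mg).
    by apply: measurable_freq_sub => //; exact: measurable_cst.
  have c0 : 0 <= `|x.1%:~R| * Num.sqrt (W x) by rewrite mulr_ge0 ?sqrtr_ge0.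
  rewrite /X EFinM; apply: (@le_trans _ _ ((`|x.1%:~R| * Num.sqrt (W x))%:E *
     (2%:E * \int[nu]_y (normc (f y * g (x - y)))%:E))%E).
    by apply: lee_wpmul2l; [rewrite lee_fin|exact: (@normc_cintegral_le _ _ _ nu _ mfg)].
  rewrite muleCA [X in (_ <= X * _)%E]EFinM -[leRHS]muleA; apply: lee_wpmul2l.
    by rewrite lee_fin.
  rewrite -ge0_integralZl_EFin//; last 2 first.
  - by move=> y _; rewrite lee_fin normc_ge0.
  - by apply/measurable_EFinP; exact: measurable_normc.
  rewrite /t /trilinear -ge0_integralD//; last 2 first.
  - exact: mt.
  - exact: mt.
  rewrite -ge0_integralD//; last 3 first.
  - by move=> y _; rewrite adde_ge0.
  - by apply: emeasurable_funD; exact: mt.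
  - exact: mt.
  rewrite -ge0_integralZl_EFin ?sqrtr_ge0//; last 2 first.
  - by move=> y _; rewrite !adde_ge0.
  - by apply: emeasurable_funD; [apply: emeasurable_funD; exact: mt|exact: mt].
  apply: ge0_le_integral.
  - exact: measurableT.
  - by move=> y _; rewrite -EFinM lee_fin mulr_ge0// normc_ge0.
  - by apply: emeasurable_funM => //; apply/measurable_EFinP; exact: measurable_normc.
  - apply: emeasurable_funM => //.
    by apply: emeasurable_funD; [apply: emeasurable_funD; exact: mt|exact: mt].
  - by move=> y _; rewrite -!EFinD -!EFinM lee_fin; exact: pw.
have T0 (k : freq -> freq -> R) x : (0 <= trilinear k F G x)%E.
  by apply: integral_ge0 => y _; exact: t0.
pose t2 x := (trilinear k1 F G x * trilinear k1 F G x + trilinear k2 F G x * trilinear k2 F G x +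
   trilinear k3 F G x * trilinear k3 F G x)%E.
have X2 x : ((X x * X x)%:E <= (2 * 2 * C0 * 3)%:E * t2 x)%E.
  rewrite EFinM; apply: (le_trans (lee_pmul _ _ (Xt x) (Xt x))); rewrite ?lee_fin//.
  rewrite muleACA -EFinM.
  have -> : 2 * Num.sqrt C0 * (2 * Num.sqrt C0) = 2 * 2 * C0.
    have hc : Num.sqrt C0 * Num.sqrt C0 = C0 by rewrite -expr2 sqr_sqrtr// ltW.
    by rewrite mulrACA hc.
  rewrite [X in (_ <= X * _)%E]EFinM -muleA; apply: lee_wpmul2l.
    by rewrite lee_fin !mulr_ge0// ltW.
  exact: sqr_add3_le.
have mT1 := measurable_trilinear mk1 F0 G0 mF mG.
have mT2 := measurable_trilinear mk2 F0 G0 mF mG.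
have mT3 := measurable_trilinear mk3 F0 G0 mF mG.
have TT0 (k : freq -> freq -> R) x : (0 <= trilinear k F G x * trilinear k F G x)%E.
  by rewrite mule_ge0.
have mTT1 : measurable_fun setT (fun x => trilinear k1 F G x * trilinear k1 F G x)%E.
  exact: (emeasurable_funM mT1 mT1).
have mTT2 : measurable_fun setT (fun x => trilinear k2 F G x * trilinear k2 F G x)%E.
  exact: (emeasurable_funM mT2 mT2).
have mTT3 : measurable_fun setT (fun x => trilinear k3 F G x * trilinear k3 F G x)%E.
  exact: (emeasurable_funM mT3 mT3).
have mt2 : measurable_fun setT t2.
  exact: (emeasurable_funD (emeasurable_funD mTT1 mTT2) mTT3).
have t20 x : (0 <= t2 x)%E := adde_ge0 (adde_ge0 (TT0 k1 x) (TT0 k2 x)) (TT0 k3 x).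
have c0 : 0 <= 2 * 2 * C0 * 3 by rewrite !mulr_ge0// ltW.
apply: (@le_trans _ _ (\int[nu]_x ((2 * 2 * C0 * 3)%:E * t2 x))%E).
  apply: ge0_le_integral.
  - exact: measurableT.
  - by move=> x _; rewrite lee_fin -/W XE mulr_ge0.
  - apply/measurable_EFinP; apply: measurable_funM; last first.
      by apply: measurable_sqr_normc; exact: cmeasurable_conv.
    apply: measurable_funM; last exact: measurable_bourgain_weight.
    by apply: measurable_fun_freq => n /=; exact: measurable_cst.
  - exact: (emeasurable_funM (measurable_cst _) mt2).
  - by move=> x _; rewrite -/W XE; exact: X2.
rewrite (ge0_integralZl_EFin nu measurableT (fun x _ => t20 x) mt2 c0).
have -> : (\int[nu]_x t2 x = \int[nu]_x (trilinear k1 F G x * trilinear k1 F G x) +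
    \int[nu]_x (trilinear k2 F G x * trilinear k2 F G x) +
    \int[nu]_x (trilinear k3 F G x * trilinear k3 F G x))%E.
  rewrite -(ge0_integralD nu measurableT (fun x _ => TT0 k1 x) mTT1 (fun x _ => TT0 k2 x) mTT2).
  by rewrite -(ge0_integralD nu measurableT (fun x _ => adde_ge0 (TT0 k1 x) (TT0 k2 x))
    (emeasurable_funD mTT1 mTT2) (fun x _ => TT0 k3 x) mTT3).
rewrite [X in (_ <= X * _)%E](_ : _ = (2 * 2 * C0 * 3)%:E * (3 * (S + 1))%:E)%E; last first.
  by rewrite -EFinM; congr EFin; ring.
rewrite -muleA; apply: lee_wpmul2l; first by rewrite lee_fin.
apply: (le_trans (leeD (leeD B1 B2) B3)).
rewrite -/P -!ge0_muleDl ?lee_fin ?addr_ge0// -!EFinD.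
apply: lee_wpmul2r => //; rewrite lee_fin; lra.
Qed.

End estimate.
End bilinear.

(** * Distributions with a given spectrum *)

Section spectra.
Context {R : realType}.
Notation leb := (@lebesgue_measure R).
Notation freq := (int * measurableTypeR R)%type.
Notation plane := (measurableTypeR R * measurableTypeR R)%type.
Notation nu := (prod_measure (@countZ R) leb).
Notation lam := (prod_measure leb leb).
Notation pi2 := (pi *+ 2 : R).
Implicit Types (f : int -> R -> R[i]) (U V W : distr R).

Definition spectrum f (y : freq) : R[i] := f y.1 y.2.

Lemma cmeasurable_spectrum f : (forall n, cmeasurable setT (f n)) ->
  cmeasurable setT (spectrum f).
Proof.
by move=> mf; split; apply: measurable_fun_freq => n; rewrite /spectrum/=; have [] := mf n.
Qed.

Lemma weighted_energy_ge0 (s b : R) (h : freq -> R[i]) : (0 <= weighted_energy s b h)%E.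
Proof.
by apply: integral_ge0 => y _; rewrite lee_fin mulr_ge0 ?bourgain_weight_ge0 ?sqr_ge0.
Qed.

Lemma measurable_weighted (s b : R) (h : freq -> R[i]) : cmeasurable setT h ->
  measurable_fun setT (fun y => (bourgain_weight s b y * normc (h y) ^+ 2)%:E).
Proof.
move=> mh; apply/measurable_EFinP; apply: measurable_funM.
  exact: measurable_bourgain_weight.
exact: measurable_sqr_normc.
Qed.

Lemma XFnormE (s b : R) f : (forall n, cmeasurable setT (f n)) ->
  XFnorm s b f = (weighted_energy s b (spectrum f) `^ (2^-1))%E.
Proof.
move=> mf; rewrite /XFnorm /weighted_energy ge0_integral_freqE//.
  exact: measurable_weighted (cmeasurable_spectrum mf).
by move=> y; rewrite lee_fin mulr_ge0 ?bourgain_weight_ge0 ?sqr_ge0.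
Qed.

Lemma le_weighted_energy (s b : R) (h k : freq -> R[i]) :
  cmeasurable setT h -> cmeasurable setT k -> (forall y, normc (h y) <= normc (k y)) ->
  (weighted_energy s b h <= weighted_energy s b k)%E.
Proof.
move=> mh mk hk; apply: ge0_le_integral.
- exact: measurableT.
- by move=> y _; rewrite lee_fin mulr_ge0 ?bourgain_weight_ge0 ?sqr_ge0.
- exact: measurable_weighted.
- exact: measurable_weighted.
- move=> y _; rewrite lee_fin ler_wpM2l ?bourgain_weight_ge0//.
  by rewrite ler_sqr ?nnegrE ?normc_ge0.
Qed.

Section square_integrability.
Variables eps s : R.
Hypotheses (eps_gt0 : 0 < eps) (eps_lt : eps < 1 / 16) (s_ge : - (1 / 2) - eps <= s).

(** The modulation controls the spatial frequency well enough to absorb the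
    negative Sobolev exponent. *)
Lemma bourgain_weight_lower (y : freq) : 2^-1 <= bourgain_weight s (1 / 2 - eps) y.
Proof.
have a0 := ln_ge0 (spatial_ge1 y); have b0 := ln_ge0 (modulation_ge1 y).
have ab := ln_sqr_le (spatial_ge1 y) (modulation_ge1 y) (sqr_spatial_le y).
have e0 := eps_gt0; have e1 := eps_lt; have s0 := s_ge.
rewrite /bourgain_weight !powR_expR ?spatial_ge1 ?modulation_ge1// -expRD.
rewrite [leLHS](_ : _ = expR (- ln 2)); last by rewrite expRN lnK ?posrE.
rewrite ler_expR.
have L0 : 0 <= ln 2 :> R by rewrite ln_ge0// ler1n.
move: (ln (spatial y)) (ln (modulation y)) (ln 2) a0 b0 ab L0 => a b L a0 b0 ab L0.
have H1 : 0 <= (s + 1 / 2 + eps) * a by rewrite mulr_ge0//; lra.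
have H2 : 0 <= (1 / 2 + eps) * (b + L - 2 * a) by rewrite mulr_ge0//; lra.
have H3 : 0 <= (1 / 16 - eps) * b by rewrite mulr_ge0//; lra.
have H4 : 0 <= (1 / 16 - eps) * L by rewrite mulr_ge0//; lra.
lra.
Qed.

Lemma weighted_energy_square_integrable (h : freq -> R[i]) : cmeasurable setT h ->
  (weighted_energy s (1 / 2 - eps) h < +oo)%E -> square_integrable nu setT h.
Proof.
move=> mh hoo; split=> //.
apply: (@le_lt_trans _ _ (2%:E * weighted_energy s (1 / 2 - eps) h)%E); last first.
  exact: lte_mul_pinfty.
rewrite /weighted_energy -ge0_integralZl_EFin//; last 2 first.
- by move=> y _; rewrite lee_fin mulr_ge0 ?bourgain_weight_ge0 ?sqr_ge0.
- exact: measurable_weighted.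
apply: ge0_le_integral.
- exact: measurableT.
- by move=> y _; rewrite lee_fin sqr_ge0.
- exact: measurable_energy.
- exact: (emeasurable_funM (measurable_cst _) (measurable_weighted _ _ mh)).
- move=> y _; rewrite -EFinM lee_fin mulrA ler_peMl ?sqr_ge0//.
  by have := bourgain_weight_lower y; lra.
Qed.

End square_integrability.

Variable T : R.
Notation I := (`]0%R, T[%classic : set R).
Notation D := (`]0%R, T[%classic `*` torus).

Lemma cmeasurable_cut_on (a : plane -> R[i]) : cmeasurable D a -> cmeasurable setT (cut T a).
Proof.
have mD := measurable_cylinder T.
have E (v : plane -> R) : (fun p => v p * \1_D p) = v \_ D.
  apply/funext => p; rewrite patchE indicE; case: (p \in D); rewrite ?mulr1 ?mulr0//.
move=> [ma mi]; split.
  have -> : (fun p => complex.Re (cut T a p)) = (fun p => complex.Re (a p) * \1_D p).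
    by apply/funext => p; rewrite /cut ReMc /= mulr0 subr0.
  by rewrite (E (fun p => complex.Re (a p))); exact: (measurable_restrictT _ mD).1 ma.
have -> : (fun p => complex.Im (cut T a p)) = (fun p => complex.Im (a p) * \1_D p).
  by apply/funext => p; rewrite /cut ImMc /= mulr0 add0r.
by rewrite (E (fun p => complex.Im (a p))); exact: (measurable_restrictT _ mD).1 mi.
Qed.

Lemma square_integrable_cut_on (a : plane -> R[i]) : square_integrable lam D a ->
  square_integrable lam setT (cut T a).
Proof.
move=> [ma aoo]; split; first exact: cmeasurable_cut_on.
apply: le_lt_trans aoo; rewrite le_eqVlt; apply/orP; left; apply/eqP.
rewrite [RHS]integral_mkcond; apply: eq_integral => p _.
rewrite patchE /cut indicE; case: ifPn => _; first by rewrite mulr1.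
by rewrite mulr0 normc_real normr0 expr0n.
Qed.

Lemma square_integrable_on (a : plane -> R[i]) : square_integrable lam setT a ->
  square_integrable lam D a.
Proof.
move=> [[mr mi] aoo]; split; first by split; exact: measurable_funTS.
apply: le_lt_trans aoo; apply: ge0_subset_integral => //.
- exact: measurable_cylinder.
- by apply: measurable_energy.
- by move=> p _; rewrite lee_fin sqr_ge0.
Qed.

Lemma distr_of_funE (a : plane -> R[i]) n psi : test_function I psi ->
  distr_of_fun I a n psi = cintegral lam setT (fun p => cut T a p * wave n psi p).
Proof.
move=> tpsi; rewrite /distr_of_fun.
transitivity (cintegral lam D
    (fun p : plane => a p * (psi p.1)%:C * cis (- (n%:~R * p.2)))); first by [].
rewrite cintegral_indic; apply: eq_cintegral => p.
rewrite /cut /wave !indicE in_setX.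
by case: (p.1 \in _); case: (p.2 \in _); rewrite ?mulr1 ?mulr0 ?mul0r// !mulrA.
Qed.

(** The zero mode of the spectrum may be discarded: it does not contribute to
    the pairings over the time interval, whose spatial mean vanishes. *)
Lemma mean_zero_spectrum (s b : R) U u f : is_spacetime_fourier U f ->
  eq_distr_on I U u -> spatial_mean_zero I u ->
  (square_integrable nu setT (spectrum f)) ->
  exists h : freq -> R[i], [/\ square_integrable nu setT h, (forall tau, h (0, tau) = 0),
    (weighted_energy s b h <= weighted_energy s b (spectrum f))%E &
    forall n psi, test_function I psi ->
      u n psi = cintegral nu setT (fun y => h y * mode n psi y)].
Proof.
move=> [mf Uf] Uu u0 f2.
pose h (y : freq) : R[i] := if y.1 == 0 then 0 else spectrum f y.
have mh : cmeasurable setT h.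
  have [mr mi] := cmeasurable_spectrum mf; split; apply: measurable_fun_freq => n;
    rewrite /h/=; case: eqP => _; rewrite /spectrum/=; by have [] := mf n.
have hf y : normc (h y) <= normc (spectrum f y).
  by rewrite /h; case: eqP => // _; rewrite (normc_real 0) normr0 normc_ge0.
have h2 : square_integrable nu setT h.
  split=> //; apply: le_lt_trans f2.2; apply: le_energy => //.
    exact: measurable_sqr_normc f2.1.
  by move=> y; rewrite ler_sqr ?nnegrE ?normc_ge0.
exists h; split=> //; first exact: (le_weighted_energy s b mh f2.1 hf).
move=> n psi tpsi; have [n0|n0] := eqVneq n 0.
  rewrite n0 (u0 psi tpsi); symmetry.
  have -> : (fun y => h y * mode 0 psi y) = (fun=> 0).
    by apply/funext => y; rewrite /h /mode; case: eqP => _; rewrite ?mul0r ?mulr0.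
  by rewrite /cintegral/= /Rintegral integral0_eq.
rewrite -(Uu n psi tpsi) (Uf n psi (test_function_setT tpsi)).
have m2 := mode_square_integrable n tpsi.
have -> : (fun y => h y * mode n psi y) = (fun y => spectrum f y * mode n psi y).
  apply/funext => y; rewrite /h /mode; case: (eqVneq y.1 n) => [->|]; last by rewrite !mulr0.
  by rewrite (negbTE n0).
by rewrite (cintegral_mode (square_integrable_mul f2 m2)).
Qed.

Lemma XTnorm_lt_spectrum (s b A : R) u : (XTnorm s b T u < A%:E)%E ->
  exists U f, [/\ eq_distr_on I U u, is_spacetime_fourier U f & (XFnorm s b f < A%:E)%E].
Proof.
move=> /ereal_inf_lt[_ [U [_ Uu] <-]] /ereal_inf_lt[_ [f Uf <-] fA].
by exists U, f.
Qed.

Lemma XTnorm_ge0 (s b : R) u : (0 <= XTnorm s b T u)%E.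
Proof.
apply: le_ereal_inf_tmp => _ [U _ <-]; apply: le_ereal_inf_tmp => _ [f _ <-].
exact: poweR_ge0.
Qed.

Lemma XFnorm_lt_energy (s b A : R) f : (forall n, cmeasurable setT (f n)) ->
  (XFnorm s b f < A%:E)%E -> (weighted_energy s b (spectrum f) <= (A ^+ 2)%:E)%E.
Proof.
move=> mf; rewrite XFnormE//; have := weighted_energy_ge0 s b (spectrum f).
case: (weighted_energy _ _ _) => [r| |]//; last first.
  by rewrite poweRyr// invr_neq0.
rewrite lee_fin => r0; rewrite poweR_EFin powR12_sqrt// !lte_fin !lee_fin => H.
by rewrite -(sqr_sqrtr r0) ler_sqr ?nnegrE ?sqrtr_ge0// ltW// (le_lt_trans (sqrtr_ge0 _) H).
Qed.

Lemma energy_le_XFnorm (s b A : R) f : (forall n, cmeasurable setT (f n)) -> 0 <= A ->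
  (weighted_energy s b (spectrum f) <= (A ^+ 2)%:E)%E -> (XFnorm s b f <= A%:E)%E.
Proof.
move=> mf A0; rewrite XFnormE//; have := weighted_energy_ge0 s b (spectrum f).
case: (weighted_energy _ _ _) => [r| |]//.
rewrite lee_fin => r0; rewrite poweR_EFin powR12_sqrt// !lee_fin => H.
by rewrite -(ger0_norm A0) -sqrtr_sqr ler_wsqrtr.
Qed.

(** The spectrum of the derivative of the product of two distributions with
    spectra [h] and [k]. *)
Definition dx_conv (h k : freq -> R[i]) (n : int) (tau : R) : R[i] :=
  (0 +i* n%:~R) * (((pi2 ^+ 2)^-1)%:C * conv h k (n, tau)).

Lemma cmeasurable_dx_conv h k n : cmeasurable setT h -> cmeasurable setT k ->
  cmeasurable setT (dx_conv h k n).
Proof.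
move=> mh mk; apply: cmeasurableM; first exact: cmeasurable_cst.
apply: cmeasurableM; first exact: cmeasurable_cst.
exact: (cmeasurable_comp (cmeasurable_conv mh mk) (pair1_measurable n)).
Qed.

Lemma weighted_energy_dx_conv (s b : R) h k :
  cmeasurable setT h -> cmeasurable setT k ->
  (weighted_energy s b (spectrum (dx_conv h k)) <=
   \int[nu]_x (x.1%:~R ^+ 2 * bourgain_weight s b x * normc (conv h k x) ^+ 2)%:E)%E.
Proof.
move=> mh mk; apply: ge0_le_integral.
- exact: measurableT.
- by move=> y _; rewrite lee_fin mulr_ge0 ?bourgain_weight_ge0 ?sqr_ge0.
- by apply: measurable_weighted; apply: cmeasurable_spectrum => n; exact: cmeasurable_dx_conv.
- apply/measurable_EFinP; apply: measurable_funM; last first.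
    by apply: measurable_sqr_normc; exact: cmeasurable_conv.
  apply: measurable_funM; last exact: measurable_bourgain_weight.
  by apply: measurable_fun_freq => n /=; exact: measurable_cst.
move=> [n tau] _; rewrite lee_fin -[spectrum _ _]/(dx_conv h k n tau) /dx_conv -[(n, tau).1]/n.
have pi21 : 1 <= pi2 ^+ 2.
  apply: exprn_ege1; apply: (@le_trans _ _ (2 : R)); first by rewrite ler1n.
  by apply: (le_trans (pi_ge2 R)); rewrite mulr2n lerDl pi_ge0.
have nE : normc (0 +i* n%:~R : R[i]) ^+ 2 = n%:~R ^+ 2 by rewrite sqr_normcE /= expr0n add0r.
have cE : normc ((pi2 ^+ 2)^-1)%:C <= 1.
  rewrite normc_real ger0_norm ?invr_ge0 ?sqr_ge0//.
  by rewrite invf_le1//; exact: lt_le_trans pi21.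
rewrite normcM exprMn nE mulrCA -[leRHS]mulrA; apply: ler_wpM2l; first exact: sqr_ge0.
apply: ler_wpM2l; first exact: bourgain_weight_ge0.
rewrite normcM exprMn ler_piMl ?sqr_ge0// exprn_ile1//; exact: normc_ge0.
Qed.

Lemma dx_conv_pairing h k n psi : square_integrable nu setT h -> square_integrable nu setT k ->
  test_function I psi ->
  cintegral leb setT (fun tau => dx_conv h k n tau * inverse_fourier psi tau) =
  (0 +i* n%:~R) * (((pi2 ^+ 2)^-1)%:C * cintegral nu setT (fun y => conv h k y * mode n psi y)).
Proof.
move=> h2 k2 tpsi.
have [A A0 hA] := energy_le_sqr h2; have [B B0 kB] := energy_le_sqr k2.
have mi := cintegrable_mode n tpsi.
have mc := cmeasurable_conv h2.1 k2.1.
have cb y : normc (conv h k y) <= 2 * (A * B).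
  exact: (normc_conv_le y h2.1 k2.1 (ltW A0) (ltW B0) hA kB).
have ci : cintegrable nu (fun y => conv h k y * mode n psi y) := cintegrableMl mc cb mi.
rewrite (cintegral_mode ci).
have ti : cintegrable leb (fun tau => conv h k (n, tau) * inverse_fourier psi tau).
  apply: (cintegrableMl (cmeasurable_comp mc (pair1_measurable n)) _
    (cintegrable_inverse_fourier tpsi)) => tau; exact: cb.
rewrite -(cintegralZ _ ti) -(cintegralZ _ (cintegrableZ _ ti)).
by apply: eq_cintegral => tau; rewrite /dx_conv !mulrA.
Qed.

End spectra.

(** * Products of distributions *)

Section products.
Context {R : realType}.
Notation leb := (@lebesgue_measure R).
Notation freq := (int * measurableTypeR R)%type.
Notation plane := (measurableTypeR R * measurableTypeR R)%type.
Notation nu := (prod_measure (@countZ R) leb).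
Notation lam := (prod_measure leb leb).
Notation pi2 := (pi *+ 2 : R).
Variables (T : R) (u v : distr R) (h k : freq -> R[i]).
Notation I := (`]0%R, T[%classic : set R).
Hypotheses (h2 : square_integrable nu setT h) (k2 : square_integrable nu setT k).
Hypothesis uh : forall n psi, test_function I psi ->
  u n psi = cintegral nu setT (fun y => h y * mode n psi y).
Hypothesis vk : forall n psi, test_function I psi ->
  v n psi = cintegral nu setT (fun y => k y * mode n psi y).

Lemma synthesizes_distr (w : distr R) (f : freq -> R[i]) (a : plane -> R[i]) :
  synthesizes T f a ->
  (forall n psi, test_function I psi ->
     w n psi = cintegral nu setT (fun y => f y * mode n psi y)) ->
  eq_distr_on I w (distr_of_fun I a).
Proof.
move=> fa wf n psi tpsi; rewrite distr_of_funE// (wf n psi tpsi) -(synthesizes_pairing n fa tpsi).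
by apply: eq_cintegral => p; rewrite (wave_cut _ _ _ tpsi).
Qed.

Lemma is_product_on_ex : exists uv : distr R, is_product_on I u v uv.
Proof.
have [a ha] := synthesizes_ex T h2; have [b kb] := synthesizes_ex T k2.
exists (distr_of_fun I (fun p => a p * b p)); exists a, b; split=> //.
- by have [_ a2 _] := ha; exact: (square_integrable_on T a2).
- by have [_ b2 _] := kb; exact: (square_integrable_on T b2).
- exact: (synthesizes_distr ha uh).
- exact: (synthesizes_distr kb vk).
Qed.

(** The representatives that witness the product need not be the synthesized
    functions, but have the same pairings, hence may be replaced by them one
    factor at a time. *)
Lemma is_product_on_pairing (uv : distr R) n psi : is_product_on I u v uv ->
  test_function I psi ->
  uv n psi = ((pi2 ^+ 2)^-1)%:C * cintegral nu setT (fun y => conv h k y * mode n psi y).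
Proof.
move=> [a0 [b0 [a02 b02 ua vb uvab]]] tpsi.
have [a ha] := synthesizes_ex T h2; have [b kb] := synthesizes_ex T k2.
have [_ a2 _] := ha; have [_ b2 _] := kb.
have ca2 : square_integrable lam setT (cut T a0) := square_integrable_cut_on a02.
have cb2 : square_integrable lam setT (cut T b0) := square_integrable_cut_on b02.
have aE m phi : test_function I phi ->
    cintegral lam setT (fun p => cut T a0 p * wave m phi p) =
    cintegral lam setT (fun p => a p * wave m phi p).
  move=> tphi; rewrite -(distr_of_funE a0 m tphi) -(ua m phi tphi) (uh m tphi).
  by rewrite (synthesizes_pairing m ha tphi).
have bE m phi : test_function I phi ->
    cintegral lam setT (fun p => cut T b0 p * wave m phi p) =
    cintegral lam setT (fun p => b p * wave m phi p).
  move=> tphi; rewrite -(distr_of_funE b0 m tphi) -(vb m phi tphi) (vk m tphi).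
  by rewrite (synthesizes_pairing m kb tphi).
rewrite -(synthesizes_product n ha kb tpsi) (uvab n psi tpsi) (distr_of_funE _ n tpsi).
transitivity (cintegral lam setT (fun p => cut T a0 p * cut T b0 p * wave n psi p)).
  apply: eq_cintegral => p; rewrite /cut !indicE.
  by case: (p \in _); rewrite ?mulr1 ?mulr0 ?mul0r.
rewrite (product_pairing_eq n ca2 a2 cb2 tpsi aE).
under eq_cintegral do rewrite (mulrC (a _)).
rewrite (product_pairing_eq n cb2 b2 a2 tpsi bE).
by apply: eq_cintegral => p; rewrite (mulrC (b p)).
Qed.

End products.

(** The norms on the time interval are infima, possibly not attained. *)
Lemma le_mul_infimum {R : realType} (x : \bar R) (C A B : R) : 0 < C -> 0 <= A -> 0 <= B ->
  (forall e, 0 < e -> (x <= (C * (A + e) * (B + e))%:E)%E) -> (x <= C%:E * A%:E * B%:E)%E.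
Proof.
move=> C0 A0 B0 H; rewrite -!EFinM; apply/lee_addgt0Pr => e e0.
have K0 : 0 < C * (A + B + 1) by rewrite mulr_gt0//; lra.
pose d := Num.min 1 (e / (C * (A + B + 1))).
have d0 : 0 < d by rewrite lt_min ltr01 divr_gt0.
have d1 : d <= 1 by rewrite ge_min lexx.
have de : d * (C * (A + B + 1)) <= e by rewrite -ler_pdivlMr// ge_min lexx orbT.
apply: (le_trans (H d d0)); rewrite -EFinD lee_fin.
apply: (@le_trans _ _ (C * A * B + d * (C * (A + B + 1)))); last by rewrite lerD2l.
have H1 : 0 <= C * (d * (1 - d)) 
   by apply: mulr_ge0; [exact: ltW|apply: mulr_ge0; [exact: ltW|rewrite subr_ge0]].
lra.
Qed.

Theorem proposition2p3 (R : realType) (eps s gamma : R)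
  (eps_gt0 : 0 < eps) (eps_lt : eps < 1 / 16)
  (s_ge : - (1 / 2) - eps <= s)
  (gamma_gt0 : 0 < gamma) (gamma_le : gamma <= eps) :
  exists C : R, 0 < C /\
    forall T : R, 0 < T ->
    forall u v : distr R,
      inXT s (1 / 2 - eps) T u -> inXT s (1 / 2 - eps) T v ->
      spatial_mean_zero `]0, T[ u -> spatial_mean_zero `]0, T[ v ->
      (exists uv : distr R, is_product_on `]0, T[ u v uv) /\
      (forall uv : distr R, is_product_on `]0, T[ u v uv ->
         (XTnorm s (- (1 / 2) + gamma) T (distr_dx uv) <=
          C%:E * XTnorm s (1 / 2 - eps) T u * XTnorm s (1 / 2 - eps) T v)%E).
Proof.
have [C C0 HC] := bilinear_estimate eps_gt0 eps_lt s_ge gamma_le.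
exists (Num.sqrt C); split; first by rewrite sqrtr_gt0.
move=> T T0 u v uX vX u0 v0.
(* a spectrum that nearly realizes the norm, with its zero mode removed *)
have spec (w : distr R) A : (XTnorm s (1 / 2 - eps) T w < A%:E)%E ->
    spatial_mean_zero `]0, T[ w ->
    exists h : int * measurableTypeR R -> R[i],
    [/\ square_integrable (prod_measure (@countZ R) lebesgue_measure) setT h,
        (forall tau, h (0, tau) = 0),
        (weighted_energy s (1 / 2 - eps) h <= (A ^+ 2)%:E)%E &
        forall n psi, test_function `]0, T[ psi ->
          w n psi = cintegral (prod_measure (@countZ R) lebesgue_measure) setT
            (fun y => h y * mode n psi y)].
  move=> wA w0; have [U [f [Uw Uf fA]]] := XTnorm_lt_spectrum wA.
  have mf := Uf.1; have fE := XFnorm_lt_energy mf fA.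
  have f2 : square_integrable (prod_measure (@countZ R) lebesgue_measure) setT (spectrum f).
    apply: (weighted_energy_square_integrable eps_gt0 eps_lt s_ge (cmeasurable_spectrum mf)).
    by apply: (le_lt_trans fE); exact: ltry.
  have [h [h2 h0 hf hw]] := mean_zero_spectrum s (1 / 2 - eps) Uf Uw w0 f2.
  by exists h; split=> //; exact: le_trans hf fE.
have norm_fin (w : distr R) : inXT s (1 / 2 - eps) T w ->
    exists2 A : R, 0 <= A & XTnorm s (1 / 2 - eps) T w = A%:E.
  move=> wX; exists (fine (XTnorm s (1 / 2 - eps) T w)); first by rewrite fine_ge0// XTnorm_ge0.
  by rewrite fineK// ge0_fin_numE// XTnorm_ge0.
have [A A0 uA] := norm_fin u uX; have [B B0 vB] := norm_fin v vX.
have approx e : 0 < e -> exists h k : int * measurableTypeR R -> R[i],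
    [/\ square_integrable (prod_measure (@countZ R) lebesgue_measure) setT h,
        square_integrable (prod_measure (@countZ R) lebesgue_measure) setT k,
        (forall n psi, test_function `]0, T[ psi ->
          u n psi = cintegral (prod_measure (@countZ R) lebesgue_measure) setT
            (fun y => h y * mode n psi y)),
        (forall n psi, test_function `]0, T[ psi ->
          v n psi = cintegral (prod_measure (@countZ R) lebesgue_measure) setT
            (fun y => k y * mode n psi y)) &
        (weighted_energy s (- (1 / 2) + gamma) (spectrum (dx_conv h k)) <=
         ((Num.sqrt C * (A + e) * (B + e)) ^+ 2)%:E)%E].
  move=> e0; have uAe : (XTnorm s (1 / 2 - eps) T u < (A + e)%:E)%E by rewrite uA lte_fin ltrDl.
  have vBe : (XTnorm s (1 / 2 - eps) T v < (B + e)%:E)%E by rewrite vB lte_fin ltrDl.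
  have [h [h2 h0 hA hu]] := spec u _ uAe u0; have [k [k2 k0 kB kv]] := spec v _ vBe v0.
  exists h, k; split=> //.
  apply: (le_trans (weighted_energy_dx_conv _ _ h2.1 k2.1)).
  apply: (le_trans (HC h k h2.1 k2.1 h0 k0)).
  rewrite !exprMn sqr_sqrtr ?(ltW C0)// -mulrA EFinM.
  apply: lee_wpmul2l; first by rewrite lee_fin ltW.
  by rewrite EFinM; apply: lee_pmul => //; exact: weighted_energy_ge0.
split.
  have [h [k [h2 k2 hu kv _]]] := approx 1 ltr01.
  exact: (is_product_on_ex h2 k2 hu kv).
move=> uv uvP; rewrite uA vB.
apply: le_mul_infimum => //; first by rewrite sqrtr_gt0.
move=> e e0; have [h [k [h2 k2 hu kv hk]]] := approx e e0.
have mdx n : cmeasurable setT (dx_conv h k n) := cmeasurable_dx_conv n h2.1 k2.1.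
pose W : distr R := fun n psi => cintegral lebesgue_measure setT
  (fun tau => dx_conv h k n tau * inverse_fourier psi tau).
have Wf : is_spacetime_fourier W (dx_conv h k) by split.
have r0 : 0 <= Num.sqrt C * (A + e) * (B + e).
  by rewrite !mulr_ge0 ?sqrtr_ge0// addr_ge0// ltW.
have Wle : (Xnorm s (- (1 / 2) + gamma) W <= (Num.sqrt C * (A + e) * (B + e))%:E)%E.
  apply: (le_trans (ereal_inf_lbound _)); last exact: (energy_le_XFnorm mdx r0 hk).
  by exists (dx_conv h k).
apply: (le_trans _ Wle); apply: ereal_inf_lbound; exists W => //; split.
  by apply: (le_lt_trans Wle); exact: ltry.
move=> n psi tpsi; rewrite /distr_dx (is_product_on_pairing h2 k2 hu kv n uvP tpsi).
exact: (dx_conv_pairing n h2 k2 tpsi).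
Qed.
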